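(* Let $(M^{2n},\omega)$ be a symplectic manifold and let $E\to M$ be a vector bundle with a symplectically flat connection with covariant derivative $d_A$ and curvature $F=\Phi\,\omega$, $d_A\Phi=0$. Then the sequence $$0\to P^0(M,E)\xrightarrow{\partial_{+A}}P^1(M,E)\xrightarrow{\partial_{+A}}\cdots\xrightarrow{\partial_{+A}}P^n(M,E)\xrightarrow{-\partial_{+A}\partial_{-A}+\Phi}P^n(M,E)\xrightarrow{-\partial_{-A}}P^{n-1}(M,E)\xrightarrow{-\partial_{-A}}\cdots\xrightarrow{-\partial_{-A}}P^0(M,E)\to0$$ is a differential complex, i.e. the composition of any two consecutive maps is zero.
   Context: $E$ is a finite-rank vector bundle with connection; $d_A:\Omega^k(M,E)\to\Omega^{k+1}(M,E)$ is the associated covariant exterior derivative (locally $d+A\wedge$), and $F\in\Omega^2(M,\mathrm{End}\,E)$ its curvature, $d_A^2\eta=F\wedge\eta$. The connection is symplectically flat if there is $\Phi\in\Omega^0(M,\mathrm{End}\,E)$ with $F=\Phi\,\omega$ and $d_A\Phi=d\Phi+[A,\Phi]=0$. $P^s(M,E)$ ($0\le s\le n$) is the space of primitive $E$-valued $s$-forms, i.e. $\beta\in\Omega^s(M,E)$ with $\omega^{n-s+1}\wedge\beta=0$. Every $\eta\in\Omega^k(M,E)$ has a unique Lefschetz decomposition $\eta=\sum_{r}\omega^r\wedge\beta_{k-2r}$ with $\beta_{k-2r}\in P^{k-2r}(M,E)$ and $\max(0,k-n)\le r\le k/2$. Set $\Pi\eta=\beta_k$ (the $r=0$ term, zero if $k>n$)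 and $L^{-1}\eta=\sum_{r\ge1}\omega^{r-1}\wedge\beta_{k-2r}$. Define $\partial_{+A}=\Pi\,d_A:P^k(M,E)\to P^{k+1}(M,E)$ and $\partial_{-A}=L^{-1}d_A:P^k(M,E)\to P^{k-1}(M,E)$, so that $d_A=\partial_{+A}+\omega\wedge\partial_{-A}$ on primitive forms. *)

(* Defs.v *)
From mathcomp Require Import all_boot all_order all_algebra.
From mathcomp Require Import all_classical all_reals all_analysis.
Import Order.TTheory GRing.Theory Num.Theory.
Import numFieldNormedType.Exports.

Set Implicit Arguments.
Unset Strict Implicit.
Unset Printing Implicit Defensive.

Local Open Scope classical_set_scope.
Local Open Scope ring_scope.

(* Exterior algebra on R^m with coefficients in W: the coefficient of alpha at
   S = {s_1 < ... < s_k} is the W-valued coefficient of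
   dx_{s_1} /\ ... /\ dx_{s_k}. All degrees live in one type. *)
Definition ext (m : nat) (W : Type) := {ffun {set 'I_m} -> W}.

Section ExteriorAlgebra.
Variables (R : realType) (m : nat).

(* dx_S /\ dx_T = (-1)^(shuffle_inv S T) dx_(S :|: T) for disjoint S, T. *)
Definition shuffle_inv (S T : {set 'I_m}) : nat :=
  #|[set u : 'I_m * 'I_m | [&& u.1 \in S, u.2 \in T & (u.2 < u.1)%N]]%SET|.

(* Exterior product along a pairing b of the coefficients. *)
Definition wedge (U V : Type) (W : lmodType R) (b : U -> V -> W)
    (alpha : ext m U) (beta : ext m V) : ext m W :=
  [ffun S : {set 'I_m} => \sum_(T : {set 'I_m} | T \subset S)
     (-1) ^+ shuffle_inv T (S :\: T) *: b (alpha T) (beta (S :\: T))].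

Definition ext1 : ext m R^o := [ffun S : {set 'I_m} => (S == finset.set0)%:R].

(* The 1-form \sum_a v_a dx_a. *)
Definition covec (W : lmodType R) (v : 'I_m -> W) : ext m W :=
  [ffun S : {set 'I_m} => \sum_(a | S == [set a]%SET) v a].

Definition ext_map (V W : Type) (f : V -> W) (alpha : ext m V) : ext m W :=
  [ffun S : {set 'I_m} => f (alpha S)].

(* Pullback along a map y = y(x) with J a b = dy_b / dx_a at the point:
   \sum_T alpha_T dy_T is expanded in the dx_S, where
   dy_b = \sum_a J a b dx_a and dy_T = dy_{t_1} /\ ... /\ dy_{t_k}. *)
Definition pullback (W : lmodType R) (J : 'M[R]_m) (alpha : ext m W) : ext m W :=
  \sum_(T : {set 'I_m})
    let dyT : ext m R^o :=
      \big[wedge (fun r s : R^o => r * s : R^o) / ext1]_(b <- enum T)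
        covec (fun a => J a b : R^o) in
    [ffun S : {set 'I_m} => (dyT S : R) *: alpha T].

Definition eval2 (alpha : ext m R^o) (u v : 'rV[R]_m) : R :=
  \sum_(a < m) \sum_(b < m | (a < b)%N)
    (alpha [set a; b]%SET : R) * (u 0 a * v 0 b - u 0 b * v 0 a).

(* f is C^oo at the points of U (used for U open): every iterated directional
   derivative of f is (Frechet) differentiable there. *)
Definition smooth_on (W : normedModType R) (U : set 'rV[R]_m)
    (f : 'rV[R]_m -> W) : Prop :=
  forall (vs : seq 'rV[R]_m) (x : 'rV[R]_m), U x ->
    differentiable (foldr (fun v g => 'D_v g) f vs) x.

Definition partial (W : normedModType R) (a : 'I_m) (f : 'rV[R]_m -> W)
  : 'rV[R]_m -> W := 'D_(delta_mx 0 a) f.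

Definition extd (W : normedModType R) (alpha : 'rV[R]_m -> ext m W)
    (x : 'rV[R]_m) : ext m W :=
  \sum_(a < m) wedge (fun (r : R) (w : W) => r *: w)
    (covec (fun b => (b == a)%:R : R^o))
    [ffun S : {set 'I_m} => partial a (fun y => alpha y S) x].

End ExteriorAlgebra.

(* The charts cmap i
   and their inverses cinv i are only meaningful on cdom i and its image. *)
Record manifold (R : realType) (m : nat) := Manifold {
  mcarrier :> topologicalType;
  mhausdorff : hausdorff_space mcarrier;
  msecond_countable : @second_countable mcarrier;
  chart : Type;
  cdom : chart -> set mcarrier;
  cmap : chart -> mcarrier -> 'rV[R]_m;
  cinv : chart -> 'rV[R]_m -> mcarrier;
  cdom_open : forall i, open (cdom i);
  cmap_open : forall i, open (cmap i @` cdom i);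
  cdom_cover : forall p, exists i, cdom i p;
  cmapK : forall i p, cdom i p -> cinv i (cmap i p) = p;
  cmap_continuous : forall i p, cdom i p -> {for p, continuous (cmap i)};
  cinv_continuous : forall i p, cdom i p ->
    {for cmap i p, continuous (cinv i)};
  ctrans_smooth : forall i i',
    smooth_on (cmap i @` (cdom i `&` cdom i')) (cmap i' \o cinv i) }.

Section Forms.
Variables (R : realType) (m : nat) (M : manifold R m).

Definition cimg (i : chart M) (D : set M) : set 'rV[R]_m :=
  cmap i @` (cdom i `&` D).

(* J a b = d x'_b / d x_a, with x, x' the coordinates of the charts i, i'. *)
Definition cjac (i i' : chart M) (p : M) : 'M[R]_m :=
  'J (cmap i' \o cinv i) (cmap i p).

(* A family of local differential forms: the component for the chart i and the
   local trivialization j is an ext-valued function of the coordinates of i. *)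
Definition lform (J : Type) (W : Type) := chart M -> J -> 'rV[R]_m -> ext m W.

(* The local components of a global k-form with values in a bundle which is
   trivialized over the open sets V j with fibre W, where rho j j' p converts
   j'-components at p into j-components. Components are extended by 0 outside
   the image of cdom i `&` V j, so that equality of lforms is equality of
   forms. *)
Definition is_form (J : Type) (W : normedModType R) (V : J -> set M)
    (rho : J -> J -> M -> W -> W) (k : nat) (eta : lform J W) : Prop :=
  [/\ forall i j (S : {set 'I_m}), smooth_on (cimg i (V j)) (fun x => eta i j x S),
      forall i j x (S : {set 'I_m}), #|S| <> k -> eta i j x S = 0,
      forall i j x, ~ cimg i (V j) x -> eta i j x = 0
    & forall i i' j j' p, cdom i p -> cdom i' p -> V j p -> V j' p ->
        eta i j (cmap i p) =
        ext_map (rho j j' p) (pullback (cjac i i' p) (eta i' j' (cmap i' p)))].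

Definition fextd (J : Type) (W : normedModType R) (V : J -> set M)
    (eta : lform J W) : lform J W :=
  fun i j x => if `[< cimg i (V j) x >] then extd (eta i j) x else 0.

Definition fwedge (J U V : Type) (W : lmodType R) (b : U -> V -> W)
    (alpha : lform J U) (beta : lform J V) : lform J W :=
  fun i j x => wedge b (alpha i j x) (beta i j x).

(* Ordinary forms: a single trivialization, defined everywhere. *)
Definition triv_dom (_ : unit) : set M := setT.

Definition is_scalar_form : nat -> lform unit R^o -> Prop :=
  is_form triv_dom (fun _ _ _ r => r).

Definition symplectic (omega : lform unit R^o) : Prop :=
  [/\ is_scalar_form 2 omega,
      fextd triv_dom omega = (fun _ _ _ => 0)
    & forall i p, cdom i p -> forall u,
        (forall v, eval2 (omega i tt (cmap i p)) u v = 0) -> u = 0].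

Definition Lef (J : Type) (W : lmodType R) (omega : lform unit R^o)
    (eta : lform J W) : lform J W :=
  fun i j x =>
    wedge (fun (r : R) (w : W) => r *: w) (omega i tt x) (eta i j x).

End Forms.

(* Smooth rank N vector bundles over M: vector spaces fiber p with local
   trivializations frame j p : R^N -> fiber p, p in tdom j, whose transition
   functions are smooth. *)
Record vbundle (R : realType) (m : nat) (M : manifold R m) (N : nat) := VBundle {
  fiber : M -> lmodType R;
  tindex : Type;
  tdom : tindex -> set M;
  frame : tindex -> forall p : M, {linear 'cV[R]_N -> fiber p};
  trans : tindex -> tindex -> M -> 'M[R]_N;
  tdom_open : forall j, open (tdom j);
  tdom_cover : forall p, exists j, tdom j p;
  frame_bij : forall j p, tdom j p -> bijective (frame j p);
  transP : forall j j' p, tdom j p -> tdom j' p ->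
    forall v, frame j' p v = frame j p (trans j j' p *m v);
  trans_smooth : forall i j j',
    smooth_on (cimg i (tdom j `&` tdom j')) (trans j j' \o cinv i) }.

Section BundleForms.
Variables (R : realType) (m : nat) (M : manifold R m).
Variables (N : nat) (E : vbundle M N).

Definition Eform : Type := lform M (tindex E) 'cV[R]_N.
Definition Endform : Type := lform M (tindex E) 'M[R]_N.

Definition is_Eform : nat -> Eform -> Prop :=
  is_form (@tdom _ _ _ _ E) (fun j j' p v => trans j j' p *m v).

Definition is_Endform : nat -> Endform -> Prop :=
  is_form (@tdom _ _ _ _ E)
    (fun j j' p B => trans j j' p *m B *m trans j' j p).

(* Connections on E, by their connection matrices (d + A in each trivialization):
   A' = g^-1 A g + g^-1 dg for g = trans j j', A = A_j, A' = A_j'. *)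
Definition is_connection (A : Endform) : Prop :=
  [/\ forall i j (S : {set 'I_m}), smooth_on (cimg i (tdom j)) (fun x => A i j x S),
      forall i j x (S : {set 'I_m}), #|S| <> 1%N -> A i j x S = 0,
      forall i j x, ~ cimg i (tdom j) x -> A i j x = 0
    & forall i i' j j' p, cdom i p -> cdom i' p -> tdom j p -> tdom j' p ->
        pullback (cjac i i' p) (A i' j' (cmap i' p)) =
        ext_map (fun B => trans j' j p *m B *m trans j j' p)
          (A i j (cmap i p)) +
        ext_map (fun B => trans j' j p *m B)
          (covec (fun a => partial a (trans j j' \o cinv i) (cmap i p)))].

Definition dA (A : Endform) (eta : Eform) : Eform :=
  (fextd (@tdom _ _ _ _ E) eta + fwedge mulmx A eta : Eform).

(* The form F = dA + A /\ A with d_A (d_A eta) = F /\ eta. *)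
Definition curvature (A : Endform) : Endform :=
  (fextd (@tdom _ _ _ _ E) A + fwedge mulmx A A : Endform).

(* d_A Phi = d Phi + [A, Phi] for Phi in Omega^0(M, End E). *)
Definition dA_End0 (A Phi : Endform) : Endform :=
  (fextd (@tdom _ _ _ _ E) Phi + (fwedge mulmx A Phi - fwedge mulmx Phi A)
   : Endform).

Definition symplectically_flat (omega : lform M unit R^o) (A Phi : Endform)
  : Prop :=
  [/\ is_Endform 0 Phi, curvature A = Lef omega Phi & dA_End0 A Phi = 0].

End BundleForms.

Section PrimitiveComplex.
Variables (R : realType) (n : nat) (M : manifold R n.*2).
Variables (omega : lform M unit R^o) (N : nat) (E : vbundle M N).

Definition primitive (s : nat) : set (Eform E) :=
  [set beta | [/\ (s <= n)%N, is_Eform s beta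
                & iter (n - s).+1 (Lef omega) beta = 0]].

(* eta = \sum_r omega^r /\ beta r is the Lefschetz decomposition of the k-form
   eta; beta is set to 0 outside the range max(0, k - n) <= r <= k / 2, which
   makes it unique as a function on nat. *)
Definition is_lefschetz (k : nat) (eta : Eform E) (beta : nat -> Eform E)
  : Prop :=
  [/\ forall r, (k - n <= r <= k./2)%N -> primitive (k - r.*2) (beta r),
      forall r, ~~ (k - n <= r <= k./2)%N -> beta r = 0
    & eta = \sum_(k - n <= r < (k./2).+1) iter r (Lef omega) (beta r)].

Definition lefschetz (k : nat) (eta : Eform E) : nat -> Eform E :=
  xget 0 [set beta | is_lefschetz k eta beta].

Definition Pi_prim (k : nat) (eta : Eform E) : Eform E :=
  if (k <= n)%N then lefschetz k eta 0%N else 0.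

Definition Linv (k : nat) (eta : Eform E) : Eform E :=
  \sum_(maxn 1 (k - n) <= r < (k./2).+1)
    iter r.-1 (Lef omega) (lefschetz k eta r).

Variables (A Phi : Endform E).

Definition dplus (s : nat) (beta : Eform E) : Eform E :=
  Pi_prim s.+1 (dA A beta).

Definition dminus (s : nat) (beta : Eform E) : Eform E :=
  Linv s.+1 (dA A beta).

(* P^0, ..., P^n, P^n, ..., P^0 in positions 0, ..., 2n + 1, then 0. *)
Definition cplx_space (k : nat) : set (Eform E) :=
  if (k <= n)%N then primitive k
  else if (k <= n.*2.+1)%N then primitive (n.*2.+1 - k)
  else [set 0].

Definition cplx_map (k : nat) (beta : Eform E) : Eform E :=
  if (k < n)%N then dplus k beta
  else if k == n then
    - dplus n.-1 (dminus n beta) + fwedge mulmx Phi beta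
  else if (k <= n.*2)%N then - dminus (n.*2.+1 - k) beta
  else 0.

End PrimitiveComplex.

Arguments cplx_space {R n M} omega {N} E k.

Definition differential_complex (V : zmodType) (C : nat -> set V)
    (D : nat -> V -> V) : Prop :=
  (forall k x, C k x -> C k.+1 (D k x)) /\
  (forall k x, C k x -> D k.+1 (D k x) = 0).

(* Main.v *)
Require Import Defs.
From HB Require Import structures.
From mathcomp Require Import all_boot all_order all_algebra.
From mathcomp Require Import all_classical all_reals all_analysis.
From mathcomp Require Import perm ring lra zify.
Import Order.TTheory GRing.Theory Num.Theory.
Import numFieldNormedType.Exports.

Set Implicit Arguments.
Unset Strict Implicit.
Unset Printing Implicit Defensive.

Local Open Scope ring_scope.

(** At each point the exterior algebra carries the operators [e_a] = (dx_a /\ -)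
    and [i_a] (contraction).  With [L] = (omega /\ -) and [Lam] = sum pi_ab i_a i_b,
    where pi is the inverse of the matrix of omega, the anticommutation
    relations give [Lam L - L Lam = 2 (n - k)] on degree [k].  This makes [L^j]
    injective on degree [k] for [j <= n - k], and a form [gamma] of degree
    [s + 1] killed by [L^(n-s+1)] decomposes as [beta0 + L beta1] with
    [beta1 = Lam gamma / (2 (n - s + 1))], which is smooth; by injectivity it does
    not depend on the chart.  It applies to [gamma = d_A beta] for a primitive
    [beta] of degree [s], because [d_A] commutes with [L].  Comparing the Lefschetz
    components of [d_A (d_A beta) = L (Phi beta)] gives [d+ d+ = 0], [d- d- = 0] and
    [d- d+ + d+ d- = Phi], and [d_A Phi = 0] makes [Phi] commute with [d+] and [d-]. *)

(** * Exterior algebra *)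

(** The two projections are defined by choosing a Lefschetz decomposition, so every computation with
    [dplus] and [dminus] rests on existence and uniqueness. Uniqueness follows from injectivity of
    the powers of L. Existence is established for d_A of a primitive form, where two terms suffice
    because L^(n-s+1) kills d_A beta. The constant 2(n-s+1) is the value of 2(n-k) at k = s-1, the
    degree of beta1. The range of uniqueness shapes the relations. In degree s+2, a sum u + L v +
    L^2 w = 0 with primitive u, v, w determines the component of index r when s+2 <= n+r. Hence d-
    d+ + d+ d- = Phi is obtained for s < n only, while d- d- = 0 holds for all s <= n. Both
    composites with the middle map are therefore reduced to the relation in degree n-1. For d_A to
    send forms to forms, d must commute with pullback. This needs the coordinate forms dy_b to be
    closed, hence the symmetry of second derivatives, which is derived from the mean value
    theorem. *)

Section Bilinear.
Variable R : realType.

Definition bilin (U V W : lmodType R) (b : U -> V -> W) : Prop :=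
  (forall v, linear (b^~ v)) /\ (forall u, linear (b u)).

Variables (U V W : lmodType R) (b : U -> V -> W).
Hypothesis bb : bilin b.

Lemma bilinDl u u' v : b (u + u') v = b u v + b u' v.
Proof. by have := bb.1 v 1 u u'; rewrite /= !scale1r. Qed.

Lemma bilinDr u v v' : b u (v + v') = b u v + b u v'.
Proof. by have := bb.2 u 1 v v'; rewrite !scale1r. Qed.

Lemma bilin0l v : b 0 v = 0.
Proof. by apply: (addrI (b 0 v)); rewrite -bilinDl !addr0. Qed.

Lemma bilin0r u : b u 0 = 0.
Proof. by apply: (addrI (b u 0)); rewrite -bilinDr !addr0. Qed.

Lemma bilinZl r u v : b (r *: u) v = r *: b u v.
Proof. by have := bb.1 v r u 0; rewrite /= bilin0l !addr0. Qed.

Lemma bilinZr r u v : b u (r *: v) = r *: b u v.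
Proof. by have := bb.2 u r v 0; rewrite /= bilin0r !addr0. Qed.

Lemma bilin_suml I (s : seq I) (P : pred I) (F : I -> U) v :
  b (\sum_(i <- s | P i) F i) v = \sum_(i <- s | P i) b (F i) v.
Proof. exact: (big_morph (b^~ v) (fun u u' => bilinDl u u' v) (bilin0l v)). Qed.

Lemma bilin_sumr I (s : seq I) (P : pred I) (F : I -> V) u :
  b u (\sum_(i <- s | P i) F i) = \sum_(i <- s | P i) b u (F i).
Proof. exact: (big_morph (b u) (fun v v' => bilinDr u v v') (bilin0r u)). Qed.

End Bilinear.

Section Pairings.
Variable R : realType.

Lemma bilin_scale (W : lmodType R) : bilin (fun (r : R^o) (w : W) => r *: w).
Proof.
by split=> [v a x y|u a x y] /=; rewrite ?scalerDl ?scalerDr !scalerA // mulrC.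
Qed.

Lemma bilin_mulmx p q r :
  bilin (fun (A : 'M[R]_(p, q)) (B : 'M[R]_(q, r)) => A *m B).
Proof.
by split=> [v a x y|u a x y] /=;
  rewrite ?mulmxDl ?mulmxDr -?scalemxAl -?scalemxAr.
Qed.

End Pairings.
Arguments bilin_scale {R W}.
Arguments bilin_mulmx {R p q r}.

(** * Shuffle signs and associativity of the wedge product *)

Section Shuffle.
Variable m : nat.
Implicit Types S T U : {set 'I_m}.

Lemma shuffle_invE S T :
  shuffle_inv S T = (\sum_(u in S) \sum_(v in T) (v < u))%N.
Proof.
rewrite /shuffle_inv -sum1_card pair_big_dep /= big_mkcond /=.
rewrite [RHS]big_mkcond /=; apply: eq_bigr => -[u v] _ /=.
by rewrite inE /=; case: (u \in S); case: (v \in T); case: (v < u)%N.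
Qed.

Lemma shuffle_invUl S S' T : [disjoint S & S'] ->
  shuffle_inv (S :|: S') T = (shuffle_inv S T + shuffle_inv S' T)%N.
Proof.
by move=> d; rewrite !shuffle_invE -bigU //=; apply: eq_bigl => u; rewrite !inE.
Qed.

Lemma shuffle_invUr S T T' : [disjoint T & T'] ->
  shuffle_inv S (T :|: T') = (shuffle_inv S T + shuffle_inv S T')%N.
Proof.
move=> d; rewrite !shuffle_invE -big_split /=.
by apply: eq_bigr => u _; rewrite -bigU //=; apply: eq_bigl => v; rewrite !inE.
Qed.

Lemma shuffle_inv11 (a b : 'I_m) :
  shuffle_inv [set a]%SET [set b]%SET = (b < a)%N.
Proof. by rewrite shuffle_invE !big_set1. Qed.

End Shuffle.

Section Wedge.
Variables (R : realType) (m : nat).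
Implicit Types S T P Q : {set 'I_m}.

(** Structure constants of the exterior algebra: the coefficient of dx_S in dx_T /\ dx_P. With them
    a wedge product becomes a sum over all pairs T, P, in which sums can be exchanged without
    tracking inclusions. *)
Definition wedge_sign T P S : R :=
  if [disjoint T & P] && (T :|: P == S) then (-1) ^+ shuffle_inv T P else 0.

(** Both sides are the coefficient of dx_S in dx_T /\ dx_P /\ dx_Q. Only U = T :|: P, respectively U
    = P :|: Q, contributes, and the inversion counts agree because [shuffle_inv] is additive over
    disjoint unions in each argument. *)
Lemma wedge_signM S T P Q :
  \sum_U wedge_sign T P U * wedge_sign U Q S =
  \sum_U wedge_sign T U S * wedge_sign P Q U.
Proof.
rewrite (bigD1 (T :|: P)) //= [X in _ + X]big1 ?addr0; last first.
  move=> U /negPf nU; rewrite /wedge_sign [T :|: P == U]eq_sym nU andbF.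
  by rewrite mul0r.
rewrite [RHS](bigD1 (P :|: Q)) //= [X in _ + X]big1 ?addr0; last first.
  move=> U /negPf nU; rewrite /wedge_sign [P :|: Q == U]eq_sym nU andbF.
  by rewrite mulr0.
rewrite /wedge_sign !eqxx !andbT finset.setUA.
rewrite -!finset.setI_eq0 finset.setIUl finset.setIUr !finset.setU_eq0 !finset.setI_eq0.
have [dTP|//] := boolP [disjoint T & P]; last by rewrite mul0r mul0r.
have [dPQ|//] := boolP [disjoint P & Q]; last by rewrite andbF !(mulr0, mul0r).
have [dTQ|//] := boolP [disjoint T & Q]; last by rewrite !(mulr0, mul0r).
have [_|//] := eqVneq (T :|: P :|: Q) S; last by rewrite !(mulr0, mul0r).
by rewrite /= -!exprD shuffle_invUl // shuffle_invUr //; congr (_ ^+ _); lia.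
Qed.

Lemma wedgeE (U V : Type) (W : lmodType R) (b : U -> V -> W) alpha beta S :
  wedge b alpha beta S = \sum_T \sum_P
    wedge_sign T P S *: b (alpha T) (beta P).
Proof.
rewrite ffunE big_mkcond /=; apply: eq_bigr => T _.
case: ifPn => [TS|nTS]; last first.
  rewrite big1 // => P _; rewrite /wedge_sign; case: ifP; last by rewrite scale0r.
  by case/andP=> _ /eqP E; rewrite -E finset.subsetUl in nTS.
rewrite (bigD1 (S :\: T)) //= [X in _ + X]big1 ?addr0.
  have d : [disjoint T & S :\: T].
    by rewrite -finset.setI_eq0 finset.setIDA finset.setDIl finset.setDv finset.set0I.
  have E : T :|: S :\: T = S.
    apply/setP => x; rewrite !inE; have := fintype.subsetP TS x.
    by case: (x \in T) => //= ->.
  by rewrite /wedge_sign d E eqxx.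
move=> P nP; rewrite /wedge_sign; case: ifP; last by rewrite scale0r.
case/andP=> d /eqP E; case/eqP: nP; rewrite -E.
rewrite finset.setDUl finset.setDv finset.set0U; apply/esym/finset.setDidPl.
by rewrite disjoint_sym.
Qed.

End Wedge.

Section WedgeAlgebra.
Variables (R : realType) (m : nat).
Implicit Types S T : {set 'I_m}.

Lemma bilin_wedge (U V W : lmodType R) (b : U -> V -> W) : bilin b ->
  bilin (wedge b : ext m U -> ext m V -> ext m W).
Proof.
move=> bb; split=> [beta r x y|alpha r x y] /=; apply/ffunP => S.
  rewrite !ffunE scaler_sumr -big_split /=; apply: eq_bigr => T _.
  rewrite !ffunE (bilinDl bb) (bilinZl bb) scalerDr !scalerA.
  by rewrite mulrC.
rewrite !ffunE scaler_sumr -big_split /=; apply: eq_bigr => T _.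
rewrite !ffunE (bilinDr bb) (bilinZr bb) scalerDr !scalerA.
by rewrite mulrC.
Qed.

(** Four separate pairings, so that one statement covers scalars, matrices and vectors in any
    compatible combination. *)
Lemma wedgeA (U V W X Y Z : lmodType R) (b1 : X -> W -> Z) (b2 : U -> V -> X)
    (b3 : U -> Y -> Z) (b4 : V -> W -> Y) :
  bilin b1 -> bilin b3 ->
  (forall u v w, b1 (b2 u v) w = b3 u (b4 v w)) ->
  forall (alpha : ext m U) (beta : ext m V) (gamma : ext m W),
  wedge b1 (wedge b2 alpha beta) gamma = wedge b3 alpha (wedge b4 beta gamma).
Proof.
move=> bb1 bb3 b1234 alpha beta gamma; apply/ffunP => S; rewrite !wedgeE.
pose f T P Q := b1 (b2 (alpha T) (beta P)) (gamma Q).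
transitivity (\sum_T \sum_P \sum_Q
    (\sum_H wedge_sign R T P H * wedge_sign R H Q S) *: f T P Q).
  under eq_bigr => H _ do under eq_bigr => Q _ do
    rewrite wedgeE (bilin_suml bb1) scaler_sumr.
  under eq_bigr => H _ do rewrite exchange_big.
  rewrite exchange_big; apply: eq_bigr => T _ /=.
  under eq_bigr => H _ do under eq_bigr => Q _ do
    rewrite (bilin_suml bb1) scaler_sumr.
  under eq_bigr => H _ do rewrite exchange_big.
  rewrite exchange_big; apply: eq_bigr => P _ /=.
  rewrite exchange_big; apply: eq_bigr => Q _ /=.
  rewrite scaler_suml; apply: eq_bigr => H _.
  by rewrite (bilinZl bb1) scalerA mulrC.
apply: eq_bigr => T _.
under [RHS]eq_bigr => H _ do rewrite wedgeE (bilin_sumr bb3) scaler_sumr.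
rewrite [RHS]exchange_big; apply: eq_bigr => P _ /=.
under [RHS]eq_bigr => H _ do rewrite (bilin_sumr bb3) scaler_sumr.
rewrite [RHS]exchange_big; apply: eq_bigr => Q _ /=.
rewrite wedge_signM scaler_suml; apply: eq_bigr => H _.
by rewrite (bilinZr bb3) scalerA /f b1234.
Qed.

End WedgeAlgebra.
Arguments bilin_wedge {R m U V W b} _.

(** * Exterior multiplication and contraction operators *)

Section Operators.
Variables (R : realType) (m : nat).
Implicit Types (W : lmodType R) (a b : 'I_m) (S : {set 'I_m}).

(** The operator e_a; [ext_contr] is i_a. The exponent counts the indices below a, that is, the
    transpositions that bring dx_a from the front to its place. *)
Definition ext_mul W a (alpha : ext m W) : ext m W :=
  [ffun S : {set 'I_m} => if a \in S
     then (-1) ^+ shuffle_inv [set a]%SET (S :\ a) *: alpha (S :\ a) else 0].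

Definition ext_contr W a (alpha : ext m W) : ext m W :=
  [ffun S : {set 'I_m} => if a \in S then 0
     else (-1) ^+ shuffle_inv [set a]%SET S *: alpha (a |: S)].

Lemma ext_mul_is_linear W a : linear (@ext_mul W a).
Proof.
move=> r x y; apply/ffunP => S; rewrite !ffunE.
case: ifP => _; last by rewrite scaler0 addr0.
by rewrite scalerDr !scalerA mulrC.
Qed.

HB.instance Definition _ W a :=
  GRing.isLinear.Build R (ext m W) (ext m W) _ (@ext_mul W a)
    (@ext_mul_is_linear W a).

Lemma ext_contr_is_linear W a : linear (@ext_contr W a).
Proof.
move=> r x y; apply/ffunP => S; rewrite !ffunE.
case: ifP => _; first by rewrite scaler0 addr0.
by rewrite scalerDr !scalerA mulrC.
Qed.

HB.instance Definition _ W a :=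
  GRing.isLinear.Build R (ext m W) (ext m W) _ (@ext_contr W a)
    (@ext_contr_is_linear W a).

Lemma wedge_covec W (v : 'I_m -> R^o) (beta : ext m W) :
  wedge (fun (r : R) (w : W) => r *: w) (covec v) beta =
  \sum_a v a *: ext_mul a beta.
Proof.
apply/ffunP => S; rewrite ffunE sum_ffunE.
rewrite (eq_bigr (fun T : {set 'I_m} => \sum_(a | T == [set a]%SET)
   (-1) ^+ shuffle_inv T (S :\: T) *: (v a *: beta (S :\: T)))); last first.
  by move=> T _; rewrite ffunE scaler_suml scaler_sumr.
rewrite (exchange_big_dep xpredT) //=; apply: eq_bigr => a _.
rewrite !ffunE; case: ifPn => aS.
  rewrite (big_pred1 [set a]%SET) //=; first by rewrite !scalerA mulrC.
  move=> T /=; case: eqVneq => [->|]; rewrite ?andbF // andbT.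
  by rewrite finset.sub1set.
rewrite scaler0 big_pred0 // => T /=; case: eqVneq => [->|]; rewrite ?andbF //.
by rewrite finset.sub1set (negPf aS).
Qed.

Lemma wedge_covec1 W a (beta : ext m W) :
  wedge (fun (r : R) (w : W) => r *: w)
    (covec (fun b => (b == a)%:R : R^o)) beta = ext_mul a beta.
Proof.
rewrite wedge_covec (bigD1 a) //= eqxx scale1r big1 ?addr0 // => b /negPf->.
by rewrite scale0r.
Qed.

Lemma shuffle_inv1_setD1 a b S : b \in S ->
  shuffle_inv [set a]%SET S = ((b < a) + shuffle_inv [set a]%SET (S :\ b))%N.
Proof.
move=> bS; rewrite -{1}(finset.setD1K bS) shuffle_invUr ?shuffle_inv11 //.
by rewrite -finset.setI_eq0 finset.setIDA finset.setDIl finset.setDv finset.set0I.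
Qed.

Lemma shuffle_inv1_setU1 a b S : b \notin S ->
  shuffle_inv [set a]%SET (b |: S) = ((b < a) + shuffle_inv [set a]%SET S)%N.
Proof.
move=> bS; rewrite (shuffle_inv1_setD1 a (finset.setU11 b S)).
by rewrite finset.setU1K.
Qed.

Lemma expN1_opp (i j : nat) : odd i = ~~ odd j -> (-1) ^+ i = - (-1) ^+ j :> R.
Proof.
by move=> ij; rewrite -signr_odd ij -(signr_odd _ j) signrN.
Qed.

(** Deleting b from the index set lowers the count for a exactly when b < a. For a != b exactly one
    of a < b and b < a holds, so the two orders differ by one transposition. *)
Lemma ext_mulC W a b (alpha : ext m W) :
  ext_mul a (ext_mul b alpha) = - ext_mul b (ext_mul a alpha).
Proof.
apply/ffunP => S; rewrite !ffunE !inE.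
have [->|ab] := eqVneq a b.
  by rewrite ?eqxx /= ?scaler0 ?if_same ?oppr0.
rewrite /=.
case: ifPn => aS; case: ifPn => bS; rewrite ?scaler0 ?oppr0 //.
rewrite finset.setDDl finset.setUC -finset.setDDl !scalerA -scaleNr.
congr (_ *: _); rewrite -!exprD.
rewrite (@shuffle_inv1_setD1 a b) ?(@shuffle_inv1_setD1 b a (S :\ b))
  ?inE ?aS ?bS ?ab ?[b == a]eq_sym ?ab //.
rewrite finset.setDDl finset.setUC -finset.setDDl.
apply: expN1_opp; rewrite !oddD.
move: ab; rewrite neq_ltn => /orP[]ab; rewrite ab ltnNge (ltnW ab) /=;
by do 2!case: (odd _).
Qed.

(** For a = b, membership of a in S decides which of the two composites vanishes, and the signs of
    the other one square to 1. For a != b the parity argument of [ext_mulC] applies. *)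
Lemma ext_contr_mul W a b (alpha : ext m W) :
  ext_contr a (ext_mul b alpha) =
  (a == b)%:R *: alpha - ext_mul b (ext_contr a alpha).
Proof.
apply/ffunP => S; rewrite !ffunE !inE.
have [->|ab] := eqVneq a b.
  rewrite ?eqxx scale1r /=; case: ifPn => bS.
    rewrite finset.setD1K // scalerA -exprD addnn -signr_odd odd_double.
    by rewrite scale1r subrr.
  rewrite finset.setU1K // scalerA -exprD addnn -signr_odd odd_double.
  by rewrite scale1r subr0.
rewrite scale0r add0r /=.
case: ifPn => aS; case: ifPn => bS; rewrite ?scaler0 ?oppr0 //.
have -> : (a |: S) :\ b = a |: S :\ b.
  by apply/setP => x; rewrite !inE; case: (eqVneq x a) => [->|]//=; rewrite ab.
rewrite !scalerA -scaleNr; congr (_ *: _); rewrite -!exprD.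
rewrite (@shuffle_inv1_setD1 a b) // (@shuffle_inv1_setU1 b a) ?inE ?negb_and ?aS ?orbT//.
apply: expN1_opp; rewrite !oddD.
move: ab; rewrite neq_ltn => /orP[]ab; rewrite ab ltnNge (ltnW ab) /=;
by do 2!case: (odd _).
Qed.

End Operators.

(** * Homogeneous forms and the number operator *)

Section Homogeneous.
Variables (R : realType) (m : nat).
Implicit Types (U V W : lmodType R) (a b : 'I_m) (S : {set 'I_m}).

Definition homog W k (alpha : ext m W) :=
  forall S : {set 'I_m}, #|S| <> k -> alpha S = 0.

Lemma homog0 W k : homog k (0 : ext m W).
Proof. by move=> S _; rewrite ffunE. Qed.

Lemma homogD W k (alpha beta : ext m W) :
  homog k alpha -> homog k beta -> homog k (alpha + beta).
Proof. by move=> ha hb S Sk; rewrite ffunE ha // hb // addr0. Qed.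

Lemma homogZ W k r (alpha : ext m W) : homog k alpha -> homog k (r *: alpha).
Proof. by move=> ha S Sk; rewrite ffunE ha // scaler0. Qed.

Lemma homogN W k (alpha : ext m W) : homog k alpha -> homog k (- alpha).
Proof. by move=> ha S Sk; rewrite ffunE ha // oppr0. Qed.

Lemma homogB W k (alpha beta : ext m W) :
  homog k alpha -> homog k beta -> homog k (alpha - beta).
Proof. by move=> ha hb; apply/homogD/homogN. Qed.

Lemma homog_sum W k I (s : seq I) (P : pred I) (F : I -> ext m W) :
  (forall i, P i -> homog k (F i)) -> homog k (\sum_(i <- s | P i) F i).
Proof.
move=> hF; apply: (big_ind (@homog W k)) => //; first exact: homog0.
by move=> x y; apply: homogD.
Qed.

Lemma homog_mul W k a (alpha : ext m W) :
  homog k alpha -> homog k.+1 (ext_mul a alpha).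
Proof.
move=> ha S Sk; rewrite ffunE; case: ifP => // aS; rewrite ha ?scaler0 // => E.
by apply: Sk; rewrite (cardsD1 a) aS E.
Qed.

Lemma homog_contr W k a (alpha : ext m W) :
  homog k.+1 alpha -> homog k (ext_contr a alpha).
Proof.
move=> ha S Sk; rewrite ffunE; case: ifPn => // aS; rewrite ha ?scaler0 //.
by rewrite cardsU1 aS => -[].
Qed.

Lemma contr_homog0 W a (alpha : ext m W) :
  homog 0 alpha -> ext_contr a alpha = 0.
Proof.
move=> ha; apply/ffunP => S; rewrite !ffunE; case: ifPn => // aS.
by rewrite ha ?scaler0 // cardsU1 aS.
Qed.

Lemma homog_wedge U V W (b : U -> V -> W) j k alpha beta :
  bilin b -> homog j alpha -> homog k beta ->
  homog (j + k) (wedge b alpha beta : ext m W).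
Proof.
move=> bb ha hb S Sk; rewrite ffunE big1 // => T TS.
have [Tj|/eqP Tj] := eqVneq #|T| j; last by rewrite ha // bilin0l // scaler0.
rewrite hb ?(bilin0r bb) ?scaler0 // => E; apply: Sk.
by rewrite -(cardsID T) (finset.setIidPr TS) Tj E.
Qed.

(** Each e_a i_a is the projection onto the index sets containing a, so a coefficient at S is
    counted once for each element of S. *)
Lemma sum_mul_contr W k (alpha : ext m W) : homog k alpha ->
  \sum_a ext_mul a (ext_contr a alpha) = k%:R *: alpha.
Proof.
move=> ha; apply/ffunP => S; rewrite sum_ffunE.
rewrite (eq_bigr (fun a => if a \in S then alpha S else 0)); last first.
  move=> a _; rewrite !ffunE; case: ifPn => // aS.
  rewrite !inE ?eqxx /= finset.setD1K // scalerA -exprD addnn -signr_odd odd_double.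
  by rewrite scale1r.
rewrite -big_mkcond /= sumr_const ffunE -scaler_nat.
by have [->//|/eqP Sk] := eqVneq #|S| k; rewrite ha // !scaler0.
Qed.

(** Dividing the number operator by the degree writes a form of positive degree as a combination of
    e_a applied to forms of lower degree. An identity compatible with sums, scalars and e_a thus
    only has to be checked in degree 0. *)
Lemma homog_ind W (P : ext m W -> Prop) :
  (forall alpha beta, P alpha -> P beta -> P (alpha + beta)) ->
  (forall r alpha, P alpha -> P (r *: alpha)) ->
  (forall alpha, homog 0 alpha -> P alpha) ->
  (forall k a alpha, homog k alpha -> P alpha -> P (ext_mul a alpha)) ->
  forall k alpha, homog k alpha -> P alpha.
Proof.
move=> PD PZ P0 PM; elim=> [//|k IH] alpha ha.
have -> : alpha = k.+1%:R^-1 *: \sum_a ext_mul a (ext_contr a alpha).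
  by rewrite (sum_mul_contr ha) scalerA mulVf ?pnatr_eq0 // scale1r.
apply: (PZ); apply: big_ind => //; first exact/P0/homog0.
by move=> a _; apply: (PM k); [|apply: IH]; exact: homog_contr.
Qed.

Lemma wedge_homog0 U V W (b : U -> V -> W) (alpha : ext m U) (beta : ext m V) :
  bilin b -> homog 0 alpha ->
  wedge b alpha beta = ext_map (b (alpha finset.set0)) beta.
Proof.
move=> bb ha; apply/ffunP => S; rewrite !ffunE (bigD1 finset.set0) ?finset.sub0set //=.
rewrite big1 ?addr0.
  by rewrite finset.setD0 shuffle_invE big_set0 scale1r.
move=> T /andP[_ T0]; rewrite ha ?(bilin0l bb) ?scaler0 //.
by apply/eqP; rewrite cards_eq0.
Qed.

Lemma wedge_mull U V W (b : U -> V -> W) a (alpha : ext m U) (beta : ext m V) :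
  bilin b -> wedge b (ext_mul a alpha) beta = ext_mul a (wedge b alpha beta).
Proof.
move=> bb; rewrite -!wedge_covec1; apply: wedgeA => //; first exact: bilin_scale.
by move=> u v w; rewrite (bilinZl bb).
Qed.

Lemma ext_map_mul V W (f : {linear V -> W}) a (beta : ext m V) :
  ext_map f (ext_mul a beta) = ext_mul a (ext_map f beta).
Proof.
by apply/ffunP => S; rewrite !ffunE; case: ifP; rewrite ?linear0 // linearZ.
Qed.

Lemma ext_map_eq V W (f g : V -> W) (beta : ext m V) :
  f =1 g -> ext_map f beta = ext_map g beta.
Proof. by move=> fg; apply/ffunP => S; rewrite !ffunE. Qed.

Lemma bilin_linear U V W (b : U -> V -> W) u : bilin b ->
  exists f : {linear V -> W}, f =1 b u.
Proof.
move=> bb; pose bM := GRing.isLinear.Build _ _ _ _ _ (bb.2 u).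
by pose bL : {linear V -> W} := HB.pack (b u) bM; exists bL.
Qed.

Lemma wedge_mulr U V W (b : U -> V -> W) k a (alpha : ext m U) (beta : ext m V) :
  bilin b -> homog k alpha ->
  ext_mul a (wedge b alpha beta) =
  (-1) ^+ k *: wedge b alpha (ext_mul a beta).
Proof.
move=> bb; have wb := bilin_wedge (m := m) bb.
elim: k alpha => [|k IH] alpha ha.
  rewrite !wedge_homog0 // scale1r; have [f fb] := bilin_linear (alpha finset.set0) bb.
  by rewrite -!(ext_map_eq _ fb) ext_map_mul.
have -> : alpha = k.+1%:R^-1 *: \sum_a ext_mul a (ext_contr a alpha).
  by rewrite (sum_mul_contr ha) scalerA mulVf ?pnatr_eq0 // scale1r.
rewrite !(bilinZl wb) linearZ /= scalerA mulrC -scalerA; congr (_ *: _).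
rewrite !(bilin_suml wb) linear_sum scaler_sumr; apply: eq_bigr => c _ /=.
rewrite !wedge_mull // ext_mulC IH; last exact: homog_contr.
by rewrite linearZ /= exprS mulN1r scaleNr.
Qed.

End Homogeneous.

(** * Lefschetz operators *)

Section Lefschetz.
Variables (R : realType) (m : nat) (W : lmodType R).
Implicit Types (a b c : 'I_m) (S : {set 'I_m}).
Variable omega : ext m R^o.
Hypothesis omega2 : homog 2 omega.

Definition lef (beta : ext m W) : ext m W :=
  wedge (fun (r : R) (w : W) => r *: w) omega beta.

(** The antisymmetric matrix of omega, with omega = 1/2 sum_ab [coef2 a b] dx_a /\ dx_b. Reading the
    entry off i_a omega builds the sign in. *)
Definition coef2 a b : R := ext_contr a omega [set b]%SET.

Lemma coef2E a b : coef2 a b =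
  if (a < b)%N then omega [set a; b]%SET
  else if (b < a)%N then - omega [set a; b]%SET else 0.
Proof.
rewrite /coef2 ffunE !inE; case: ltngtP => ab.
- rewrite -val_eqE ltn_eqF // shuffle_inv11 ltnNge ltnW //= expr0.
  by rewrite scale1r.
- by rewrite -val_eqE gtn_eqF // shuffle_inv11 ab expr1 scaleN1r.
- by move/val_inj: ab => ->; rewrite eqxx.
Qed.

Lemma coef2C a b : coef2 a b = - coef2 b a.
Proof.
by rewrite !coef2E finset.setUC; case: ltngtP => _; rewrite ?opprK ?oppr0.
Qed.

Lemma homog1_covec (alpha : ext m R^o) : homog 1 alpha ->
  alpha = covec (fun c => alpha [set c]%SET).
Proof.
move=> ha; apply/ffunP => S; rewrite ffunE.
have [/eqP/cards1P[c ->]|S1] := eqVneq #|S| 1%N.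
  by rewrite (big_pred1 c) // => b; rewrite eq_sym (inj_eq finset.set1_inj).
rewrite ha; last exact/eqP.
by rewrite big_pred0 // => b; apply: contraNF S1 => /eqP->; rewrite cards1.
Qed.

Lemma lefE beta : lef beta =
  2^-1 *: \sum_a \sum_b coef2 a b *: ext_mul a (ext_mul b beta).
Proof.
have wb := bilin_wedge (m := m) (@bilin_scale R W).
have E : omega = 2^-1 *: \sum_a ext_mul a (ext_contr a omega).
  by rewrite (sum_mul_contr omega2) scalerA mulVf ?pnatr_eq0 // scale1r.
rewrite /lef {1}E (bilinZl wb); congr (_ *: _).
rewrite (bilin_suml wb); apply: eq_bigr => a _.
rewrite wedge_mull; last exact: bilin_scale.
rewrite (homog1_covec (homog_contr a omega2)) wedge_covec linear_sum.
by apply: eq_bigr => b _; rewrite linearZ.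
Qed.

Lemma lef_is_linear : linear lef.
Proof. exact: (bilin_wedge (m := m) (@bilin_scale R W)).2. Qed.

HB.instance Definition _ :=
  GRing.isLinear.Build R (ext m W) (ext m W) _ lef lef_is_linear.

Lemma homog_lef k beta : homog k beta -> homog k.+2 (lef beta).
Proof. by move=> hb; apply: (homog_wedge bilin_scale omega2 hb). Qed.

Lemma homog_lef_iter k j beta :
  homog k beta -> homog (k + j.*2) (iter j lef beta).
Proof.
move=> hb; elim: j => [|j IH] /=; first by rewrite addn0.
by rewrite doubleS !addnS; apply: homog_lef.
Qed.

Lemma lef_mul a beta : lef (ext_mul a beta) = ext_mul a (lef beta).
Proof. by rewrite /lef (wedge_mulr _ _ bilin_scale omega2) expr2 mulrNN mulr1 scale1r. Qed.

(** Moving i_a through e_c e_b leaves one delta term per factor. Antisymmetry of [coef2] makes the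
    two resulting sums equal, which cancels the 1/2 of [lefE]; [E1] and [E2] are these two sums. *)
Lemma contr_lef a beta :
  ext_contr a (lef beta) = lef (ext_contr a beta) +
    \sum_b coef2 a b *: ext_mul b beta.
Proof.
rewrite !lefE linearZ /=.
have -> : \sum_b coef2 a b *: ext_mul b beta =
  2^-1 *: (\sum_b coef2 a b *: ext_mul b beta + \sum_b coef2 a b *: ext_mul b beta).
  rewrite scalerDr -scalerDl [X in X *: _](_ : _ = 1) ?scale1r //; lra.
rewrite -scalerDr; congr (_ *: _); rewrite linear_sum /= addrA.
have E1 : \sum_b coef2 a b *: ext_mul b beta =
  \sum_c \sum_b (a == c)%:R *: (coef2 c b *: ext_mul b beta).
  rewrite [RHS](bigD1 a) //= [X in _ = _ + X]big1 ?addr0; last first.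
    move=> c ca; rewrite big1 // => b _.
    by rewrite eq_sym (negPf ca) scale0r.
  by apply: eq_bigr => b _; rewrite eqxx scale1r.
have E2 : \sum_b coef2 a b *: ext_mul b beta =
  - \sum_c \sum_b (a == b)%:R *: (coef2 c b *: ext_mul c beta).
  rewrite exchange_big [X in _ = - X](bigD1 a) //= [X in _ = - (_ + X)]big1 ?addr0; last first.
    move=> c ca; rewrite big1 // => b _.
    by rewrite eq_sym (negPf ca) scale0r.
  rewrite -sumrN; apply: eq_bigr => b _.
  by rewrite eqxx scale1r coef2C scaleNr.
rewrite {1}E1 E2 -big_split -sumrB /=; apply: eq_bigr => c _.
rewrite linear_sum /= -big_split -sumrB /=; apply: eq_bigr => b _.
rewrite linearZ /= !ext_contr_mul linearB /= linearZ /= linearB linearZ /=.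
rewrite scalerBr opprB linearZ /= addrCA addrA !scalerA.
by rewrite [ext_mul c (_ *: _)]linearZ /= scalerA [coef2 c b * (a == b)%:R]mulrC.
Qed.

Variable pi_ : 'I_m -> 'I_m -> R.
Hypothesis pi_coef2 : forall a c, \sum_b pi_ a b * coef2 b c = (a == c)%:R.
Hypothesis coef2_pi : forall a c, \sum_b coef2 a b * pi_ b c = (a == c)%:R.

Definition dual_lef (beta : ext m W) : ext m W :=
  \sum_a \sum_b pi_ a b *: ext_contr a (ext_contr b beta).

Lemma dual_lef_is_linear : linear dual_lef.
Proof.
move=> r x y; rewrite /dual_lef scaler_sumr -big_split /=; apply: eq_bigr => a _.
rewrite scaler_sumr -big_split /=; apply: eq_bigr => b _.
by rewrite [ext_contr b _]linearP [ext_contr a _]linearP scalerDr !scalerA mulrC.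
Qed.

HB.instance Definition _ :=
  GRing.isLinear.Build R (ext m W) (ext m W) _ dual_lef dual_lef_is_linear.

Lemma homog_dual_lef k beta : homog k.+2 beta -> homog k (dual_lef beta).
Proof.
move=> hb; apply: homog_sum => a _; apply: homog_sum => b _; apply: homogZ.
by apply/homog_contr/homog_contr.
Qed.

Lemma dual_lef_homog_lt2 k beta : (k < 2)%N -> homog k beta -> dual_lef beta = 0.
Proof.
case: k => [|[|//]] _ hb; apply: big1 => a _; apply: big1 => b _.
  by rewrite (contr_homog0 b hb) linear0 scaler0.
by rewrite (contr_homog0 a (homog_contr b hb)) scaler0.
Qed.

(* With g_a = sum_b pi_ab i_b one has [g_a, L] = e_a, so the commutator is
   sum_a (i_a e_a + [i_a, L] g_a) = sum_a (i_a e_a - e_a i_a). *)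
Lemma dual_lefK k beta : homog k beta ->
  dual_lef (lef beta) = lef (dual_lef beta) + (m%:R - k.*2%:R) *: beta.
Proof.
move=> hb.
pose g a (x : ext m W) := \sum_b pi_ a b *: ext_contr b x.
have dE x : dual_lef x = \sum_a ext_contr a (g a x).
  apply: eq_bigr => a _; rewrite /g linear_sum; apply: eq_bigr => b _ /=.
  by rewrite linearZ.
have gl a x : g a (lef x) = lef (g a x) + ext_mul a x.
  rewrite /g linear_sum /=.
  under eq_bigr => b _ do rewrite contr_lef scalerDr -linearZ.
  rewrite big_split /=; congr (_ + _).
  under eq_bigr => b _ do rewrite scaler_sumr.
  rewrite exchange_big /= (bigD1 a) //= [X in _ + X]big1 ?addr0.
    under eq_bigr => b _ do rewrite scalerA.
    by rewrite -scaler_suml pi_coef2 eqxx scale1r.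
  move=> c ca; under eq_bigr => b _ do rewrite scalerA.
  by rewrite -scaler_suml pi_coef2 eq_sym (negPf ca) scale0r.
have fg : \sum_a \sum_c coef2 a c *: ext_mul c (g a beta) = - (k%:R *: beta).
  rewrite exchange_big /= -(sum_mul_contr hb) -sumrN; apply: eq_bigr => c _.
  rewrite /g -[LHS]/(\sum_a coef2 a c *: ext_mul c (\sum_b pi_ a b *: ext_contr b beta)).
  under eq_bigr => a _ do rewrite linear_sum scaler_sumr.
  rewrite exchange_big /= (bigD1 c) //= [X in _ + X]big1 ?addr0.
    under eq_bigr => a _ do rewrite linearZ scalerA coef2C mulNr.
    by rewrite -scaler_suml sumrN coef2_pi eqxx scaleN1r.
  move=> b bc; under eq_bigr => a _ do rewrite linearZ scalerA coef2C mulNr.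
  by rewrite -scaler_suml sumrN coef2_pi eq_sym (negPf bc) oppr0 scale0r.
rewrite !dE linear_sum /=.
under eq_bigr => a _ do
  rewrite gl [ext_contr a _]linearD /= contr_lef ext_contr_mul eqxx scale1r.
rewrite !big_split /= -addrA; congr (_ + _).
rewrite fg sumrN (sum_mul_contr hb) sumr_const card_ord -[beta *+ m]scaler_nat.
by rewrite addrC -addrA -opprD -scalerDl -scalerBl -addnn natrD.
Qed.

(** The constant is the sum over q < r of m - 2(k + 2q), the commutator eigenvalues met when Lam
    passes r copies of L. For r = 0 it vanishes, so the value of [r.-1] there is harmless. *)
Lemma dual_lef_iter k r beta : homog k beta ->
  dual_lef (iter r lef beta) = iter r lef (dual_lef beta) +
    (r%:R * (m%:R - k.*2%:R - r.*2%:R + 2)) *: iter r.-1 lef beta.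
Proof.
move=> hb; elim: r => [|r IH]; first by rewrite mul0r scale0r addr0.
rewrite iterS (dual_lefK (homog_lef_iter hb)) IH linearD /= -addrA.
congr (_ + _); rewrite linearZ /=.
case: r {IH} => [|r].
  rewrite mul0r scale0r add0r addn0 /=; congr (_ *: _).
  rewrite -!muln2 !natrM; ring.
rewrite -iterS -scalerDl /=; congr (_ *: _).
rewrite -!muln2 !(natrM, natrD, mulrSr) /=; ring.
Qed.

End Lefschetz.

(** * Injectivity of the powers of L and the two-term decomposition *)

Section HardLefschetz.
Variables (R : realType) (n m : nat) (W : lmodType R).
Hypothesis mE : m = n.*2.
Variable omega : ext m R^o.
Hypothesis omega2 : homog 2 omega.
Variable pi_ : 'I_m -> 'I_m -> R.
Hypothesis pi_coef2 :
  forall a c, \sum_b pi_ a b * coef2 omega b c = (a == c)%:R.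
Hypothesis coef2_pi :
  forall a c, \sum_b coef2 omega a b * pi_ b c = (a == c)%:R.

Local Notation L := (@lef R m W omega).
Local Notation Lam := (@dual_lef R m W pi_).

Let iterD_eq0 i j (x : ext m W) :
  (i <= j)%N -> iter i L x = 0 -> iter j L x = 0.
Proof.
move=> ij ix; rewrite -(subnK ij) iterD ix.
by elim: (j - i)%N => //= l ->; rewrite linear0.
Qed.

Lemma lef_iter0 j : iter j L (0 : ext m W) = 0.
Proof. exact: (@iterD_eq0 0). Qed.

Lemma lef_iter_is_linear j : linear (iter j L).
Proof. by elim: j => [//|j IH] r x y /=; rewrite IH linearP. Qed.

Lemma lef_iterB j x y : iter j L (x - y) = iter j L x - iter j L y.
Proof. by rewrite addrC -scaleN1r lef_iter_is_linear scaleN1r addrC. Qed.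

Lemma lef_iterZ j r x : iter j L (r *: x) = r *: iter j L x.
Proof.
have := lef_iter_is_linear j r x 0; rewrite addr0 => ->.
by rewrite (@iterD_eq0 0 j 0) // addr0.
Qed.

(* If L^(j+1) x = 0 then L^(j+2) (Lam x) = 0, so Lam x = 0 by induction on the
   degree, and the commutator formula leaves a nonzero multiple of L^j x. *)
Lemma lef_iter_inj k j (x : ext m W) :
  homog k x -> (j + k <= n)%N -> iter j L x = 0 -> x = 0.
Proof.
elim/ltn_ind: k j x => k IHk; elim=> [//|j IHj] x hx jk Lx.
have E := dual_lef_iter omega2 pi_coef2 coef2_pi j.+1 hx.
have Lx0 : Lam x = 0.
  have [k2|k2] := ltnP k 2; first exact: dual_lef_homog_lt2 k2 hx.
  have kE : k = (k - 2).+2 by lia.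
  have hx' : homog (k - 2) (Lam x) by apply: homog_dual_lef; rewrite -kE.
  (* Lam lowers the degree by 2 while the exponent rises only from j+1 to j+2, so the bound by n
     still holds. *)
  apply: (IHk _ _ j.+2 _ hx'); [lia|lia|].
  rewrite Lx linear0 in E; have /= := congr1 L E.
  rewrite linear0 linearD linearZ /=.
  by rewrite -[L (iter j L x)]/(iter j.+1 L x) Lx scaler0 addr0 => <-.
apply: IHj hx _ _; first lia.
move: E; rewrite Lx Lx0 linear0 (@iterD_eq0 0 j.+1 0) // add0r /= => /esym/eqP.
rewrite scaler_eq0 => /orP[|/eqP //].
rewrite mulf_eq0 pnatr_eq0 /= => /eqP E0; exfalso.
(* The second factor m - 2k - 2(j+1) + 2 equals 2(n - k - j), which is positive since j + 1 + k <=
   n. *)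
have : ((n - k - j).*2)%:R = 0 :> R.
  by rewrite -[RHS]E0 mE -!muln2 -!subnDA natrM natrB ?natrM ?natrD ?mulrSr; [ring|lia].
by move/eqP; rewrite pnatr_eq0; lia.
Qed.

(* A form gamma = beta0 + L beta1 with beta0, beta1 primitive has
   Lam gamma = [Lam, L] beta1 = 2 (n - s + 1) beta1. *)
Definition lef_part s (gamma : ext m W) : ext m W :=
  ((n - s).+1.*2%:R)^-1 *: Lam gamma.

Section Decomposition.
Variables (s : nat) (gamma : ext m W).
Hypotheses (sn : (s <= n)%N) (hgamma : homog s.+1 gamma).
Hypothesis Lgamma : iter (n - s).+1 L gamma = 0.

Let natE r : r%:R * (m%:R - s.+1.*2%:R - r.*2%:R + 2) =
  r.*2%:R * ((n - s)%:R - r%:R) :> R.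
Proof. by rewrite mE -!muln2 !natrM natrB // mulrSr; ring. Qed.

(** In [dual_lef_iter] with r = n-s+2 both L^r gamma and L^(r-1) gamma vanish. For s > 0 the
    exponent n-s+2 is the one that defines primitivity in degree s-1. *)
Lemma lef_part_primitive : iter (n - s).+2 L (lef_part s gamma) = 0.
Proof.
rewrite lef_iterZ; have := dual_lef_iter omega2 pi_coef2 coef2_pi (n - s).+2 hgamma.
rewrite (iterD_eq0 (leqnSn _) Lgamma) linear0 succnK Lgamma scaler0 addr0 => <-.
by rewrite scaler0.
Qed.

(** At r = n-s+1 the coefficient 2r(n-s-r) of [natE] is -2(n-s+1). Hence L^(n-s+1) Lam gamma =
    2(n-s+1) L^(n-s) gamma, and the normalisation of [lef_part] removes the factor. *)
Lemma lef_part_rest : iter (n - s) L (gamma - L (lef_part s gamma)) = 0.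
Proof.
rewrite lef_iterB -iterSr lef_iterZ.
have := dual_lef_iter omega2 pi_coef2 coef2_pi (n - s).+1 hgamma.
rewrite Lgamma linear0 natE /= => /eqP; rewrite eq_sym addr_eq0 => /eqP ->.
rewrite scalerN opprK scalerA -[X in X + _]scale1r -scalerDl.
rewrite [X in X *: _](_ : _ = 0) ?scale0r //.
by rewrite mulKf ?pnatr_eq0 // -[(n - s).+1%:R]natr1; ring.
Qed.

Lemma homog_lef_part : (0 < s)%N -> homog s.-1 (lef_part s gamma).
Proof. by case: s hgamma => // s' h _; apply/homogZ/homog_dual_lef. Qed.

Lemma lef_part0 : s = 0%N -> lef_part s gamma = 0.
Proof.
by move=> s0; rewrite /lef_part (dual_lef_homog_lt2 _ _ hgamma) ?scaler0 ?s0.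
Qed.

End Decomposition.

(** The terms are peeled off from the largest index b. Applying L^(n+b-k) kills the terms of index r
    < b by primitivity, and leaves L^(n+2b-k) of a form of degree k-2b, the extreme case of
    injectivity. If k > n + b, no index up to b satisfies the bound of the conclusion. *)
Lemma lefschetz_unique k (delta : nat -> ext m W) :
  (forall r, (r <= k./2)%N -> homog (k - r.*2) (delta r)) ->
  (forall r, (r <= k./2)%N -> (k - r.*2 <= n)%N \/ delta r = 0) ->
  (forall r, (r <= k./2)%N -> iter (n - (k - r.*2)).+1 L (delta r) = 0) ->
  \sum_(0 <= r < k./2.+1) iter r L (delta r) = 0 ->
  forall r, (r <= k./2)%N -> (k <= n + r)%N -> delta r = 0.
Proof.
move=> hd sd Ld.
suff H b : (b <= k./2.+1)%N -> \sum_(0 <= r < b) iter r L (delta r) = 0 ->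
    forall r, (r < b)%N -> (k <= n + r)%N -> delta r = 0.
  by move=> S r rk; exact: (H _ (leqnn _) S).
elim: b => [//|b IH] bk; rewrite big_nat_recr //= => S.
have [kb|nkb] := leqP k (n + b); last by move=> r rb kr; exfalso; lia.
have db : delta b = 0.
  apply: (@lef_iter_inj (k - b.*2) (n + b - k + b)); [exact: hd|lia|].
  rewrite iterD; move/addr0_eq: S => <-.
  rewrite -[X in iter _ _ X]scaleN1r lef_iterZ.
  rewrite (big_morph _ (id1 := 0) (op1 := +%R) _ (lef_iter0 _)); last first.
    by move=> x y; have := lef_iter_is_linear (n + b - k) 1 x y; rewrite !scale1r.
  rewrite big_nat big1 ?scaler0 // => r /andP[_ rb].
  have rk : (r <= k./2)%N by lia.
  (* [dr] makes n - (k - 2r) a true difference, so that r < b gives n + b - k + r >= n - (k - 2r) +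
     1. *)
  have [dr|->] := sd r rk; last by rewrite !lef_iter0.
  rewrite -iterD; apply: iterD_eq0 (Ld r rk); lia.
move: S; rewrite db lef_iter0 addr0 => S r; rewrite ltnS leq_eqVlt => /orP[/eqP->//|rb].
by apply: IH => //; lia.
Qed.

End HardLefschetz.

(** * Inverting the matrix of a nondegenerate 2-form *)

Section Nondegenerate.
Variables (R : realType) (m : nat).
Variable omega : ext m R^o.

Definition coef2_mx : 'M[R]_m := \matrix_(a, b) coef2 omega a b.

Lemma eval2E u v : eval2 omega u v = (u *m coef2_mx *m v^T) 0 0.
Proof.
rewrite mxE; under eq_bigr => b _ do rewrite !mxE.
transitivity (\sum_a \sum_b coef2 omega a b * (u 0 a * v 0 b)); last first.
  rewrite exchange_big; apply: eq_bigr => b _ /=; rewrite mulr_suml.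
  by apply: eq_bigr => a _; rewrite mxE; ring.
rewrite /eval2; under eq_bigr => a _ do rewrite big_mkcond /=.
pose f (a b : 'I_m) := if (a < b)%N then (omega [set a; b]%SET : R) * (u 0 a * v 0 b) else 0.
pose g (a b : 'I_m) := if (a < b)%N then (omega [set a; b]%SET : R) * (u 0 b * v 0 a) else 0.
transitivity (\sum_a \sum_b (f a b - g a b)).
  apply: eq_bigr => a _; apply: eq_bigr => b _; rewrite /f /g.
  by case: ifP; rewrite ?subr0 // mulrBr.
under eq_bigr => a _ do rewrite sumrB.
rewrite sumrB [X in _ - X]exchange_big -sumrB; apply: eq_bigr => a _.
rewrite -sumrB; apply: eq_bigr => b _; rewrite /f /g coef2E finset.setUC.
by case: ltngtP => _; ring.
Qed.

Hypothesis nondeg : forall u, (forall v, eval2 omega u v = 0) -> u = 0.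

Lemma coef2_mx_unit : coef2_mx \in unitmx.
Proof.
rewrite -row_free_unit; apply: inj_row_free => u uw; apply: nondeg => v.
by rewrite eval2E uw mul0mx mxE.
Qed.

Definition coef2_inv a b : R := invmx coef2_mx a b.

Lemma coef2_invl a c : \sum_b coef2_inv a b * coef2 omega b c = (a == c)%:R.
Proof.
have := congr1 (fun A : 'M[R]_m => A a c) (mulVmx coef2_mx_unit).
by rewrite !mxE => <-; apply: eq_bigr => b _; rewrite mxE.
Qed.

Lemma coef2_invr a c : \sum_b coef2 omega a b * coef2_inv b c = (a == c)%:R.
Proof.
have := congr1 (fun A : 'M[R]_m => A a c) (mulmxV coef2_mx_unit).
by rewrite !mxE => <-; apply: eq_bigr => b _; rewrite mxE.
Qed.

End Nondegenerate.

(** * Pullback *)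

Section Pullback.
Variables (R : realType) (m : nat).
Implicit Types (U V W : lmodType R) (a b : 'I_m) (S T : {set 'I_m}).

Definition cov_mul W (v : 'I_m -> R) (beta : ext m W) : ext m W :=
  \sum_a v a *: ext_mul a beta.

Lemma cov_mul_is_linear W v : linear (@cov_mul W v).
Proof.
move=> r x y; rewrite /cov_mul scaler_sumr -big_split /=; apply: eq_bigr => a _.
by rewrite [ext_mul a _]linearP scalerDr !scalerA mulrC.
Qed.

HB.instance Definition _ W v :=
  GRing.isLinear.Build R (ext m W) (ext m W) _ (@cov_mul W v)
    (@cov_mul_is_linear W v).

Lemma cov_mulC W u v (beta : ext m W) :
  cov_mul u (cov_mul v beta) = - cov_mul v (cov_mul u beta).
Proof.
rewrite /cov_mul -sumrN.
under eq_bigr => a _ do rewrite linear_sum scaler_sumr.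
rewrite exchange_big; apply: eq_bigr => b _ /=.
rewrite [in RHS]linear_sum scaler_sumr -sumrN; apply: eq_bigr => a _ /=.
rewrite [ext_mul a (_ *: _)]linearZ [ext_mul b (_ *: _)]linearZ /= ext_mulC scalerN scalerN.
by rewrite !scalerA mulrC.
Qed.

Lemma cov_mul_mul0 W v (beta : ext m W) : cov_mul v (cov_mul v beta) = 0.
Proof.
have /eqP := cov_mulC v v beta; rewrite -addr_eq0 -mulr2n -scaler_nat.
by rewrite scaler_eq0 pnatr_eq0 => /eqP.
Qed.

Lemma homog_cov_mul W k v (beta : ext m W) :
  homog k beta -> homog k.+1 (cov_mul v beta).
Proof. by move=> hb; apply: homog_sum => a _; apply/homogZ/homog_mul. Qed.

Lemma wedge_cov_mul U V W (b : U -> V -> W) v (alpha : ext m U) (beta : ext m V) :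
  bilin b -> wedge b (cov_mul v alpha) beta = cov_mul v (wedge b alpha beta).
Proof.
move=> bb; have wb := bilin_wedge (m := m) bb.
rewrite (bilin_suml wb); apply: eq_bigr => a _.
by rewrite (bilinZl wb) wedge_mull.
Qed.

Definition ext_tens W (theta : ext m R^o) (w : W) : ext m W :=
  [ffun S : {set 'I_m} => (theta S : R) *: w].

Lemma ext_tens_is_linear W theta : linear (@ext_tens W theta).
Proof.
move=> r x y; apply/ffunP => S; rewrite !ffunE.
by rewrite scalerDr !scalerA mulrC.
Qed.

HB.instance Definition _ W theta :=
  GRing.isLinear.Build R W (ext m W) _ (@ext_tens W theta)
    (@ext_tens_is_linear W theta).

Lemma ext_tens0 W (w : W) : ext_tens 0 w = 0.
Proof. by apply/ffunP => S; rewrite !ffunE scale0r. Qed.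

Lemma ext_tensZl W r theta (w : W) : ext_tens (r *: theta) w = r *: ext_tens theta w.
Proof. by apply/ffunP => S; rewrite !ffunE scalerA. Qed.

Lemma cov_mul_tens W v theta (w : W) :
  cov_mul v (ext_tens theta w) = ext_tens (cov_mul v theta) w.
Proof.
apply/ffunP => S; rewrite ffunE !sum_ffunE scaler_suml; apply: eq_bigr => a _.
rewrite !ffunE; case: ifP => _; last by rewrite !scaler0 scale0r.
by rewrite !scalerA; congr (_ *: _); rewrite -?mulrA.
Qed.

Variable J : 'M[R]_m.

(** Indexed by sequences rather than sets, so that a factor may be repeated or out of order while
    dy_a travels to its place. *)
Definition dy_seq (s : seq 'I_m) : ext m R^o :=
  foldr (fun b => cov_mul (fun a => J a b)) (ext1 R m) s.

Lemma pullbackE W (alpha : ext m W) :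
  pullback J alpha = \sum_(T : {set 'I_m}) ext_tens (dy_seq (enum T)) (alpha T).
Proof.
rewrite /pullback; apply: eq_bigr => T _ /=.
apply/ffunP => S; rewrite !ffunE; congr (_ *: _).
rewrite (_ : \big[_/_]_(b <- _) _ = dy_seq (enum T)) //.
elim: (enum T) => [|b s IH]; first by rewrite big_nil.
by rewrite big_cons IH -[RHS]wedge_covec.
Qed.

Lemma pullback_is_linear W : linear (@pullback R m W J).
Proof.
move=> r x y; rewrite !pullbackE scaler_sumr -big_split /=.
by apply: eq_bigr => T _; rewrite !ffunE linearP.
Qed.

HB.instance Definition _ W :=
  GRing.isLinear.Build R (ext m W) (ext m W) _ (@pullback R m W J)
    (@pullback_is_linear W).

Lemma homog_dy_seq s : homog (size s) (dy_seq s).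
Proof.
elim: s => [|b s IH] /=; last exact: homog_cov_mul.
by move=> S S0; rewrite ffunE; case: eqP => // E; rewrite E cards0 in S0.
Qed.

Lemma homog_pullback W k (alpha : ext m W) : homog k alpha -> homog k (pullback J alpha).
Proof.
move=> ha; rewrite pullbackE; apply: homog_sum => T _.
have [Tk|/eqP Tk] := eqVneq #|T| k; last by rewrite ha // linear0; exact: homog0.
move=> S Sk; rewrite ffunE homog_dy_seq ?scale0r //.
by rewrite -cardE Tk.
Qed.

Lemma enum_ord_split a : exists l1 l2,
  [/\ enum 'I_m = l1 ++ a :: l2, all (fun b => b < a)%N l1 &
      all (fun b => a < b)%N l2].
Proof.
have : pairwise (fun b c : 'I_m => b < c)%N (enum 'I_m).
  have := iota_ltn_sorted 0 m; rewrite -val_enum_ord sorted_map.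
  by rewrite sorted_pairwise // => x y z; apply: ltn_trans.
have /splitPr[l1 l2] : a \in enum 'I_m by rewrite mem_enum.
rewrite pairwise_cat /= allrel_consr => /and3P[/andP[al1 _] _ /andP[al2 _]].
by exists l1, l2.
Qed.

Lemma cov_mul_dy_seq a (s : seq 'I_m) (t : seq 'I_m) :
  cov_mul (fun c => J c a) (dy_seq (s ++ t)) =
  (-1) ^+ size s *: dy_seq (s ++ a :: t).
Proof.
elim: s => [|b s IH] /=; first by rewrite scale1r.
by rewrite cov_mulC IH linearZ /= exprS mulN1r scaleNr.
Qed.

Lemma dy_seq_repeat a s t : dy_seq (s ++ a :: a :: t) = 0.
Proof.
elim: s => [|b s IH] /=; first exact: cov_mul_mul0.
by rewrite IH linear0.
Qed.

(** The enumeration of T is cut at a: dy_a passes the elements below a, whose number is the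
    exponent, and meets a second dy_a if a lies in T. *)
Lemma cov_mul_dy_enum a T :
  cov_mul (fun c => J c a) (dy_seq (enum T)) =
  if a \in T then 0
  else (-1) ^+ shuffle_inv [set a]%SET T *: dy_seq (enum (a |: T)).
Proof.
have [l1 [l2 [E al1 al2]]] := enum_ord_split a.
have eE (A : {set 'I_m}) : enum A = [seq x <- l1 ++ a :: l2 | x \in A].
  by rewrite -E {1}/enum_mem -enumT.
have filt (A : {set 'I_m}) (l : seq 'I_m) : a \notin l ->
    [seq x <- l | x \in a |: A] = [seq x <- l | x \in A].
  move=> al; apply: eq_in_filter => x xl; rewrite !inE.
  by case: eqP => // xa; rewrite -xa xl in al.
have a1 : a \notin l1 by apply/negP => /(allP al1); rewrite ltnn.
have a2 : a \notin l2 by apply/negP => /(allP al2); rewrite ltnn.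
case: ifPn => aT.
  by rewrite eE filter_cat /= aT cov_mul_dy_seq dy_seq_repeat scaler0.
rewrite !eE !filter_cat /= (negPf aT) !inE eqxx /= !filt // cov_mul_dy_seq.
congr ((-1) ^+ _ *: _).
rewrite shuffle_invE big_set1 -big_enum eE filter_cat /= (negPf aT) big_cat /=.
rewrite [X in (_ + X)%N]big1_seq ?addn0; last first.
  move=> x /=; rewrite mem_filter => /andP[_ /(allP al2) ax].
  by rewrite ltnNge (ltnW ax).
rewrite -sum1_size; apply: eq_big_seq => x; rewrite mem_filter.
by case/andP=> _ /(allP al1) ->.
Qed.

Lemma pullback_mul W a (beta : ext m W) :
  pullback J (ext_mul a beta) = cov_mul (fun c => J c a) (pullback J beta).
Proof.
rewrite !pullbackE linear_sum /=.
under [RHS]eq_bigr => T _ do rewrite cov_mul_tens cov_mul_dy_enum.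
rewrite (bigID (fun T : {set 'I_m} => a \in T)) /= [X in _ + X]big1 ?addr0; last first.
  by move=> T /negPf aT; rewrite ffunE aT linear0.
rewrite [RHS](bigID (fun T : {set 'I_m} => a \in T)) /=.
rewrite [X in _ = X + _]big1 ?add0r; last first.
  by move=> T ->; rewrite ext_tens0.
rewrite (reindex_onto (fun T => a |: T) (fun T => T :\ a)) /=; last first.
  by move=> T aT; rewrite finset.setD1K.
apply: eq_big => [T|T /andP[_ /eqP TE]].
  rewrite finset.setU11 /=; apply/eqP/idP => [<-|aT]; first by rewrite !inE eqxx.
  by rewrite finset.setU1K.
have aT : a \notin T by rewrite -TE !inE eqxx.
by rewrite ffunE finset.setU11 TE (negPf aT) linearZ ext_tensZl.
Qed.

Lemma pullback_map V W (f : {linear V -> W}) (beta : ext m V) :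
  pullback J (ext_map f beta) = ext_map f (pullback J beta).
Proof.
rewrite !pullbackE; apply/ffunP => S; rewrite ffunE !sum_ffunE linear_sum.
by apply: eq_bigr => T _; rewrite !ffunE linearZ.
Qed.

Lemma pullback_homog0 W (alpha : ext m W) : homog 0 alpha ->
  pullback J alpha finset.set0 = alpha finset.set0.
Proof.
move=> ha; rewrite pullbackE sum_ffunE (bigD1 finset.set0) //= big1 ?addr0.
  by rewrite enum_set0 !ffunE eqxx scale1r.
by move=> T T0; rewrite ha ?linear0 ?ffunE //; apply/eqP; rewrite cards_eq0.
Qed.

(** By [pullback_mul] both sides turn e_a into multiplication by dy_a, so [homog_ind] reduces the
    claim to degree 0, where the wedge is a coefficientwise linear map. *)
Lemma pullback_wedge U V W (b : U -> V -> W) k (alpha : ext m U) (beta : ext m V) :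
  bilin b -> homog k alpha ->
  pullback J (wedge b alpha beta) = wedge b (pullback J alpha) (pullback J beta).
Proof.
move=> bb; have wb := bilin_wedge (m := m) bb.
move: k alpha; apply: homog_ind.
- by move=> x y xE yE; rewrite (bilinDl wb) !linearD /= xE yE (bilinDl wb).
- by move=> r x xE; rewrite (bilinZl wb) !linearZ /= xE (bilinZl wb).
- move=> x hx; rewrite !wedge_homog0 //; last exact: homog_pullback.
  rewrite pullback_homog0 //; have [f fb] := bilin_linear (x finset.set0) bb.
  by rewrite -!(ext_map_eq _ fb) pullback_map.
- move=> k a x hx xE; rewrite wedge_mull // !pullback_mul xE.
  by rewrite wedge_cov_mul.
Qed.

End Pullback.

Local Open Scope classical_set_scope.

(** * Smooth functions *)

Section Differentiability.
Variables (R : realType).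
Implicit Types (V W : normedModType R).

(** The case from which locality of differentiability follows: [near_eq_differentiable] adds to f
    the difference g - f, which vanishes near x. *)
Lemma differentiable_near0 V W (h : V -> W) x :
  (\forall y \near x, h y = 0) -> differentiable h x.
Proof.
move=> h0; have hx : h x = 0 by exact: nbhs_singleton h0.
have E : h \o shift x = cst (h x) + (\0 : V -> W) +o_ 0 id.
  apply/eqaddoP => _/posnumP[e]; near=> y.
  rewrite /= hx !fctE /= addr0 subr0.
  suff -> : h (y + x) = 0 by rewrite normr0 mulr_ge0.
  near: y; move: h0; rewrite (near_shift 0) /=.
  by apply: filterS => y; rewrite /= subr0.
apply/diff_locallyP; split.
  have -> : 'd h x = \0 :> (V -> W) by apply: diff_unique => //; exact: cst_continuous.
  exact: cst_continuous.
by rewrite (_ : 'd h x = \0 :> (V -> W)) //; apply: diff_unique => //; exact: cst_continuous.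
Unshelve. all: by end_near. Qed.

Lemma near_eq_differentiable V W (f g : V -> W) x :
  (\forall y \near x, f y = g y) -> differentiable f x -> differentiable g x.
Proof.
move=> fg df; have -> : g = f + (g - f) by rewrite addrC subrK.
apply: differentiableD => //; apply: differentiable_near0.
by apply: filterS fg => y; rewrite !fctE => ->; rewrite subrr.
Qed.

Lemma differentiable_mxP V p q (M : V -> 'M[R]_(p, q)) x :
  differentiable M x <-> forall i j, differentiable (fun y => M y i j : R) x.
Proof.
split=> [dM i j|dM].
  apply: (@differentiable_comp _ _ _ _ M (fun A : 'M[R]_(p, q) => A i j)) => //.
  exact: differentiable_coord.
have -> : M = \sum_(i < p) \sum_(j < q) (fun y => M y i j *: delta_mx i j).
  apply/funext => y; rewrite {1}(matrix_sum_delta (M y)) fct_sumE.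
  by apply: eq_bigr => i _; rewrite fct_sumE.
apply: differentiable_sum => i; apply: differentiable_sum => j.
exact: differentiableZl.
Qed.

Lemma derive_coord V p q (M : V -> 'M[R]_(p, q)) x v i j :
  differentiable M x -> ('D_v M x) i j = 'D_v (fun y => M y i j) x.
Proof. by move=> dM; rewrite derive_mx ?mxE //; exact: diff_derivable. Qed.

Definition cbilin (U V W : normedModType R) (b : U -> V -> W) :=
  bilin b /\ continuous (fun p : U * V => b p.1 p.2).

Lemma cbilin_scale W : cbilin (fun (r : R^o) (w : W) => r *: w).
Proof. by split; [exact: bilin_scale|exact: scale_continuous]. Qed.

Lemma cbilin_mulmx p q r :
  cbilin (fun (A : 'M[R]_(p, q)) (B : 'M[R]_(q, r)) => A *m B).
Proof.
split; first exact: bilin_mulmx.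
move=> x; apply: differentiable_continuous; apply/differentiable_mxP => i j.
have -> : (fun y : 'M[R]_(p, q) * 'M[R]_(q, r) => (y.1 *m y.2) i j) =
    \sum_(k < q) ((fun y : 'M[R]_(p, q) * 'M[R]_(q, r) => y.1 i k) *
       (fun y : 'M[R]_(p, q) * 'M[R]_(q, r) => y.2 k j)).
  by apply/funext => y; rewrite mxE fct_sumE.
apply: differentiable_sum => k; apply: differentiableM.
  apply: (@differentiable_comp _ _ _ _ fst (fun A : 'M[R]_(p, q) => A i k)).
    by apply: linear_differentiable => -[z1 z2]; exact: (@cvg_fst _ _ (nbhs z1) (nbhs z2)).
  exact: differentiable_coord.
apply: (@differentiable_comp _ _ _ _ snd (fun A : 'M[R]_(q, r) => A k j)).
  by apply: linear_differentiable => -[z1 z2]; exact: (@cvg_snd _ _ (nbhs z1) (nbhs z2)).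
exact: differentiable_coord.
Qed.

Section ProductRule.
Variables (X U V W : normedModType R) (b : U -> V -> W).
Hypothesis bb : cbilin b.
Variables (f : X -> U) (g : X -> V) (x : X).
Hypotheses (df : differentiable f x) (dg : differentiable g x).

Let bil : exists B : {bilinear U -> V -> W}, (B : U -> V -> W) = b.
Proof.
have h : bilinear_for (GRing.Scale.Law.clone _ _ *:%R _)
    (GRing.Scale.Law.clone _ _ *:%R _) b.
  by split=> u; [exact: bb.1.1|exact: bb.1.2].
pose bM := bilinear_isBilinear.Build R U V W _ _ b h.
by pose bB : {bilinear U -> V -> W} := HB.pack b bM; exists bB.
Qed.

Lemma differentiable_cbilin : differentiable (fun y => b (f y) (g y)) x.
Proof.
have [B Bb] := bil; have Bc := bb.2; rewrite -Bb in Bc *.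
apply: (@differentiable_comp _ _ _ _ (fun y => (f y, g y)) (fun p => B p.1 p.2)).
  exact: differentiable_pair.
exact: differentiable_bilin.
Qed.

Lemma derive_cbilin v : 'D_v (fun y => b (f y) (g y)) x =
  b ('D_v f x) (g x) + b (f x) ('D_v g x).
Proof.
rewrite !deriveE //; last exact: differentiable_cbilin.
have [B Bb] := bil; have Bc := bb.2; rewrite -Bb in Bc *.
rewrite -[fun y => _]/((fun p : U * V => B p.1 p.2) \o (fun y => (f y, g y))).
rewrite diff_comp /=; [|exact: differentiable_pair|exact: differentiable_bilin].
by rewrite diff_pair // diff_bilin //= addrC.
Qed.

End ProductRule.

End Differentiability.

(** * Closure properties of smooth functions on an open set *)

Section Smoothness.
Variables (R : realType) (m : nat) (D : set 'rV[R]_m).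
Hypothesis Dopen : open D.
Implicit Types (U V W : normedModType R).

(** Smoothness truncated at order k, peeling off the innermost derivative. The product rule
    expresses order k+1 of a product through order k of the factors and their first derivatives, so
    closure goes by induction on k; [smooth_onP] returns to [smooth_on]. *)
Fixpoint differentiable_upto W k (f : 'rV[R]_m -> W) : Prop :=
  (forall x, D x -> differentiable f x) /\
  if k is k'.+1 then forall v, differentiable_upto k' ('D_v f) else True.

Lemma differentiable_uptoW W k (f : 'rV[R]_m -> W) :
  differentiable_upto k f -> forall x, D x -> differentiable f x.
Proof. by case: k => [|k] []. Qed.

Lemma smooth_onP W (f : 'rV[R]_m -> W) :
  smooth_on D f <-> forall k, differentiable_upto k f.
Proof.
split=> [sf k|df vs].
  elim: k f sf => [|k IH] f sf; (split; first by move=> x Dx; exact: (sf [::])) => // v.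
  apply: IH => vs x Dx.
  by have := sf (rcons vs v) x Dx; rewrite foldr_rcons.
elim/last_ind: vs f df => [|vs v IH] f df x Dx /=.
  exact: (differentiable_uptoW (df 0%N)).
rewrite foldr_rcons; apply: IH Dx => k.
by have [_ /(_ v)] := df k.+1.
Qed.

Lemma smooth_on_derive W (f : 'rV[R]_m -> W) v :
  smooth_on D f -> smooth_on D ('D_v f).
Proof.
by move=> /smooth_onP sf; apply/smooth_onP => k; have [_ /(_ v)] := sf k.+1.
Qed.

Lemma smooth_on_differentiable W (f : 'rV[R]_m -> W) x :
  smooth_on D f -> D x -> differentiable f x.
Proof. by move=> /(_ [::] x). Qed.

Lemma near_open x : D x -> \forall y \near x, D y.
Proof. by move=> Dx; apply: open_nbhs_nbhs. Qed.

Lemma near_open_eq W (f g : 'rV[R]_m -> W) x :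
  (forall y, D y -> f y = g y) -> D x -> \forall y \near x, f y = g y.
Proof. by move=> fg Dx; apply: filterS (near_open Dx) => y; apply: fg. Qed.

Lemma differentiable_upto_ext W k (f g : 'rV[R]_m -> W) :
  (forall x, D x -> f x = g x) ->
  differentiable_upto k f -> differentiable_upto k g.
Proof.
elim: k f g => [|k IH] f g fg [df dkf]; (split; first by move=> x Dx;
  apply: near_eq_differentiable (df x Dx); exact: near_open_eq) => // v.
by apply: (IH _ _ _ (dkf v)) => x Dx; apply: near_eq_derive; exact: near_open_eq.
Qed.

Lemma differentiable_uptoS W k (f : 'rV[R]_m -> W) :
  differentiable_upto k.+1 f -> differentiable_upto k f.
Proof.
elim: k f => [|k IH] f [df dkf]; split=> // v.
exact/IH/dkf.
Qed.

Lemma smooth_on_ext W (f g : 'rV[R]_m -> W) :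
  (forall x, D x -> f x = g x) -> smooth_on D f -> smooth_on D g.
Proof.
by move=> fg /smooth_onP sf; apply/smooth_onP => k; apply: differentiable_upto_ext fg (sf k).
Qed.

Lemma differentiable_upto_cst W k (w : W) : differentiable_upto k (fun _ => w).
Proof.
elim: k w => [|k IH] w; split=> // v.
have -> : 'D_v (fun _ => w) = (fun _ => 0) :> ('rV[R]_m -> W).
  by apply/funext => x; exact: derive_cst.
exact: IH.
Qed.

Lemma differentiable_uptoD W k (f g : 'rV[R]_m -> W) :
  differentiable_upto k f -> differentiable_upto k g ->
  differentiable_upto k (fun x => f x + g x).
Proof.
elim: k f g => [|k IH] f g [df dkf] [dg dkg]; (split; first by move=> x Dx;
  apply: differentiableD; [exact: df|exact: dg]) => // v.
apply: differentiable_upto_ext (IH _ _ (dkf v) (dkg v)) => x Dx.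
by rewrite -deriveD //; apply: diff_derivable; [exact: df|exact: dg].
Qed.

Lemma differentiable_upto_cbilin U V W (b : U -> V -> W) k f g : cbilin b ->
  differentiable_upto k f -> differentiable_upto k g ->
  differentiable_upto k (fun x => b (f x) (g x)).
Proof.
move=> bb; elim: k f g => [|k IH] f g dkf dkg.
  by split=> // x Dx; apply: differentiable_cbilin; [|exact: dkf.1|exact: dkg.1].
have [df dDf] := dkf; have [dg dDg] := dkg.
split=> [x Dx|v].
  by apply: differentiable_cbilin; [|exact: df|exact: dg].
apply: differentiable_upto_ext (differentiable_uptoD
  (IH _ _ (dDf v) (differentiable_uptoS dkg))
  (IH _ _ (differentiable_uptoS dkf) (dDg v))) => x Dx.
by apply/esym/derive_cbilin; [|exact: df|exact: dg].
Qed.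

Lemma smooth_on_cst W (w : W) : smooth_on D (fun _ => w).
Proof. by apply/smooth_onP => k; exact: differentiable_upto_cst. Qed.

Lemma smooth_onD W (f g : 'rV[R]_m -> W) :
  smooth_on D f -> smooth_on D g -> smooth_on D (fun x => f x + g x).
Proof.
move=> /smooth_onP sf /smooth_onP sg; apply/smooth_onP => k.
exact: differentiable_uptoD.
Qed.

Lemma smooth_on_cbilin U V W (b : U -> V -> W) f g : cbilin b ->
  smooth_on D f -> smooth_on D g -> smooth_on D (fun x => b (f x) (g x)).
Proof.
move=> bb /smooth_onP sf /smooth_onP sg; apply/smooth_onP => k.
exact: differentiable_upto_cbilin.
Qed.

Lemma smooth_onZ W (r : 'rV[R]_m -> R^o) (f : 'rV[R]_m -> W) :
  smooth_on D r -> smooth_on D f -> smooth_on D (fun x => (r x : R) *: f x).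
Proof. exact: (smooth_on_cbilin (@cbilin_scale R W)). Qed.

Lemma smooth_on_sum W I (s : seq I) (P : pred I) (F : I -> 'rV[R]_m -> W) :
  (forall i, P i -> smooth_on D (F i)) ->
  smooth_on D (fun x => \sum_(i <- s | P i) F i x).
Proof.
move=> sF; elim: s => [|i s IH].
  apply: (smooth_on_ext _ (smooth_on_cst (0 : W))) => x _; by rewrite big_nil.
have [Pi|nPi] := boolP (P i).
  apply: (smooth_on_ext _ (smooth_onD (sF i Pi) IH)) => x _.
  by rewrite big_cons Pi.
by apply: (smooth_on_ext _ IH) => x _; rewrite big_cons (negPf nPi).
Qed.

Lemma smooth_on_prod I (s : seq I) (F : I -> 'rV[R]_m -> R^o) :
  (forall i, smooth_on D (F i)) ->
  smooth_on D (fun x => \prod_(i <- s) (F i x : R) : R^o).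
Proof.
move=> sF; elim: s => [|i s IH].
  apply: (smooth_on_ext _ (smooth_on_cst (1 : R^o))) => x _; by rewrite big_nil.
by apply: (smooth_on_ext _ (smooth_onZ (sF i) IH)) => x _; rewrite big_cons.
Qed.

(** The derivative of 1/f along v is -(1/f)(1/f) 'D_v f, so order k of 1/f yields order k+1. *)
Lemma smooth_on_inv (f : 'rV[R]_m -> R^o) :
  (forall x, D x -> f x != 0) -> smooth_on D f ->
  smooth_on D (fun x => (f x : R)^-1 : R^o).
Proof.
move=> f0 /smooth_onP sf; apply/smooth_onP.
have df x : D x -> differentiable (fun x => (f x : R)^-1 : R^o) x.
  by move=> Dx; apply: differentiableV; [exact: (sf 0%N).1|exact: f0].
elim=> [|k IH]; split=> // v.
have bb := cbilin_scale R^o.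
have := differentiable_upto_cbilin bb (differentiable_upto_cst k (-1 : R^o))
  (differentiable_upto_cbilin bb (differentiable_upto_cbilin bb IH IH)
     ((sf k.+1).2 v)).
apply: differentiable_upto_ext => x Dx.
rewrite deriveV /=; [|exact: f0|by apply/diff_derivable/(sf 0%N).1].
by rewrite scaleN1r -scaleNr -exprVn expr2.
Qed.

Lemma smooth_on_det k (A : 'rV[R]_m -> 'M[R]_k) :
  (forall i j, smooth_on D (fun x => A x i j : R^o)) ->
  smooth_on D (fun x => \det (A x) : R^o).
Proof.
move=> sA; apply: smooth_on_sum => s _.
have sp := @smooth_on_prod _ (index_enum 'I_k) _ (fun i => sA i ((s : {perm 'I_k}) i)).
exact: (smooth_on_ext _ (smooth_onZ (smooth_on_cst ((-1) ^+ s : R^o)) sp)).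
Qed.

(** By Cramer's rule an entry of the inverse is a cofactor divided by the determinant. Applied to
    the matrix of omega, this makes the coefficients of Lam smooth. *)
Lemma smooth_on_invmx k (A : 'rV[R]_m -> 'M[R]_k) i j :
  (forall x, D x -> A x \in unitmx) ->
  (forall i j, smooth_on D (fun x => A x i j : R^o)) ->
  smooth_on D (fun x => invmx (A x) i j : R^o).
Proof.
move=> uA sA.
have sdet := smooth_on_inv _ (smooth_on_det sA).
have sadj : smooth_on D (fun x => (\adj (A x)) i j : R^o).
  apply: (@smooth_on_ext _ (fun x => ((-1) ^+ (j + i) : R^o) *:
     (\det (row' j (col' i (A x))) : R^o))).
    by move=> x _; rewrite mxE.
  apply: (smooth_onZ (smooth_on_cst _)); apply: smooth_on_det => k1 k2.
  by apply: (smooth_on_ext _ (sA (lift j k1) (lift i k2))) => x _; rewrite !mxE.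
apply: (smooth_on_ext _ (smooth_onZ (sdet _) sadj)) => x Dx.
  by rewrite /invmx uA // !mxE.
by have := uA x Dx; rewrite unitmxE unitfE.
Qed.

End Smoothness.

(** * Symmetry of second derivatives *)

Section Schwarz.
Variables (R : realType) (V : normedModType R).
Implicit Types (f : V -> R) (x u w : V).

Let is_derive_line f u c s : differentiable f (s *: u + c) ->
  is_derive s 1 (fun t : R => f (t *: u + c) : R) ('D_u f (s *: u + c)).
Proof.
move=> df.
have E : (fun h : R => h^-1 *:
    (((fun t : R => f (t *: u + c)) \o shift s) (h *: 1) - f (s *: u + c))) =
  (fun h => h^-1 *: ((f \o shift (s *: u + c)) (h *: u) - f (s *: u + c))).
  by apply/funext => h /=; rewrite scalerDl addrA /GRing.scale /= mulr1.
have dd : derivable f (s *: u + c) u by exact: diff_derivable.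
split; first by move: dd; rewrite /derivable -E.
by rewrite /derive -E.
Qed.

(* Mean value theorem for s |-> f (s u + t w + x) - f (s u + x) on [0, t]. *)
Lemma second_difference f x u w : (\forall y \near x, differentiable f y) ->
  differentiable ('D_u f) x ->
  forall e, 0 < e -> \forall t \near (0 : R)^'+,
   `|(f (t *: u + (t *: w + x)) - f (t *: w + x) - (f (t *: u + x) - f x))
      / t ^+ 2 - 'D_w ('D_u f) x| <= e.
Proof.
move=> df dh e e0; set h := 'D_u f in dh *.
(* The two error terms are taken at xi u + t w and xi u with 0 <= xi <= t, whose norms add up to at
   most t (2|u| + |w|); the summand 1 keeps K positive. *)
pose K := 2 * `|u| + `|w| + 1.
have K0 : 0 < K by rewrite ltr_wpDl // addr_ge0 ?mulr_ge0.
have eK0 : 0 < e / K by rewrite divr_gt0.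
have [_ /eqaddoP/(_ _ eK0) hz] := (diff_locallyP _ _).1 dh.
move: df; rewrite (near_shift 0) => df.
have /nbhs_ballP[d /= d0 dP] : \forall z \near (0 : V),
    `|h (z + x) - h x - 'd h x z| <= e / K * `|z| /\ differentiable f (z + x).
  by apply: filterS2 hz df => z; rewrite /= subr0 !fctE /= opprD addrA.
have dz z : `|z| < d -> `|h (z + x) - h x - 'd h x z| <= e / K * `|z| /\
    differentiable f (z + x).
  by move=> zd; apply: dP; rewrite -ball_normE /= sub0r normrN.
near=> t.
have t0 : 0 < t by near: t; exact: nbhs_right_gt.
have td : t * K < d.
  by rewrite -ltr_pdivlMr //; near: t; apply: nbhs_right_lt; rewrite divr_gt0.
have nz1 s : 0 <= s <= t -> `|s *: u + t *: w| <= t * (`|u| + `|w|).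
  case/andP=> s0 st; rewrite (le_trans (ler_normD _ _)) // !normrZ mulrDr.
  by rewrite !ger0_norm ?(ltW t0) // lerD // ler_wpM2r.
have nz2 s : 0 <= s <= t -> `|s *: u| <= t * `|u|.
  by case/andP=> s0 st; rewrite normrZ ger0_norm // ler_wpM2r.
have bd c : 0 <= c -> c <= K -> t * c < d.
  by move=> c0 cK; rewrite (le_lt_trans _ td) // ler_wpM2l // ltW.
have K1 : `|u| + `|w| <= K by rewrite /K; have := normr_ge0 u; lra.
have K2 : `|u| <= K by rewrite /K; have := normr_ge0 u; have := normr_ge0 w; lra.
have d1 s : 0 <= s <= t -> `|s *: u + t *: w| < d.
  by move=> /nz1 /le_lt_trans; apply; rewrite bd // addr_ge0.
have d2 s : 0 <= s <= t -> `|s *: u| < d.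
  by move=> /nz2 /le_lt_trans; apply; rewrite bd.
pose g (s : R) : R := f (s *: u + (t *: w + x)) - f (s *: u + x).
pose dg (s : R) : R := h (s *: u + (t *: w + x)) - h (s *: u + x).
have gd s : 0 <= s <= t -> is_derive s 1 g (dg s).
  move=> st; apply: is_deriveB; apply: is_derive_line.
    by rewrite addrA; exact: (dz _ (d1 s st)).2.
  exact: (dz _ (d2 s st)).2.
have gc : {within `[0, t], continuous g}.
  apply: derivable_within_continuous => s; rewrite in_itv /= => st.
  exact: (@ex_derive _ _ _ _ _ _ _ (gd s st)).
have gdo s : s \in `]0, t[%R -> is_derive s 1 g (dg s).
  by rewrite in_itv /= => /andP[s0 st]; apply: gd; rewrite !ltW.
have [xi] := MVT t0 gdo gc.
rewrite in_itv /= subr0 => /andP[/ltW xi0 /ltW xit] E.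
have xiI : 0 <= xi <= t by rewrite xi0 xit.
have E' : f (t *: u + (t *: w + x)) - f (t *: w + x) - (f (t *: u + x) - f x) =
    dg xi * t.
  by rewrite -E /g !scale0r !add0r; ring.
rewrite E' deriveE //.
have [A1 _] := dz _ (d1 _ xiI).
have [A2 _] := dz _ (d2 _ xiI).
have AL : 'd h x (xi *: u + t *: w) = 'd h x (xi *: u) + t * 'd h x w.
  by rewrite linearD; congr (_ + _); rewrite linearZ.
(* Both values of h are expanded to first order at x: h(x) and the differential at xi u cancel, and
   t 'd h x w remains. *)
have -> : dg xi * t / t ^+ 2 - 'd h x w =
  ((h (xi *: u + t *: w + x) - h x - 'd h x (xi *: u + t *: w)) -
   (h (xi *: u + x) - h x - 'd h x (xi *: u))) / t.
  by rewrite AL /dg addrA; field; rewrite gt_eqF.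
rewrite normrM normfV (gtr0_norm t0) ler_pdivrMr //.
rewrite (le_trans (ler_normB _ _)) // (le_trans (lerD A1 A2)) //.
rewrite -mulrDr -mulrA ler_wpM2l ?(ltW e0) // ler_pdivrMl //.
rewrite (le_trans (lerD (nz1 _ xiI) (nz2 _ xiI))) // /K.
by rewrite -mulrDr mulrC ler_wpM2r ?(ltW t0) //; lra.
Unshelve. all: by end_near. Qed.

(** The second difference is symmetric in u and w, so one quotient q lies within e/2 of both mixed
    derivatives. *)
Lemma derive_comm f x u w : (\forall y \near x, differentiable f y) ->
  differentiable ('D_u f) x -> differentiable ('D_w f) x ->
  'D_u ('D_w f) x = 'D_w ('D_u f) x.
Proof.
move=> df du dw; apply/eqP; rewrite -subr_eq0 -normr_le0.
apply/ler_addgt0Pr => e e0; rewrite add0r.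
have e2 : 0 < e / 2 by rewrite divr_gt0.
have /filter_ex[t [A B]] := @filterI _ _ (at_right_proper_filter (0 : R)) _ _
  (second_difference w df du e2)
  (second_difference u df dw e2).
have E : f (t *: w + (t *: u + x)) - f (t *: u + x) - (f (t *: w + x) - f x) =
  f (t *: u + (t *: w + x)) - f (t *: w + x) - (f (t *: u + x) - f x).
  by rewrite addrCA; ring.
rewrite E in B; move: A B; rewrite [e in _ -> _ -> _ <= e]splitr.
set q := _ / _ => A B.
have -> : 'D_u ('D_w f) x - 'D_w ('D_u f) x =
  (q - 'D_w ('D_u f) x) - (q - 'D_u ('D_w f) x).
  by rewrite opprB [RHS]addrC subrKA.
exact: le_trans (ler_normB _ _) (lerD A B).
Qed.

End Schwarz.

(** * Exterior derivative *)

Section ExtCalculus.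
Variables (R : realType) (m : nat).
Implicit Types (U V W : normedModType R) (x v : 'rV[R]_m) (a : 'I_m).

Definition ext_derive W v (alpha : 'rV[R]_m -> ext m W) x : ext m W :=
  [ffun S : {set 'I_m} => 'D_v (fun y => alpha y S) x].

Lemma ext_deriveE W v (alpha : 'rV[R]_m -> ext m W) x (S : {set 'I_m}) :
  ext_derive v alpha x S = 'D_v (fun y => alpha y S) x.
Proof. by rewrite ffunE. Qed.

Definition ext_differentiable W (alpha : 'rV[R]_m -> ext m W) x :=
  forall S : {set 'I_m}, differentiable (fun y => alpha y S) x.

Local Notation e_ a := (delta_mx 0 a : 'rV[R]_m).

Lemma extdE W (alpha : 'rV[R]_m -> ext m W) x :
  extd alpha x = \sum_a ext_mul a (ext_derive (e_ a) alpha x).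
Proof. by apply: eq_bigr => a _; rewrite wedge_covec1. Qed.

Lemma is_diff_bigsum W I (s : seq I) (P : pred I) (F : I -> 'rV[R]_m -> W) x :
  (forall i, P i -> differentiable (F i) x) ->
  differentiable (fun y => \sum_(i <- s | P i) F i y) x /\
  forall v, 'D_v (fun y => \sum_(i <- s | P i) F i y) x =
    \sum_(i <- s | P i) 'D_v (F i) x.
Proof.
move=> dF; elim: s => [|i s [IHd IHD]].
  have -> : (fun y => \sum_(i <- [::] | P i) F i y) = (fun=> 0).
    by apply/funext => y; rewrite big_nil.
  by split=> [|v]; [exact: differentiable_cst|rewrite big_nil; exact: derive_cst].
have [Pi|nPi] := boolP (P i).
  have -> : (fun y => \sum_(j <- i :: s | P j) F j y) =
      F i + (fun y => \sum_(j <- s | P j) F j y).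
    by apply/funext => y; rewrite big_cons Pi.
  split=> [|v]; first by apply: differentiableD; [exact: dF|].
  rewrite deriveD; [|exact/diff_derivable/dF|exact: diff_derivable].
  by rewrite IHD big_cons Pi.
have -> : (fun y => \sum_(j <- i :: s | P j) F j y) =
    (fun y => \sum_(j <- s | P j) F j y).
  by apply/funext => y; rewrite big_cons (negPf nPi).
by split=> // v; rewrite IHD big_cons (negPf nPi).
Qed.

Lemma near_eq_ext_derive W v (alpha beta : 'rV[R]_m -> ext m W) x :
  (\forall y \near x, alpha y = beta y) ->
  ext_derive v alpha x = ext_derive v beta x.
Proof.
move=> ab; apply/ffunP => S; rewrite !ffunE; apply: near_eq_derive.
by apply: filterS ab => y ->.
Qed.

Lemma near_eq_extd W (alpha beta : 'rV[R]_m -> ext m W) x :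
  (\forall y \near x, alpha y = beta y) -> extd alpha x = extd beta x.
Proof.
move=> ab; rewrite !extdE; apply: eq_bigr => a _.
by rewrite (near_eq_ext_derive _ ab).
Qed.

Lemma ext_differentiable_sum W I (s : seq I) (P : pred I)
    (F : I -> 'rV[R]_m -> ext m W) x :
  (forall i, P i -> ext_differentiable (F i) x) ->
  ext_differentiable (fun y => \sum_(i <- s | P i) F i y) x.
Proof.
move=> dF S.
have -> : (fun y => (\sum_(i <- s | P i) F i y) S) =
    (fun y => \sum_(i <- s | P i) F i y S).
  by apply/funext => y; rewrite sum_ffunE.
by apply: (is_diff_bigsum s _).1 => i Pi; exact: dF.
Qed.

Lemma ext_derive_sum W I (s : seq I) (P : pred I)
    (F : I -> 'rV[R]_m -> ext m W) v x :
  (forall i, P i -> ext_differentiable (F i) x) ->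
  ext_derive v (fun y => \sum_(i <- s | P i) F i y) x =
  \sum_(i <- s | P i) ext_derive v (F i) x.
Proof.
move=> dF; apply/ffunP => S; rewrite ffunE sum_ffunE.
have -> : (fun y => (\sum_(i <- s | P i) F i y) S) =
    (fun y => \sum_(i <- s | P i) F i y S).
  by apply/funext => y; rewrite sum_ffunE.
rewrite (is_diff_bigsum s _).2; last by move=> i Pi; exact: dF.
by apply: eq_bigr => i _; rewrite ffunE.
Qed.

Lemma ext_deriveD W v (alpha beta : 'rV[R]_m -> ext m W) x :
  ext_differentiable alpha x -> ext_differentiable beta x ->
  ext_derive v (fun y => alpha y + beta y) x =
  ext_derive v alpha x + ext_derive v beta x.
Proof.
move=> da db; apply/ffunP => S; rewrite !ffunE.
have -> : (fun y => (alpha y + beta y) S) =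
    (fun y => alpha y S) + (fun y => beta y S).
  by apply/funext => y; rewrite ffunE.
by rewrite deriveD //; exact: diff_derivable.
Qed.

Lemma extdD W (alpha beta : 'rV[R]_m -> ext m W) x :
  ext_differentiable alpha x -> ext_differentiable beta x ->
  extd (fun y => alpha y + beta y) x = extd alpha x + extd beta x.
Proof.
move=> da db; rewrite !extdE -big_split /=; apply: eq_bigr => a _.
by rewrite ext_deriveD // linearD.
Qed.

Section Products.
Variables (U V W : normedModType R) (b : U -> V -> W).
Hypothesis bb : cbilin b.

Section Pointwise.
Variables (f : 'rV[R]_m -> U) (beta : 'rV[R]_m -> ext m V) (x : 'rV[R]_m).
Hypotheses (df : differentiable f x) (db : ext_differentiable beta x).

Lemma ext_differentiable_map :
  ext_differentiable (fun y => ext_map (b (f y)) (beta y)) x.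
Proof.
move=> S.
have -> : (fun y => ext_map (b (f y)) (beta y) S) = (fun y => b (f y) (beta y S)).
  by apply/funext => y; rewrite ffunE.
exact: differentiable_cbilin.
Qed.

Lemma ext_derive_map v :
  ext_derive v (fun y => ext_map (b (f y)) (beta y)) x =
  ext_map (b ('D_v f x)) (beta x) + ext_map (b (f x)) (ext_derive v beta x).
Proof.
apply/ffunP => S; rewrite !ffunE.
have -> : (fun y => ext_map (b (f y)) (beta y) S) = (fun y => b (f y) (beta y S)).
  by apply/funext => y; rewrite ffunE.
exact: derive_cbilin.
Qed.

End Pointwise.

Section WedgeProduct.
Variables (alpha : 'rV[R]_m -> ext m U) (beta : 'rV[R]_m -> ext m V).
Variable x : 'rV[R]_m.
Hypotheses (da : ext_differentiable alpha x) (db : ext_differentiable beta x).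

Let term (S T : {set 'I_m}) y :=
  (-1) ^+ shuffle_inv T (S :\: T) *: b (alpha y T) (beta y (S :\: T)).

Let dterm S T : differentiable (term S T) x.
Proof. by apply: differentiableZ; exact: differentiable_cbilin. Qed.

Let wE S : (fun y => wedge b (alpha y) (beta y) S) =
  (fun y => \sum_(T : {set 'I_m} | T \subset S) term S T y).
Proof. by apply/funext => y; rewrite ffunE. Qed.

Lemma ext_differentiable_wedge :
  ext_differentiable (fun y => wedge b (alpha y) (beta y)) x.
Proof. by move=> S; rewrite wE; exact: (is_diff_bigsum _ _).1. Qed.

Lemma ext_derive_wedge v :
  ext_derive v (fun y => wedge b (alpha y) (beta y)) x =
  wedge b (ext_derive v alpha x) (beta x) +
  wedge b (alpha x) (ext_derive v beta x).
Proof.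
apply/ffunP => S; rewrite !ffunE wE (is_diff_bigsum _ _).2; last first.
  by move=> T _; exact: dterm.
rewrite -big_split /=; apply: eq_bigr => T _.
rewrite /term deriveZ; last exact/diff_derivable/differentiable_cbilin.
by rewrite derive_cbilin // scalerDr !ffunE.
Qed.

(** The sign comes from carrying each e_a past alpha at the point x. *)
Lemma extd_wedge k : homog k (alpha x) ->
  extd (fun y => wedge b (alpha y) (beta y)) x =
  wedge b (extd alpha x) (beta x) +
  (-1) ^+ k *: wedge b (alpha x) (extd beta x).
Proof.
move=> ha; have wb := bilin_wedge (m := m) bb.1.
rewrite !extdE (bilin_suml wb) (bilin_sumr wb) scaler_sumr -big_split /=.
apply: eq_bigr => a _; rewrite ext_derive_wedge linearD /=.
by rewrite wedge_mull ?(wedge_mulr _ _ bb.1 ha) //; exact: bb.1.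
Qed.

End WedgeProduct.
End Products.

Lemma ext_differentiable_mul W a (alpha : 'rV[R]_m -> ext m W) x :
  ext_differentiable alpha x -> ext_differentiable (fun y => ext_mul a (alpha y)) x.
Proof.
move=> da S; have [aS|aS] := boolP (a \in S).
  have -> : (fun y => ext_mul a (alpha y) S) =
    (-1) ^+ shuffle_inv [set a]%SET (S :\ a)%SET *: (fun y => alpha y (S :\ a)%SET).
    by apply/funext => y; rewrite ffunE aS.
  exact: differentiableZ.
have -> : (fun y => ext_mul a (alpha y) S) = (fun=> 0).
  by apply/funext => y; rewrite ffunE (negPf aS).
exact: differentiable_cst.
Qed.

Lemma ext_derive_mul W v a (alpha : 'rV[R]_m -> ext m W) x :
  ext_differentiable alpha x ->
  ext_derive v (fun y => ext_mul a (alpha y)) x = ext_mul a (ext_derive v alpha x).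
Proof.
move=> da; apply/ffunP => S; rewrite !ffunE; have [aS|aS] := boolP (a \in S).
  have -> : (fun y => ext_mul a (alpha y) S) =
    (-1) ^+ shuffle_inv [set a]%SET (S :\ a)%SET *: (fun y => alpha y (S :\ a)%SET).
    by apply/funext => y; rewrite ffunE aS.
  by rewrite deriveZ //; exact/diff_derivable/da.
have -> : (fun y => ext_mul a (alpha y) S) = (fun=> 0).
  by apply/funext => y; rewrite ffunE (negPf aS).
exact: derive_cst.
Qed.

(** Exchanging the two indices turns the sum into its negative. Applied to second derivatives this
    gives d d = 0 and d(dy_b) = 0. *)
Lemma sum_ext_mul_sym W (F : 'I_m -> 'I_m -> ext m W) :
  (forall a c, F a c = F c a) ->
  \sum_a \sum_c ext_mul a (ext_mul c (F a c)) = 0.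
Proof.
move=> Fs; set s := \sum_a _.
have : s = - s.
  rewrite {1}/s exchange_big -sumrN; apply: eq_bigr => a _ /=.
  by rewrite -sumrN; apply: eq_bigr => c _; rewrite ext_mulC Fs.
move/eqP; rewrite -addr_eq0 -mulr2n -scaler_nat scaler_eq0 pnatr_eq0.
by move=> /eqP.
Qed.

Definition ext_smooth_on W (D : set 'rV[R]_m) (alpha : 'rV[R]_m -> ext m W) :=
  forall S : {set 'I_m}, smooth_on D (fun y => alpha y S).

Lemma ext_smooth_differentiable W D (alpha : 'rV[R]_m -> ext m W) x :
  ext_smooth_on D alpha -> D x -> ext_differentiable alpha x.
Proof. by move=> sa Dx S; exact: smooth_on_differentiable (sa S) Dx. Qed.

Lemma ext_smooth_derive W D v (alpha : 'rV[R]_m -> ext m W) :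
  ext_smooth_on D alpha -> ext_smooth_on D (ext_derive v alpha).
Proof.
move=> sa S; have -> : (fun y => ext_derive v alpha y S) =
    'D_v (fun y => alpha y S) by apply/funext => y; rewrite ffunE.
exact: smooth_on_derive.
Qed.

(** The mean value argument behind [derive_comm] is for real values, so matrices are treated entry
    by entry. Entries of a derivative are derivatives of entries only on D, whence the equalities
    near x. *)
Lemma derive_comm_mx p q (f : 'rV[R]_m -> 'M[R]_(p, q)) D u w x :
  open D -> smooth_on D f -> D x -> 'D_u ('D_w f) x = 'D_w ('D_u f) x.
Proof.
move=> Do sf Dx; have su v : smooth_on D ('D_v f) := smooth_on_derive v sf.
have coordE (g : 'rV[R]_m -> 'M[R]_(p, q)) v i j y : smooth_on D g -> D y ->
    ('D_v g y) i j = 'D_v (fun z => g z i j) y.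
  by move=> sg Dy; apply: derive_coord; exact: smooth_on_differentiable sg Dy.
apply/matrixP => i j.
apply: etrans (coordE ('D_w f) u i j x (su w) Dx) _.
apply/esym; apply: etrans (coordE ('D_u f) w i j x (su u) Dx) _; apply/esym.
have nE v : \forall y \near x, 'D_v f y i j = 'D_v (fun z => f z i j) y.
  by apply: filterS (near_open Do Dx) => y Dy; exact: coordE.
rewrite (near_eq_derive _ (nE w)) (near_eq_derive _ (nE u)).
apply: derive_comm.
- apply: filterS (near_open Do Dx) => y Dy.
  exact: ((differentiable_mxP f y).1 (smooth_on_differentiable sf Dy) i j).
- apply: (near_eq_differentiable (nE u)).
  exact: ((differentiable_mxP ('D_u f) x).1 (smooth_on_differentiable (su u) Dx) i j).
- apply: (near_eq_differentiable (nE w)).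
  exact: ((differentiable_mxP ('D_w f) x).1 (smooth_on_differentiable (su w) Dx) i j).
Qed.

Lemma extd_extd p q D (alpha : 'rV[R]_m -> ext m 'M[R]_(p, q)) x :
  open D -> ext_smooth_on D alpha -> D x -> extd (extd alpha) x = 0.
Proof.
move=> Do sa Dx.
have dd a c y : D y ->
    ext_differentiable (fun z => ext_mul c (ext_derive (e_ c) alpha z)) y.
  move=> Dy; apply: ext_differentiable_mul.
  exact: ext_smooth_differentiable (ext_smooth_derive _ sa) Dy.
have -> : extd alpha = fun y => \sum_c ext_mul c (ext_derive (e_ c) alpha y).
  by apply/funext => y; exact: extdE.
rewrite extdE -[RHS](sum_ext_mul_sym (F := fun a c =>
  ext_derive (e_ a) (ext_derive (e_ c) alpha) x)).
  apply: eq_bigr => a _; rewrite ext_derive_sum; last by move=> c _; exact: dd.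
  rewrite linear_sum; apply: eq_bigr => c _ /=; rewrite ext_derive_mul //.
  exact: ext_smooth_differentiable (ext_smooth_derive _ sa) Dx.
move=> a c; apply/ffunP => S.
have E v : (fun y => ext_derive v alpha y S) = 'D_v (fun y => alpha y S).
  by apply/funext => y; rewrite ffunE.
apply: etrans (ext_deriveE _ _ _ _) _; apply/esym.
apply: etrans (ext_deriveE _ _ _ _) _; apply/esym.
apply: etrans (congr1 (fun g => 'D_(e_ a) g x) (E (e_ c))) _.
apply: etrans (derive_comm_mx (e_ a) (e_ c) Do (sa S) Dx) _.
exact: (congr1 (fun g => 'D_(e_ c) g x) (esym (E (e_ a)))).
Qed.

End ExtCalculus.

Lemma ext_map_scale (R : realType) m (W : lmodType R) (r : R) (beta : ext m W) :
  ext_map (fun w => r *: w) beta = r *: beta.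
Proof. by apply/ffunP => S; rewrite !ffunE. Qed.

Lemma ext_mul_cov_mul (R : realType) m (W : lmodType R) a v (beta : ext m W) :
  ext_mul a (cov_mul v beta) = - cov_mul v (ext_mul a beta).
Proof.
rewrite /cov_mul -sumrN [ext_mul a _]linear_sum; apply: eq_bigr => c _ /=.
by rewrite [ext_mul a (_ *: _)]linearZ /= ext_mulC scalerN.
Qed.

(** * The exterior derivative commutes with pullback *)

Section PullbackCalculus.
Variables (R : realType) (m : nat).
Local Notation e_ a := (delta_mx 0 a : 'rV[R]_m).
Variables (phi : 'rV[R]_m -> 'rV[R]_m) (D : set 'rV[R]_m).
Hypotheses (Dopen : open D) (sphi : smooth_on D phi).

Lemma jacobianE y c b : D y -> ('J phi y) c b = ('D_(e_ c) phi y) 0 b.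
Proof.
move=> Dy; rewrite deriveE; last exact: smooth_on_differentiable sphi Dy.
by rewrite /jacobian mxE.
Qed.

Let near_jac x c b : D x -> \forall y \near x,
  ('D_(e_ c) phi y) 0 b = ('J phi y) c b.
Proof.
by move=> Dx; apply: filterS (near_open Dopen Dx) => y Dy; rewrite jacobianE.
Qed.

Lemma differentiable_jacobian x c b : D x ->
  differentiable (fun y => ('J phi y) c b : R^o) x.
Proof.
move=> Dx; apply: near_eq_differentiable (near_jac c b Dx) _.
apply: ((differentiable_mxP ('D_(e_ c) phi) x).1 _ 0 b).
exact: smooth_on_differentiable (smooth_on_derive (e_ c) sphi) Dx.
Qed.

Lemma derive_jacobianC x a c b : D x ->
  'D_(e_ a) (fun y => ('J phi y) c b : R^o) x =
  'D_(e_ c) (fun y => ('J phi y) a b : R^o) x.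
Proof.
move=> Dx.
have dd v : differentiable ('D_v phi) x :=
  smooth_on_differentiable (smooth_on_derive v sphi) Dx.
apply: etrans (esym (near_eq_derive (e_ a) (near_jac c b Dx))) _.
apply: etrans (near_eq_derive (e_ c) (near_jac a b Dx)).
apply: etrans (esym (derive_coord (e_ a) 0 b (dd (e_ c)))) _.
apply: etrans (derive_coord (e_ c) 0 b (dd (e_ a))).
by apply: (congr1 (fun M : 'rV[R]_m => M 0 b)); exact: derive_comm_mx Dopen sphi Dx.
Qed.

Section CovMul.
Variables (W : normedModType R) (b : 'I_m) (beta : 'rV[R]_m -> ext m W).
Variable x : 'rV[R]_m.
Hypotheses (Dx : D x) (db : ext_differentiable beta x).

Let E : (fun y => cov_mul (fun c => ('J phi y) c b) (beta y)) =
  (fun y => \sum_c ext_map (fun w : W => ('J phi y) c b *: w) (ext_mul c (beta y))).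
Proof.
by apply/funext => y; apply: eq_bigr => c _; rewrite ext_map_scale.
Qed.

Let dterm c : ext_differentiable (fun y =>
  ext_map (fun w : W => ('J phi y) c b *: w) (ext_mul c (beta y))) x.
Proof.
apply: (ext_differentiable_map (@cbilin_scale R W)).
  exact: differentiable_jacobian.
exact: ext_differentiable_mul.
Qed.

Lemma ext_differentiable_cov_mul :
  ext_differentiable (fun y => cov_mul (fun c => ('J phi y) c b) (beta y)) x.
Proof. by rewrite E; apply: ext_differentiable_sum => c _; exact: dterm. Qed.

Lemma ext_derive_cov_mul v :
  ext_derive v (fun y => cov_mul (fun c => ('J phi y) c b) (beta y)) x =
  cov_mul (fun c => 'D_v (fun y => ('J phi y) c b : R^o) x) (beta x) +
  cov_mul (fun c => ('J phi x) c b) (ext_derive v beta x).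
Proof.
rewrite E ext_derive_sum; last by move=> c _; exact: dterm.
rewrite -big_split /=; apply: eq_bigr => c _.
rewrite (ext_derive_map (@cbilin_scale R W)).
- by rewrite ext_derive_mul // !ext_map_scale.
- exact: differentiable_jacobian.
- exact: ext_differentiable_mul.
Qed.

(* The coordinate 1-forms dy_b are closed because second partial derivatives
   commute. *)
Lemma extd_cov_mul :
  extd (fun y => cov_mul (fun c => ('J phi y) c b) (beta y)) x =
  - cov_mul (fun c => ('J phi x) c b) (extd beta x).
Proof.
rewrite !extdE.
under eq_bigr => a _ do rewrite ext_derive_cov_mul linearD.
rewrite big_split /= [X in X + _](_ : _ = 0) ?add0r.
  rewrite [cov_mul _ (\sum_(_ <- _) _)]linear_sum -sumrN; apply: eq_bigr => a _ /=.
  exact: ext_mul_cov_mul.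
transitivity (\sum_a \sum_c ext_mul a (ext_mul c
  ('D_(e_ a) (fun y => ('J phi y) c b : R^o) x *: beta x))).
  apply: eq_bigr => a _; rewrite /cov_mul linear_sum; apply: eq_bigr => c _ /=.
  by rewrite [ext_mul c (_ *: _)]linearZ.
apply: sum_ext_mul_sym => a c; congr (_ *: _).
exact: derive_jacobianC.
Qed.

End CovMul.

Lemma ext_differentiable_dy_seq s x : D x ->
  ext_differentiable (fun y => dy_seq ('J phi y) s) x.
Proof.
move=> Dx; elim: s => [S|b s IH]; first exact: differentiable_cst.
exact: ext_differentiable_cov_mul.
Qed.

Lemma extd_dy_seq s x : D x -> extd (fun y => dy_seq ('J phi y) s) x = 0.
Proof.
move=> Dx; elim: s => [|b s IH].
  rewrite extdE big1 // => a _.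
  have -> : ext_derive (e_ a) (fun y => dy_seq ('J phi y) [::]) x = 0.
    apply/ffunP => S; apply: etrans (ext_deriveE _ _ _ _) _.
    by apply: etrans (derive_cst _ _ _) _; rewrite ffunE.
  by rewrite linear0.
rewrite /= extd_cov_mul //; last exact: ext_differentiable_dy_seq.
by rewrite IH linear0 oppr0.
Qed.

Section Naturality.
Variables (W : normedModType R) (alpha : 'rV[R]_m -> ext m W) (x : 'rV[R]_m).
Hypotheses (Dx : D x) (da : ext_differentiable alpha (phi x)).

Let dphi : differentiable phi x := smooth_on_differentiable sphi Dx.

Let dcomp S : differentiable (fun y => alpha (phi y) S) x.
Proof. by apply: (@differentiable_comp _ _ _ _ phi (fun z => alpha z S)). Qed.

Let derive_comp a S : 'D_(e_ a) (fun y => alpha (phi y) S) x =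
  \sum_b ('J phi x) a b *: 'D_(e_ b) (fun z => alpha z S) (phi x).
Proof.
apply: etrans (deriveE _ (dcomp S)) _.
have -> : 'd (fun y => alpha (phi y) S) x (e_ a) =
    'd (fun z => alpha z S) (phi x) ('d phi x (e_ a)).
  have := diff_comp dphi (da S).
  by move=> /(congr1 (fun h => h (e_ a))).
rewrite -(deriveE _ dphi) [X in 'd _ _ X](row_sum_delta ('D_(e_ a) phi x)) linear_sum.
apply: eq_bigr => b _; rewrite linearZ jacobianE //=; congr (_ *: _).
by apply/esym; exact: deriveE.
Qed.

(** Viewing the coefficient w as a 0-form turns each summand of a pullback into a wedge product, to
    which the Leibniz rule applies. *)
Let wedge_zero (theta : ext m R^o) (w : W) :
  wedge (fun (r : R^o) (w : W) => (r : R) *: w) theta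
    [ffun S : {set 'I_m} => if S == finset.set0 then w else 0] = ext_tens theta w.
Proof.
apply/ffunP => S; rewrite !ffunE.
rewrite (bigD1 S) //= finset.setDv big1 ?addr0.
  by rewrite ffunE eqxx shuffle_invE big1 ?scale1r // => i _; rewrite big_set0.
move=> P /andP[PS nPS]; rewrite ffunE finset.setD_eq0.
case: ifP => [SP|]; last by rewrite scaler0 scaler0.
by case/eqP: nPS; apply/eqP; rewrite finset.eqEsubset PS SP.
Qed.

Let term (T : {set 'I_m}) y : ext m W :=
  wedge (fun (r : R^o) (w : W) => (r : R) *: w) (dy_seq ('J phi y) (enum T))
    [ffun S : {set 'I_m} => if S == finset.set0 then alpha (phi y) T else 0].

Let termE y : pullback ('J phi y) (alpha (phi y)) = \sum_T term T y.
Proof. by rewrite pullbackE; apply: eq_bigr => T _; rewrite /term wedge_zero. Qed.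

Let dzero T : ext_differentiable (fun y =>
   [ffun S : {set 'I_m} => if S == finset.set0 then alpha (phi y) T else 0] : ext m W) x.
Proof.
move=> S; have [S0|S0] := eqVneq S finset.set0.
  have -> : (fun y => ([ffun P : {set 'I_m} => if P == finset.set0
      then alpha (phi y) T else 0] : ext m W) S) = (fun y => alpha (phi y) T).
    by apply/funext => y; rewrite ffunE S0 eqxx.
  exact: dcomp.
have -> : (fun y => ([ffun P : {set 'I_m} => if P == finset.set0
    then alpha (phi y) T else 0] : ext m W) S) = (fun y => 0).
  by apply/funext => y; rewrite ffunE (negPf S0).
exact: differentiable_cst.
Qed.

Lemma ext_differentiable_pullback :
  ext_differentiable (fun y => pullback ('J phi y) (alpha (phi y))) x.
Proof.
have -> : (fun y => pullback ('J phi y) (alpha (phi y))) =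
    (fun y => \sum_T term T y) by apply/funext => y; exact: termE.
apply: ext_differentiable_sum => T _.
apply: (ext_differentiable_wedge (@cbilin_scale R W)); last exact: dzero.
exact: ext_differentiable_dy_seq.
Qed.

Let extd_zero T : extd (fun y =>
   [ffun S : {set 'I_m} => if S == finset.set0 then alpha (phi y) T else 0] : ext m W) x =
  \sum_a ext_mul a [ffun S : {set 'I_m} => if S == finset.set0
     then 'D_(e_ a) (fun y => alpha (phi y) T) x else 0].
Proof.
rewrite extdE; apply: eq_bigr => a _; congr ext_mul.
apply/ffunP => S; apply: etrans (ext_deriveE _ _ _ _) _; apply: etrans _ (esym (ffunE _ _)).
have [S0|S0] := eqVneq S finset.set0.
  by apply: (congr1 (fun g => 'D_(e_ a) g x)); apply/funext => y; rewrite ffunE S0 eqxx.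
apply: etrans _ (derive_cst (0 : W) x (e_ a)).
by apply: (congr1 (fun g => 'D_(e_ a) g x)); apply/funext => y; rewrite ffunE (negPf S0).
Qed.

(** In d of the sum of dy_T /\ (alpha_T o phi) the factor dy_T is closed, and the chain rule gives
    d(alpha_T o phi) as the sum over b of the pulled back partial derivatives times dy_b. Moving
    dy_b to the front cancels the Leibniz sign. *)
Lemma extd_pullback :
  extd (fun y => pullback ('J phi y) (alpha (phi y))) x =
  pullback ('J phi x) (extd alpha (phi x)).
Proof.
have -> : (fun y => pullback ('J phi y) (alpha (phi y))) =
    (fun y => \sum_T term T y) by apply/funext => y; exact: termE.
have dterm T : ext_differentiable (term T) x.
  apply: (ext_differentiable_wedge (@cbilin_scale R W)); last exact: dzero.
  exact: ext_differentiable_dy_seq.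
transitivity (\sum_(T : {set 'I_m}) extd (term T) x).
  rewrite extdE (eq_bigr (fun a =>
    \sum_T ext_mul a (ext_derive (e_ a) (term T) x))); last first.
    move=> a _; rewrite ext_derive_sum; first by rewrite linear_sum.
    by move=> T _; exact: dterm.
  by rewrite exchange_big; apply: eq_bigr => T _; rewrite extdE.
have pT (T : {set 'I_m}) : extd (term T) x = \sum_b
   cov_mul (fun c => ('J phi x) c b) (ext_tens (dy_seq ('J phi x) (enum T))
       ('D_(e_ b) (fun z => alpha z T) (phi x))).
  have hT := @homog_dy_seq R m ('J phi x) (enum T).
  have dT := ext_differentiable_dy_seq (enum T) Dx.
  apply: etrans (extd_wedge (@cbilin_scale R W) dT (dzero T) hT) _.
  have wb := bilin_wedge (m := m) (@bilin_scale R W).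
  rewrite extd_dy_seq // (bilin0l wb) add0r extd_zero (bilin_sumr wb) scaler_sumr.
  transitivity (\sum_a \sum_b ('J phi x) a b *: ext_mul a
    (ext_tens (dy_seq ('J phi x) (enum T)) ('D_(e_ b) (fun z => alpha z T) (phi x)))).
    apply: eq_bigr => a _.
    apply: etrans (esym (wedge_mulr a _ (@bilin_scale R W) hT)) _.
    rewrite wedge_zero derive_comp [ext_tens _ _]linear_sum linear_sum.
    apply: eq_bigr => b _ /=.
    rewrite [ext_tens _ (_ *: _)]linearZ.
    by rewrite [ext_mul a (_ *: _)]linearZ.
  by rewrite exchange_big.
rewrite (eq_bigr _ (fun T _ => pT T)) extdE linear_sum exchange_big.
apply: eq_bigr => b _ /=; rewrite pullback_mul pullbackE linear_sum.
by apply: eq_bigr => T _ /=; rewrite ext_deriveE.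
Qed.

End Naturality.
End PullbackCalculus.

Section ExtMapWedge.
Variables (R : realType) (m : nat).

Lemma linear_fun_sum (V W : lmodType R) (f : V -> W) I (s : seq I) (P : pred I) F :
  linear f -> f (\sum_(i <- s | P i) F i) = \sum_(i <- s | P i) f (F i).
Proof.
move=> fl; pose fM := GRing.isLinear.Build _ _ _ _ _ fl.
by pose fL : {linear V -> W} := HB.pack f fM; exact: (linear_sum fL).
Qed.

Lemma linear_fun_scale (V W : lmodType R) (f : V -> W) r v :
  linear f -> f (r *: v) = r *: f v.
Proof.
move=> fl; have f0 : f 0 = 0.
  by have := fl (-1) 0 0; rewrite scaler0 addr0 scaleN1r addNr.
by have := fl r v 0; rewrite f0 !addr0.
Qed.

Lemma ext_map_wedge (U V W U' V' W' : lmodType R) (b : U -> V -> W)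
    (b' : U' -> V' -> W') (f : W -> W') h k (alpha : ext m U) (beta : ext m V) :
  linear f -> (forall u v, f (b u v) = b' (h u) (k v)) ->
  ext_map f (wedge b alpha beta) = wedge b' (ext_map h alpha) (ext_map k beta).
Proof.
move=> fl fE; apply/ffunP => S; rewrite !ffunE linear_fun_sum //.
by apply: eq_bigr => T _; rewrite linear_fun_scale // fE !ffunE.
Qed.

Lemma linear_ext_map (V W : lmodType R) (f : V -> W) :
  linear f -> linear (ext_map f : ext m V -> ext m W).
Proof. by move=> fl r x y; apply/ffunP => S; rewrite !ffunE fl. Qed.

Lemma ext_map_id (W : Type) (beta : ext m W) : ext_map (fun w => w) beta = beta.
Proof. by apply/ffunP => S; rewrite ffunE. Qed.

Lemma ext_map_comp (U V W : Type) (f : V -> W) (g : U -> V) (beta : ext m U) :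
  ext_map f (ext_map g beta) = ext_map (fun u => f (g u)) beta.
Proof. by apply/ffunP => S; rewrite !ffunE. Qed.

Lemma homog_ext_map (V W : lmodType R) (f : V -> W) k (beta : ext m V) :
  linear f -> homog k beta -> homog k (ext_map f beta).
Proof.
by move=> fl hb S Sk; rewrite ffunE hb // -(scale0r 0) linear_fun_scale // scale0r.
Qed.

Lemma covec_sum (W : lmodType R) (v : 'I_m -> W) : covec v = \sum_a
  ext_mul a [ffun S : {set 'I_m} => if S == finset.set0 then v a else 0].
Proof.
apply/ffunP => S; rewrite ffunE sum_ffunE big_mkcond; apply: eq_bigr => a _.
rewrite !ffunE; have [->|nS] := eqVneq S [set a]%SET.
  by rewrite set11 finset.setDv eqxx shuffle_invE big_set1 big_set0 scale1r.
case: ifP => // aS; case: eqP => [S0|]; last by rewrite scaler0.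
by case/eqP: nS; rewrite -(finset.setD1K aS) S0 finset.setU0.
Qed.

Lemma wedge_covec_map (U V W : lmodType R) (b : U -> V -> W) (v : 'I_m -> U)
    (beta : ext m V) : bilin b ->
  wedge b (covec v) beta = \sum_a ext_mul a (ext_map (b (v a)) beta).
Proof.
move=> bb; have wb := bilin_wedge (m := m) bb.
rewrite covec_sum (bilin_suml wb); apply: eq_bigr => a _.
rewrite wedge_mull // wedge_homog0 //; first by rewrite ffunE eqxx.
by move=> S; rewrite ffunE; case: eqP => // -> /eqP; rewrite cards0.
Qed.

End ExtMapWedge.

(** * Smoothness of functions with values in the exterior algebra *)

Section ExtSmooth.
Variables (R : realType) (m : nat) (D : set 'rV[R]_m).
Hypothesis Dopen : open D.
Implicit Types (U V W : normedModType R).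

Lemma ext_smooth_ext W (alpha beta : 'rV[R]_m -> ext m W) :
  (forall x, D x -> alpha x = beta x) ->
  ext_smooth_on D alpha -> ext_smooth_on D beta.
Proof.
move=> ab sa S; apply: (smooth_on_ext Dopen) (sa S) => x Dx.
by rewrite ab.
Qed.

Lemma ext_smoothD W (alpha beta : 'rV[R]_m -> ext m W) :
  ext_smooth_on D alpha -> ext_smooth_on D beta ->
  ext_smooth_on D (fun x => alpha x + beta x).
Proof.
move=> sa sb S; apply: (smooth_on_ext Dopen) (smooth_onD Dopen (sa S) (sb S)) => x _.
by rewrite ffunE.
Qed.

Lemma ext_smooth_sum W I (s : seq I) (P : pred I) (F : I -> 'rV[R]_m -> ext m W) :
  (forall i, P i -> ext_smooth_on D (F i)) ->
  ext_smooth_on D (fun x => \sum_(i <- s | P i) F i x).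
Proof.
move=> sF S.
apply: (smooth_on_ext Dopen) (smooth_on_sum Dopen s (fun i Pi => sF i Pi S)) => x _.
by rewrite sum_ffunE.
Qed.

Lemma ext_smoothZ W (r : 'rV[R]_m -> R^o) (alpha : 'rV[R]_m -> ext m W) :
  smooth_on D r -> ext_smooth_on D alpha ->
  ext_smooth_on D (fun x => (r x : R) *: alpha x).
Proof.
move=> sr sa S; apply: (smooth_on_ext Dopen) (smooth_onZ Dopen sr (sa S)) => x _.
by rewrite ffunE.
Qed.

Lemma ext_smooth_wedge U V W (b : U -> V -> W) alpha beta : cbilin b ->
  ext_smooth_on D alpha -> ext_smooth_on D beta ->
  ext_smooth_on D (fun x => wedge b (alpha x) (beta x)).
Proof.
move=> bb sa sb S.
have sT (T : {set 'I_m}) : T \subset S -> smooth_on D (fun x =>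
    ((-1) ^+ shuffle_inv T (S :\: T)%SET : R) *:
       b (alpha x T) (beta x (S :\: T)%SET)).
  move=> _; have sc := @smooth_on_cst R m D _ ((-1) ^+ shuffle_inv T (S :\: T)%SET : R^o).
  have sw := smooth_on_cbilin Dopen bb (sa T) (sb (S :\: T)%SET).
  exact: (smooth_onZ Dopen sc sw).
apply: (smooth_on_ext Dopen) (smooth_on_sum Dopen _ sT) => x _.
by rewrite ffunE.
Qed.

Lemma ext_smooth_mul W a (alpha : 'rV[R]_m -> ext m W) :
  ext_smooth_on D alpha -> ext_smooth_on D (fun x => ext_mul a (alpha x)).
Proof.
move=> sa S; have [aS|aS] := boolP (a \in S).
  have := smooth_onZ Dopen (@smooth_on_cst R m D _
      ((-1) ^+ shuffle_inv [set a]%SET (S :\ a)%SET : R^o))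
    (sa (S :\ a)%SET).
  by apply: (smooth_on_ext Dopen) => x _; rewrite ffunE aS.
apply: (smooth_on_ext Dopen) (@smooth_on_cst R m D _ (0 : W)) => x _.
by rewrite ffunE (negPf aS).
Qed.

Lemma ext_smooth_contr W a (alpha : 'rV[R]_m -> ext m W) :
  ext_smooth_on D alpha -> ext_smooth_on D (fun x => ext_contr a (alpha x)).
Proof.
move=> sa S; have [aS|aS] := boolP (a \in S).
  apply: (smooth_on_ext Dopen) (@smooth_on_cst R m D _ (0 : W)) => x _.
  by rewrite ffunE aS.
have := smooth_onZ Dopen (@smooth_on_cst R m D _ ((-1) ^+ shuffle_inv [set a]%SET S : R^o))
    (sa (a |: S)%SET).
by apply: (smooth_on_ext Dopen) => x _; rewrite ffunE (negPf aS).
Qed.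

Lemma ext_smooth_extd W (alpha : 'rV[R]_m -> ext m W) :
  ext_smooth_on D alpha -> ext_smooth_on D (extd alpha).
Proof.
move=> sa.
have -> : extd alpha = fun x => \sum_a ext_mul a (ext_derive (delta_mx 0 a) alpha x).
  by apply/funext => x; exact: extdE.
by apply: ext_smooth_sum => a _; apply/ext_smooth_mul/ext_smooth_derive.
Qed.

Lemma homog_extd W k (alpha : 'rV[R]_m -> ext m W) x :
  (forall y, homog k (alpha y)) -> homog k.+1 (extd alpha x).
Proof.
move=> ha; rewrite extdE; apply: homog_sum => a _; apply: homog_mul => S Sk.
rewrite ext_deriveE; have -> : (fun y => alpha y S) = (fun=> 0).
  by apply/funext => y; exact: ha.
exact: derive_cst.
Qed.

End ExtSmooth.

(** * Bundle-valued forms *)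

Section Charts.
Variables (R : realType) (m : nat) (M : manifold R m).
Implicit Types (i : chart M) (D : set M).

Lemma cimg_cmap i D p : cdom i p -> D p -> cimg i D (cmap i p).
Proof. by move=> ip Dp; exists p. Qed.

Lemma cimg_open i D : open D -> open (cimg i D).
Proof.
move=> Do; rewrite openE => _ [p [ip Dp] <-]; rewrite /interior.
have nD : nbhs (cmap i p) (fun x => D (cinv i x)).
  by apply: (cinv_continuous ip); rewrite cmapK //; exact: open_nbhs_nbhs.
have nO : nbhs (cmap i p) (cmap i @` cdom i).
  by apply: open_nbhs_nbhs; split; [exact: cmap_open|exists p].
apply: filterS2 nD nO => x Dx [q iq qx]; exists q => //; split => //.
by move: Dx; rewrite -qx cmapK.
Qed.

Lemma cimgS i D D' : D `<=` D' -> cimg i D `<=` cimg i D'.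
Proof. by move=> DD' _ [p [ip Dp] <-]; exists p => //; split => //; exact: DD'. Qed.

Lemma chart_change_smooth i i' D : D `<=` cdom i' ->
  smooth_on (cimg i D) (cmap i' \o cinv i).
Proof.
move=> Di vs x [p [ip Dp] <-]; apply: (@ctrans_smooth R m M i i').
by exists p => //; split => //; exact: Di.
Qed.

End Charts.

Section BundleFormClosure.
Variables (R : realType) (m : nat) (M : manifold R m).
Variables (N : nat) (E : vbundle M N).
Implicit Types (eta : Eform E) (i : chart M) (j : tindex E).

Lemma open_triv i j : open (cimg i (tdom j)).
Proof. by apply: cimg_open; exact: tdom_open. Qed.

Lemma trans_inv j j' p : tdom j p -> tdom j' p ->
  trans j j' p *m trans j' j p = 1%:M.
Proof.
move=> jp j'p; have h w : trans j j' p *m trans j' j p *m w = w :> 'cV[R]_N.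
  by apply: (bij_inj (frame_bij jp)); rewrite -mulmxA -!transP.
apply/matrixP => a b.
have := congr1 (fun v : 'cV[R]_N => v a 0) (h (delta_mx b 0)).
by rewrite -colE !mxE !eqxx andbT.
Qed.

Lemma linear_mulmx p q r (A : 'M[R]_(p, q)) : linear (fun v : 'M[R]_(q, r) => A *m v).
Proof. by move=> a x y; rewrite mulmxDr scalemxAr. Qed.

Lemma Eform_homog k eta i j x : is_Eform k eta -> homog k (eta i j x).
Proof. by case=> _ h _ _; exact: h. Qed.

Lemma Eform_smooth k eta i j : is_Eform k eta ->
  ext_smooth_on (cimg i (tdom j)) (eta i j).
Proof. by case=> h _ _ _; exact: h. Qed.

Lemma Eform_out k eta i j x : is_Eform k eta ->
  ~ cimg i (tdom j) x -> eta i j x = 0.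
Proof. by case=> _ _ h _; exact: h. Qed.

Lemma Eform_trans k eta i i' j j' p : is_Eform k eta ->
  cdom i p -> cdom i' p -> tdom j p -> tdom j' p ->
  eta i j (cmap i p) = ext_map (fun v => trans j j' p *m v)
    (pullback (cjac i i' p) (eta i' j' (cmap i' p))).
Proof. by case=> _ _ _ h; exact: h. Qed.

Lemma trans_is_linear j j' (J : 'M[R]_m) p :
  linear (fun beta : ext m 'cV[R]_N =>
    ext_map (fun v => trans j j' p *m v) (pullback J beta)).
Proof.
move=> r x y; rewrite linearP.
exact: (linear_ext_map (@linear_mulmx _ _ _ _)).
Qed.

Lemma is_Eform0 k : is_Eform k (0 : Eform E).
Proof.
split=> [i j S|i j x S _|//|i i' j j' p _ _ _ _].
- have -> : (fun x => (0 : Eform E) i j x S) = (fun=> 0).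
    by apply/funext => x; rewrite ffunE.
  exact: smooth_on_cst.
- by rewrite ffunE.
- by apply/ffunP => S; rewrite linear0 !ffunE mulmx0.
Qed.

Lemma is_Eform_lincomb k r eta eta' : is_Eform k eta -> is_Eform k eta' ->
  is_Eform k (fun i j x => r *: eta i j x + eta' i j x : ext m 'cV[R]_N).
Proof.
move=> h h'; split=> [i j|i j x|i j x nx|i i' j j' p ip i'p jp j'p].
- have Do := @open_triv i j.
  apply: (ext_smoothD Do); last exact: Eform_smooth h'.
  by apply: (ext_smoothZ Do (smooth_on_cst (r : R^o))); exact: Eform_smooth h.
- by apply: homogD; [apply: homogZ|]; apply: Eform_homog.
- by rewrite (Eform_out h nx) (Eform_out h' nx) scaler0 addr0.
- rewrite trans_is_linear.
  by rewrite -(Eform_trans h ip i'p jp j'p) -(Eform_trans h' ip i'p jp j'p).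
Qed.

Lemma is_EformD k eta eta' : is_Eform k eta -> is_Eform k eta' ->
  is_Eform k (eta + eta' : Eform E).
Proof.
move=> h h'; have := is_Eform_lincomb 1 h h'.
congr is_Eform; apply/funext => i; apply/funext => j; apply/funext => x.
by rewrite scale1r.
Qed.

Lemma is_EformN k eta : is_Eform k eta -> is_Eform k (- eta : Eform E).
Proof.
move=> h; have := is_Eform_lincomb (-1) h (is_Eform0 k).
congr is_Eform; apply/funext => i; apply/funext => j; apply/funext => x.
by rewrite scaleN1r addr0.
Qed.

Lemma is_Eform_Lef omega k eta : is_scalar_form 2 omega -> is_Eform k eta ->
  is_Eform k.+2 (Lef omega eta : Eform E).
Proof.
case=> so ho _ to h; split=> [i j|i j x|i j x nx|i i' j j' p ip i'p jp j'p].
- have Do := @open_triv i j.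
  apply: (ext_smooth_wedge Do (@cbilin_scale _ _)); last exact: Eform_smooth h.
  move=> S vs x [p [ip _] <-]; apply: so; exact: cimg_cmap.
- exact: (homog_wedge bilin_scale (ho i tt x : homog 2 (omega i tt x)) (Eform_homog i j x h)).
- by rewrite /Lef (Eform_out h nx) (bilin0r (bilin_wedge bilin_scale)).
- rewrite /Lef (pullback_wedge _ _ bilin_scale (ho i' tt _)).
  rewrite (ext_map_wedge (b' := fun (r : R^o) (w : 'cV[R]_N) => (r : R) *: w)
     (h := fun r => r) (k := fun v => trans j j' p *m v)).
  + rewrite -(Eform_trans h ip i'p jp j'p); congr wedge.
    exact: (to i i' tt tt p ip i'p I I).
  + exact: linear_mulmx.
  + by move=> r v; rewrite -scalemxAr.
Qed.

Lemma is_Eform_End0 (Phi : Endform E) k eta : is_Endform 0 Phi -> is_Eform k eta ->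
  is_Eform k (fwedge mulmx Phi eta : Eform E).
Proof.
case=> so ho _ to h; split=> [i j|i j x|i j x nx|i i' j j' p ip i'p jp j'p].
- have Do := @open_triv i j.
  by apply: (ext_smooth_wedge Do (@cbilin_mulmx _ _ _ _)); [exact: so|exact: Eform_smooth h].
- exact: (homog_wedge bilin_mulmx (ho i j x : homog 0 (Phi i j x)) (Eform_homog i j x h)).
- by rewrite /fwedge (Eform_out h nx) (bilin0r (bilin_wedge bilin_mulmx)).
- rewrite /fwedge (pullback_wedge _ _ bilin_mulmx (ho i' j' _)).
  rewrite (ext_map_wedge (b' := fun (A : 'M[R]_N) (w : 'cV[R]_N) => A *m w)
     (h := fun B => trans j j' p *m B *m trans j' j p) (k := fun v => trans j j' p *m v)).
  + rewrite -(Eform_trans h ip i'p jp j'p); congr wedge.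
    exact: (to i i' j j' p ip i'p jp j'p).
  + exact: linear_mulmx.
  + move=> B v; rewrite -!mulmxA [trans j' j p *m _]mulmxA trans_inv //.
    by rewrite mul1mx.
Qed.

End BundleFormClosure.

(** * The covariant derivative under change of chart and trivialization *)

Section CovariantDerivative.
Variables (R : realType) (m : nat) (M : manifold R m).
Variables (N : nat) (E : vbundle M N) (A : Endform E).
Implicit Types (eta : Eform E) (i : chart M) (j : tindex E).

Lemma dAE eta i j x : cimg i (tdom j) x ->
  dA A eta i j x = extd (eta i j) x + wedge mulmx (A i j x) (eta i j x).
Proof.
move=> Dx; have -> : dA A eta i j x =
  fextd (@tdom _ _ _ _ E) eta i j x + fwedge mulmx A eta i j x by [].
by rewrite /fextd asboolT.
Qed.

Lemma dA_out k eta i j x : is_Eform k eta ->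
  ~ cimg i (tdom j) x -> dA A eta i j x = 0.
Proof.
move=> h nx; have -> : dA A eta i j x =
  fextd (@tdom _ _ _ _ E) eta i j x + fwedge mulmx A eta i j x by [].
rewrite /fextd asboolF // add0r /fwedge (Eform_out h nx).
exact: (bilin0r (bilin_wedge bilin_mulmx)).
Qed.

Hypothesis cA : is_connection A.

Lemma conn_smooth i j : ext_smooth_on (cimg i (tdom j)) (A i j).
Proof. by case: cA => h _ _ _; exact: h. Qed.

Lemma conn_homog i j x : homog 1 (A i j x).
Proof. by case: cA => _ h _ _; exact: h. Qed.

Section ChangeOfChart.
Variables (k : nat) (eta : Eform E).
Hypothesis h : is_Eform k eta.
Variables (i i' : chart M) (j j' : tindex E) (p : M).
Hypotheses (ip : cdom i p) (i'p : cdom i' p) (jp : tdom j p) (j'p : tdom j' p).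

Let D : set M := cdom i' `&` (tdom j `&` tdom j').
Let phi := cmap i' \o cinv i.
Let g : 'rV[R]_m -> 'M[R]_N := trans j j' \o cinv i.
Let x := cmap i p.
Let mulN (B : 'M[R]_N) (w : 'cV[R]_N) := B *m w.

Let Do : open (cimg i D).
Proof.
apply: cimg_open; apply: openI; first exact: cdom_open.
by apply: openI; exact: tdom_open.
Qed.

Let Dx : cimg i D x.
Proof. exact: cimg_cmap. Qed.

Let sphi : smooth_on (cimg i D) phi.
Proof. by apply: chart_change_smooth => q []. Qed.

Let phix : phi x = cmap i' p.
Proof. by rewrite /phi /x /= cmapK. Qed.

Let gx : g x = trans j j' p.
Proof. by rewrite /g /x /= cmapK. Qed.

Let dg : differentiable g x.
Proof.
apply: (smooth_on_differentiable (@trans_smooth _ _ _ _ E i j j')).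
exact: cimg_cmap.
Qed.

Let de : ext_differentiable (eta i' j') (phi x).
Proof.
rewrite phix; have Dy : cimg i' (tdom j') (cmap i' p) by exact: cimg_cmap.
exact: ext_smooth_differentiable (@Eform_smooth _ _ _ _ _ _ _ i' j' h) Dy.
Qed.

Let pb y := pullback ('J phi y) (eta i' j' (phi y)).

Let dpb : ext_differentiable pb x.
Proof. exact: (ext_differentiable_pullback Do sphi Dx de). Qed.

Let etaE y : cimg i D y -> eta i j y = ext_map (mulN (g y)) (pb y).
Proof.
case=> q [iq [i'q [jq j'q]]] <-.
rewrite (Eform_trans h iq i'q jq j'q) /pb /g /phi /= cmapK //.
Qed.

(** Near x the component is g times a pullback, g being the transition matrix. The Leibniz rule
    leaves a term with dg, which measures the failure of d to be covariant. *)
Lemma extd_trans : extd (eta i j) x =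
  wedge mulmx (covec (fun a => partial a g x))
    (pullback (cjac i i' p) (eta i' j' (cmap i' p))) +
  ext_map (fun v => trans j j' p *m v)
    (pullback (cjac i i' p) (extd (eta i' j') (cmap i' p))).
Proof.
have bm := @cbilin_mulmx R N N 1.
have nE : \forall y \near x, eta i j y = ext_map (mulN (g y)) (pb y).
  by apply: filterS (near_open Do Dx) => y; exact: etaE.
rewrite (near_eq_extd nE) extdE.
under eq_bigr => a _ do rewrite (ext_derive_map bm dg dpb) linearD.
rewrite big_split /=; congr (_ + _).
  rewrite wedge_covec_map; last exact: bilin_mulmx.
  by rewrite -phix.
have := extd_pullback Do sphi Dx de; rewrite -/pb phix => pE.
rewrite -gx -pE extdE linear_fun_sum; last exact/linear_ext_map/linear_mulmx.
apply: eq_bigr => a _; apply/ffunP => S; rewrite !ffunE.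
by case: ifP; rewrite ?mulmx0 // -scalemxAr.
Qed.

(** Multiplying the transformed connection g^-1 A g + g^-1 dg by g gives A g + dg, whose second
    summand accounts for the dg term of [extd_trans]. *)
Lemma dA_trans : dA A eta i j x = ext_map (fun v => trans j j' p *m v)
  (pullback (cjac i i' p) (dA A eta i' j' (cmap i' p))).
Proof.
rewrite !dAE; [|exact: cimg_cmap|exact: cimg_cmap].
rewrite extd_trans linearD /=.
have -> (y z : ext m 'cV[R]_N) : ext_map (fun v => trans j j' p *m v) (y + z) =
    ext_map (fun v => trans j j' p *m v) y + ext_map (fun v => trans j j' p *m v) z.
  by have := linear_ext_map (linear_mulmx (trans j j' p)) 1 y z; rewrite !scale1r.
rewrite addrAC addrC; congr (_ + _).
have [_ _ _ At] := cA.
rewrite (pullback_wedge _ _ bilin_mulmx (conn_homog i' j' _)) (At i i' j j' p) //.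
have wb := bilin_wedge (m := m) (@bilin_mulmx R N N 1).
rewrite (bilinDl wb) addrC.
have -> (y z : ext m 'cV[R]_N) : ext_map (fun v => trans j j' p *m v) (y + z) =
    ext_map (fun v => trans j j' p *m v) y + ext_map (fun v => trans j j' p *m v) z.
  by have := linear_ext_map (linear_mulmx (trans j j' p)) 1 y z; rewrite !scale1r.
have T'T := trans_inv j'p jp; have TT' := trans_inv jp j'p.
congr (_ + _).
- rewrite (ext_map_wedge (b' := fun (B : 'M[R]_N) (w : 'cV[R]_N) => B *m w)
    (h := fun C => trans j j' p *m C *m trans j' j p)
    (k := fun v => trans j j' p *m v)) ?ext_map_comp.
  + rewrite -(Eform_trans h ip i'p jp j'p); congr wedge.
    apply/ffunP => S; rewrite [RHS]ffunE.
    by rewrite -!mulmxA TT' mulmx1 mulmxA TT' mul1mx.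
  + exact: linear_mulmx.
  + by move=> u v; rewrite -!mulmxA [trans j' j p *m _]mulmxA T'T mul1mx.
- rewrite (ext_map_wedge (b' := fun (B : 'M[R]_N) (w : 'cV[R]_N) => B *m w)
    (h := fun C => trans j j' p *m C) (k := fun w => w)) ?ext_map_id ?ext_map_comp.
  + congr wedge.
    apply/ffunP => S; rewrite [RHS]ffunE.
    by rewrite mulmxA TT' mul1mx.
  + exact: linear_mulmx.
  + by move=> u v; rewrite mulmxA.
Qed.

End ChangeOfChart.

Lemma is_Eform_dA k eta : is_Eform k eta -> is_Eform k.+1 (dA A eta : Eform E).
Proof.
move=> h; split=> [i j|i j x|i j x nx|i i' j j' p ip i'p jp j'p].
- have Do := @open_triv _ _ _ _ E i j.
  apply: (ext_smooth_ext Do (fun x Dx => esym (dAE eta Dx))).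
  apply: (ext_smoothD Do).
    exact: (ext_smooth_extd Do (@Eform_smooth _ _ _ _ _ _ _ i j h)).
  apply: (ext_smooth_wedge Do (@cbilin_mulmx _ _ _ _)); first exact: conn_smooth.
  exact: Eform_smooth h.
- have [Dx|nx] := pselect (cimg i (tdom j) x); last first.
    by rewrite (dA_out h nx); exact: homog0.
  rewrite dAE //; apply: homogD; first by apply: homog_extd => y; exact: Eform_homog h.
  exact: (homog_wedge bilin_mulmx (conn_homog i j x) (Eform_homog i j x h)).
- exact: dA_out h nx.
- exact: (dA_trans h).
Qed.

End CovariantDerivative.

(** Since omega has even degree, L commutes with every e_a ([lef_mul]), and in degree 0 it commutes
    with coefficientwise linear maps; [homog_ind] does the rest. *)
Lemma wedge_lef (R : realType) m (U V W : lmodType R) (b : U -> V -> W)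
    (omega : ext m R^o) k (alpha : ext m U) (beta : ext m V) :
  bilin b -> homog 2 omega -> homog k alpha ->
  wedge b alpha (lef omega beta) = lef omega (wedge b alpha beta).
Proof.
move=> bb o2; have wb := bilin_wedge (m := m) bb.
have lo := bilin_wedge (m := m) (@bilin_scale R W).
move: k alpha; apply: homog_ind.
- by move=> x y xE yE; rewrite (bilinDl wb) xE yE (bilinDl wb) -(bilinDr lo).
- by move=> r x xE; rewrite (bilinZl wb) xE (bilinZl wb) -(bilinZr lo).
- move=> x hx; rewrite (wedge_homog0 _ bb hx) (wedge_homog0 _ bb hx) /lef.
  rewrite (ext_map_wedge (b' := fun (r : R^o) (w : W) => (r : R) *: w)
    (h := fun r => r) (k := b (x finset.set0))) ?ext_map_id //.
  + exact: bb.2.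
  + by move=> r v; exact: (bilinZr bb).
- by move=> k a x hx xE; rewrite !wedge_mull // xE lef_mul.
Qed.

Section ExtScale.
Variables (R : realType) (m : nat) (W : normedModType R).
Variables (r : R) (alpha : 'rV[R]_m -> ext m W) (x : 'rV[R]_m).
Hypothesis da : ext_differentiable alpha x.

Let scaleE S : (fun y => (r *: alpha y) S) = r *: (fun y => alpha y S).
Proof. by apply/funext => y; rewrite ffunE. Qed.

Lemma ext_differentiableZ : ext_differentiable (fun y => r *: alpha y) x.
Proof. by move=> S; rewrite scaleE; exact: differentiableZ. Qed.

Lemma extdZ : extd (fun y => r *: alpha y) x = r *: extd alpha x.
Proof.
rewrite !extdE scaler_sumr; apply: eq_bigr => a _.
rewrite -[RHS]linearZ /=; congr ext_mul; apply/ffunP => S.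
rewrite [RHS]ffunE; apply: etrans (ext_deriveE _ _ _ _) _.
rewrite scaleE; apply: etrans (deriveZ _ (diff_derivable (da S))) _.
by rewrite ext_deriveE.
Qed.

End ExtScale.

(** * Identities for d_A: linearity, commutation with L and Phi, curvature *)

Section Identities.
Variables (R : realType) (m : nat) (M : manifold R m).
Variables (N : nat) (E : vbundle M N) (A Phi : Endform E).
Variable omega : lform M unit R^o.
Implicit Types (eta : Eform E) (i : chart M) (j : tindex E).
Hypotheses (so : is_scalar_form 2 omega) (cA : is_connection A).

Lemma Eform_eq k eta eta' : is_Eform k eta -> is_Eform k eta' ->
  (forall i j x, cimg i (tdom j) x -> eta i j x = eta' i j x) -> eta = eta'.
Proof.
move=> h h' e; apply/funext => i; apply/funext => j; apply/funext => x.
have [/e//|nx] := pselect (cimg i (tdom j) x).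
by rewrite (Eform_out h nx) (Eform_out h' nx).
Qed.

Lemma omega_homog i x : homog 2 (omega i tt x).
Proof. by case: so => _ h _ _; exact: h. Qed.

Lemma omega_smooth i (D : set M) : ext_smooth_on (cimg i D) (omega i tt).
Proof.
case: so => h _ _ _ S vs x [p [ip _] <-]; apply: h; exact: cimg_cmap.
Qed.

Lemma Eform_diff k eta i j x : is_Eform k eta -> cimg i (tdom j) x ->
  ext_differentiable (eta i j) x.
Proof. by move=> h; apply: ext_smooth_differentiable (@Eform_smooth _ _ _ _ _ _ _ i j h). Qed.

Lemma dA_lincomb k r eta eta' : is_Eform k eta -> is_Eform k eta' ->
  dA A (fun i j x => r *: eta i j x + eta' i j x : ext m 'cV[R]_N) =
  (fun i j x => r *: dA A eta i j x + dA A eta' i j x).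
Proof.
move=> h h'; apply: (@Eform_eq k.+1); [exact/is_Eform_dA/is_Eform_lincomb| |].
  by apply: is_Eform_lincomb; exact: is_Eform_dA.
move=> i j x Dx; rewrite !dAE //.
have wb := bilin_wedge (m := m) (@bilin_mulmx R N N 1).
rewrite (bilinDr wb) (bilinZr wb) scalerDr addrACA; congr (_ + _).
have dx := Eform_diff h Dx; have dx' := Eform_diff h' Dx.
rewrite extdD //; last exact: ext_differentiableZ.
by rewrite extdZ //; exact: Eform_diff h Dx.
Qed.

Lemma dAD k eta eta' : is_Eform k eta -> is_Eform k eta' ->
  dA A (eta + eta' : Eform E) = dA A eta + dA A eta'.
Proof.
move=> h h'; have := dA_lincomb 1 h h'.
rewrite (_ : (fun i j x => _ + eta' i j x) = eta + eta').
  by move=> ->; apply/funext => i; apply/funext => j; apply/funext => x; rewrite scale1r.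
by apply/funext => i; apply/funext => j; apply/funext => x; rewrite scale1r.
Qed.

Lemma dA0 : dA A (0 : Eform E) = 0.
Proof.
apply: (addrI (dA A (0 : Eform E))).
by rewrite -(dAD (is_Eform0 E 0) (is_Eform0 E 0)) !addr0.
Qed.

Lemma dAN k eta : is_Eform k eta -> dA A (- eta : Eform E) = - dA A eta.
Proof.
move=> h; apply/eqP; rewrite -addr_eq0 -(dAD (is_EformN h) h) addNr dA0.
by [].
Qed.

Lemma dA_Lef k eta : fextd (@triv_dom R m M) omega = (fun _ _ _ => 0) -> is_Eform k eta ->
  dA A (Lef omega eta) = Lef omega (dA A eta).
Proof.
move=> co h; apply: (@Eform_eq k.+3).
- exact/is_Eform_dA/is_Eform_Lef.
- exact/is_Eform_Lef/is_Eform_dA.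
move=> i j x Dx; rewrite /Lef !dAE //.
have co0 : extd (omega i tt) x = 0.
  have := congr1 (fun f => f i tt x) co; rewrite /fextd asboolT //.
  by apply: cimgS Dx.
have dom : ext_differentiable (omega i tt) x.
  exact: ext_smooth_differentiable (@omega_smooth i (tdom j)) Dx.
have lo := bilin_wedge (m := m) (@bilin_scale R 'cV[R]_N).
rewrite (extd_wedge (@cbilin_scale R _) dom (Eform_diff h Dx) (@omega_homog i x)).
rewrite co0 (bilin0l lo) add0r sqrrN expr1n scale1r (bilinDr lo); congr (_ + _).
exact: (wedge_lef _ bilin_mulmx (@omega_homog i x) (@conn_homog _ _ _ _ _ _ cA i j x)).
Qed.

Let bm : bilin (fun (B : 'M[R]_N) (w : 'cV[R]_N) => B *m w) := @bilin_mulmx R N N 1.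
Let wb := bilin_wedge (m := m) bm.

Lemma wedge_mulmxA (B C : ext m 'M[R]_N) (beta : ext m 'cV[R]_N) :
  wedge mulmx B (wedge mulmx C beta) = wedge mulmx (wedge mulmx B C) beta.
Proof. by apply/esym/wedgeA => // u v w; rewrite mulmxA. Qed.

Lemma dA_dA k eta : curvature A = Lef omega Phi -> is_Eform k eta ->
  dA A (dA A eta) = Lef omega (fwedge mulmx Phi eta).
Proof.
move=> cE h.
have Eout i j x : ~ cimg i (tdom j) x ->
    dA A (dA A eta) i j x = Lef omega (fwedge mulmx Phi eta) i j x.
  move=> nx; rewrite (dA_out A (is_Eform_dA cA h) nx) /Lef /fwedge (Eform_out h nx).
  by rewrite (bilin0r wb) (bilin0r (bilin_wedge bilin_scale)).
apply/funext => i; apply/funext => j; apply/funext => x.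
have [Dx|/Eout//] := pselect (cimg i (tdom j) x).
have Do := @open_triv _ _ _ _ E i j.
have h' := is_Eform_dA cA h.
have sA := @conn_smooth _ _ _ _ _ _ cA i j.
have dAx := ext_smooth_differentiable sA Dx.
have se := @Eform_smooth _ _ _ _ _ _ _ i j h.
have de := ext_smooth_differentiable se Dx.
rewrite dAE //.
have nE : \forall y \near x, dA A eta i j y =
    extd (eta i j) y + wedge mulmx (A i j y) (eta i j y).
  by apply: filterS (near_open Do Dx) => y Dy; rewrite dAE.
rewrite (near_eq_extd nE) dAE // extdD; last first.
- exact: (ext_differentiable_wedge (@cbilin_mulmx _ _ _ _) dAx de).
- exact: (ext_smooth_differentiable (ext_smooth_extd Do se) Dx).
rewrite (extd_extd Do se Dx) add0r.
rewrite (extd_wedge (@cbilin_mulmx _ _ _ _) dAx de (@conn_homog _ _ _ _ _ _ cA i j x)).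
(* The Leibniz sign for the 1-form A makes the two terms A /\ d eta cancel, leaving (dA + A /\ A) /\
   eta. *)
rewrite expr1 scaleN1r (bilinDr wb) addrA subrK wedge_mulmxA -(bilinDl wb).
have cx : curvature A i j x = extd (A i j) x + wedge mulmx (A i j x) (A i j x).
  have -> : curvature A i j x =
    fextd (@tdom _ _ _ _ E) A i j x + fwedge mulmx A A i j x by [].
  by rewrite /fextd asboolT.
rewrite -cx cE /Lef /fwedge; apply: wedgeA => //; first exact: bilin_scale.
by move=> r B w; rewrite scalemxAl.
Qed.

Lemma dA_Phi k eta : is_Endform 0 Phi -> dA_End0 A Phi = 0 -> is_Eform k eta ->
  dA A (fwedge mulmx Phi eta) = fwedge mulmx Phi (dA A eta).
Proof.
move=> hP pE h; apply: (@Eform_eq k.+1).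
- exact/is_Eform_dA/is_Eform_End0.
- exact/is_Eform_End0/is_Eform_dA.
move=> i j x Dx; rewrite dAE // /fwedge dAE //.
have sP : ext_smooth_on (cimg i (tdom j)) (Phi i j) by case: hP => hs _ _ _; exact: hs.
have P0 : homog 0 (Phi i j x) by case: hP => _ hh _ _; exact: hh.
have dP := ext_smooth_differentiable sP Dx.
have de := Eform_diff h Dx.
rewrite (extd_wedge (@cbilin_mulmx _ _ _ _) dP de P0) scale1r (bilinDr wb).
rewrite addrAC addrC; congr (_ + _); rewrite !wedge_mulmxA -(bilinDl wb).
have px : extd (Phi i j) x + (wedge mulmx (A i j x) (Phi i j x) -
    wedge mulmx (Phi i j x) (A i j x)) = 0.
  have := congr1 (fun f : Endform E => f i j x) pE.
  have -> : dA_End0 A Phi i j x = fextd (@tdom _ _ _ _ E) Phi i j x +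
    (fwedge mulmx A Phi i j x - fwedge mulmx Phi A i j x) by [].
  by rewrite /fextd asboolT.
by move/eqP: px; rewrite addrA subr_eq0 => /eqP ->.
Qed.

End Identities.

(** * Lefschetz decomposition of forms *)

Section LefschetzForms.
Variables (R : realType) (n : nat) (M : manifold R n.*2).
Variables (N : nat) (E : vbundle M N).
Variable omega : lform M unit R^o.
Hypothesis symp : symplectic omega.
Implicit Types (eta gamma : Eform E) (i : chart M) (j : tindex E).
Local Notation m := n.*2.

Let so : is_scalar_form 2 omega. Proof. by case: symp. Qed.

Local Notation o2 i x := (@omega_homog _ _ _ _ so i x).

Lemma Lef_iterE r eta i j x :
  iter r (Lef omega) eta i j x = iter r (lef (omega i tt x)) (eta i j x).
Proof. by elim: r => //= r <-. Qed.

Lemma symplectic_nondeg i (D : set M) x : cimg i D x ->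
  forall u, (forall v, eval2 (omega i tt x) u v = 0) -> u = 0.
Proof. by case: symp => _ _ nd [p [ip _] <-]; apply: nd. Qed.

Let pi_ i x := coef2_inv (omega i tt x).

Let pil i D x : cimg i D x -> forall a c,
  \sum_b pi_ i x a b * coef2 (omega i tt x) b c = (a == c)%:R.
Proof. by move=> Dx a c; exact: coef2_invl (symplectic_nondeg Dx) a c. Qed.

Let pir i D x : cimg i D x -> forall a c,
  \sum_b coef2 (omega i tt x) a b * pi_ i x b c = (a == c)%:R.
Proof. by move=> Dx a c; exact: coef2_invr (symplectic_nondeg Dx) a c. Qed.

Lemma lef_iter_inj_at i (D : set M) x k r (alpha : ext m 'cV[R]_N) :
  cimg i D x -> homog k alpha -> (r + k <= n)%N ->
  iter r (lef (omega i tt x)) alpha = 0 -> alpha = 0.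
Proof.
by move=> Dx; exact: (lef_iter_inj (erefl m) (o2 i x) (pil Dx) (pir Dx)).
Qed.

Lemma coef2_inv_smooth i (D : set M) a b : open D ->
  smooth_on (cimg i D) (fun x => pi_ i x a b : R^o).
Proof.
move=> Do; have cDo := @cimg_open _ _ _ i _ Do.
apply: (smooth_on_invmx cDo) => [x Dx|c d].
  exact: coef2_mx_unit (symplectic_nondeg Dx).
have := ext_smooth_contr cDo c (@omega_smooth _ _ _ _ so i D) [set d]%SET.
by apply: (smooth_on_ext cDo) => x _; rewrite mxE.
Qed.

Definition Lef_part s gamma : Eform E :=
  fun i j x => lef_part n (pi_ i x) s (gamma i j x).

Section Part.
Variables (s : nat) (gamma : Eform E).
Hypotheses (sn : (s <= n)%N) (hg : is_Eform s.+1 gamma).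
Hypothesis Lg : iter (n - s).+1 (Lef omega) gamma = 0.

Let Lgx i j x : iter (n - s).+1 (lef (omega i tt x)) (gamma i j x) = 0.
Proof. by rewrite -Lef_iterE Lg. Qed.

Lemma Lef_part_out i j x : ~ cimg i (tdom j) x -> Lef_part s gamma i j x = 0.
Proof.
by move=> nx; rewrite /Lef_part (Eform_out hg nx) /lef_part linear0 scaler0.
Qed.

Let rest i j x : cimg i (tdom j) x ->
  iter (n - s).+1 (lef (omega i tt x)) (Lef_part s gamma i j x) =
  iter (n - s) (lef (omega i tt x)) (gamma i j x).
Proof.
move=> Dx.
have /eqP := lef_part_rest (erefl m) (o2 i x) (pil Dx) (pir Dx) sn
  (Eform_homog i j x hg) (Lgx i j x).
by rewrite lef_iterB subr_eq0 -iterSr => /eqP ->.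
Qed.

Lemma lef_trans i i' j j' p (w : ext m 'cV[R]_N) r :
  cdom i p -> cdom i' p ->
  iter r (lef (omega i tt (cmap i p)))
    (ext_map (fun v => trans j j' p *m v) (pullback (cjac i i' p) w)) =
  ext_map (fun v => trans j j' p *m v) (pullback (cjac i i' p)
    (iter r (lef (omega i' tt (cmap i' p))) w)).
Proof.
move=> ip i'p; elim: r w => [//|r IH] w; rewrite !iterS IH.
move: (iter r _ w) => {IH}w; rewrite /lef.
rewrite (pullback_wedge _ _ bilin_scale (o2 i' (cmap i' p))).
rewrite (ext_map_wedge (b' := fun (r : R^o) (w : 'cV[R]_N) => (r : R) *: w)
     (h := fun r => r) (k := fun v => trans j j' p *m v)).
- by have [_ _ _ to] := so; congr wedge; exact: (to i i' tt tt p ip i'p I I).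
- exact: linear_mulmx.
- by move=> c v; rewrite -scalemxAr.
Qed.

Lemma is_Eform_Lef_part : (0 < s)%N -> is_Eform s.-1 (Lef_part s gamma).
Proof.
move=> s0.
have hp i j x : homog s.-1 (Lef_part s gamma i j x).
  exact: homog_lef_part (Eform_homog i j x hg) s0.
split=> [i j|i j x|i j x nx|i i' j j' p ip i'p jp j'p].
- have Do := @open_triv _ _ _ _ E i j.
  apply: (ext_smoothZ Do (smooth_on_cst _)).
  apply: (ext_smooth_sum Do) => a _; apply: (ext_smooth_sum Do) => b _.
  apply: (ext_smoothZ Do); first exact/coef2_inv_smooth/tdom_open.
  apply/(ext_smooth_contr Do)/(ext_smooth_contr Do).
  exact: (@Eform_smooth _ _ _ _ _ _ _ i j hg).
- exact: hp.
- exact: Lef_part_out.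
- have Dx : cimg i (tdom j) (cmap i p) by exact: cimg_cmap.
  have Dx' : cimg i' (tdom j') (cmap i' p) by exact: cimg_cmap.
  apply/eqP; rewrite -subr_eq0; apply/eqP.
  (* The transformation of the inverse matrix is never computed: by [rest], L^(n-s+1) of the local
     form is L^(n-s) of gamma, which is global. Exponent n-s+1 and degree s-1 add up to n, the limit
     of injectivity. *)
  apply: (lef_iter_inj_at (k := s.-1) (r := (n - s).+1) Dx).
  + apply: homogB; first exact: hp.
    by apply: homog_ext_map; [exact: linear_mulmx|exact: homog_pullback].
  + lia.
  rewrite lef_iterB (rest Dx) lef_trans // (rest Dx') -lef_trans //.
  by rewrite -(Eform_trans hg ip i'p jp j'p) subrr.
Qed.

Lemma Lef_part_primitive : iter (n - s).+2 (Lef omega) (Lef_part s gamma) = 0.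
Proof.
apply/funext => i; apply/funext => j; apply/funext => x; rewrite Lef_iterE.
have [Dx|nx] := pselect (cimg i (tdom j) x); last first.
  by rewrite Lef_part_out // lef_iter0.
exact: (lef_part_primitive (n := n) (o2 i x) (pil Dx) (pir Dx)
  (Eform_homog i j x hg) (Lgx i j x)).
Qed.

Lemma Lef_part_rest :
  iter (n - s) (Lef omega) (gamma - Lef omega (Lef_part s gamma)) = 0.
Proof.
apply/funext => i; apply/funext => j; apply/funext => x; rewrite Lef_iterE.
have -> : (gamma - Lef omega (Lef_part s gamma)) i j x =
  gamma i j x - lef (omega i tt x) (Lef_part s gamma i j x) by [].
have [Dx|nx] := pselect (cimg i (tdom j) x).
  exact: (lef_part_rest (erefl m) (o2 i x) (pil Dx) (pir Dx) sn
    (Eform_homog i j x hg) (Lgx i j x)).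
by rewrite Lef_part_out // (Eform_out hg nx) linear0 subrr lef_iter0.
Qed.

Lemma Lef_part0 : s = 0%N -> Lef_part s gamma = 0.
Proof.
move=> s0; apply/funext => i; apply/funext => j; apply/funext => x.
exact: lef_part0 (Eform_homog i j x hg) s0.
Qed.

End Part.
End LefschetzForms.

(** * Primitive forms and uniqueness of the Lefschetz decomposition *)

Section Primitive.
Variables (R : realType) (n : nat) (M : manifold R n.*2).
Variables (N : nat) (E : vbundle M N).
Variable omega : lform M unit R^o.
Hypothesis symp : symplectic omega.
Implicit Types (eta beta : Eform E) (i : chart M) (j : tindex E).
Local Notation m := n.*2.

Let so : is_scalar_form 2 omega. Proof. by case: symp. Qed.
Local Notation o2 i x := (@omega_homog _ _ _ _ so i x).

Lemma iter_Lef_linear r (c : R) eta eta' :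
  iter r (Lef omega) (fun i j x => c *: eta i j x + eta' i j x) =
  (fun i j x => c *: iter r (Lef omega) eta i j x + iter r (Lef omega) eta' i j x)
  :> Eform E.
Proof.
apply/funext => i; apply/funext => j; apply/funext => x.
by rewrite !Lef_iterE lef_iter_is_linear.
Qed.

Lemma iter_Lef0 r : iter r (Lef omega) 0 = 0 :> Eform E.
Proof.
apply/funext => i; apply/funext => j; apply/funext => x.
by rewrite Lef_iterE; apply: lef_iter0.
Qed.

Lemma LefB eta eta' : Lef omega (eta - eta') = Lef omega eta - Lef omega eta' :> Eform E.
Proof.
apply/funext => i; apply/funext => j; apply/funext => x.
exact: (linearB (lef (omega i tt x))).
Qed.

Lemma LefD eta eta' : Lef omega (eta + eta') = Lef omega eta + Lef omega eta' :> Eform E.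
Proof.
apply/funext => i; apply/funext => j; apply/funext => x.
exact: (linearD (lef (omega i tt x))).
Qed.

Lemma primitive0 s : (s <= n)%N -> primitive omega s (0 : Eform E).
Proof. by move=> sn; split=> //; [exact: is_Eform0|exact: iter_Lef0]. Qed.

Lemma primitive_lincomb s (c : R) beta beta' :
  primitive omega s beta -> primitive omega s beta' ->
  primitive omega s (fun i j x => c *: beta i j x + beta' i j x : ext m 'cV[R]_N).
Proof.
case=> sn h L [_ h' L']; split=> //; first exact: is_Eform_lincomb.
rewrite (@iter_Lef_linear _ c beta beta') L L'.
by apply/funext => i; apply/funext => j; apply/funext => x; rewrite scaler0 addr0.
Qed.

Lemma primitiveB s beta beta' :
  primitive omega s beta -> primitive omega s beta' ->
  primitive omega s (beta - beta' : Eform E).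
Proof.
move=> h h'; have := primitive_lincomb (-1) h' h.
congr (primitive omega s _); apply/funext => i; apply/funext => j; apply/funext => x.
by rewrite scaleN1r addrC.
Qed.

Lemma sum_formE (s : seq nat) (P : pred nat) (F : nat -> Eform E) i j x :
  (\sum_(r <- s | P r) F r) i j x = \sum_(r <- s | P r) F r i j x.
Proof. exact: (big_morph (fun f : Eform E => f i j x) (id1 := 0) (op1 := +%R)). Qed.

Lemma lefschetz_unique_form k (delta : nat -> Eform E) :
  (forall r, (r <= k./2)%N ->
     primitive omega (k - r.*2) (delta r) \/ delta r = 0) ->
  \sum_(0 <= r < k./2.+1) iter r (Lef omega) (delta r) = 0 ->
  forall r, (r <= k./2)%N -> (k <= n + r)%N -> delta r = 0.
Proof.
move=> pd Sd r rk kr; apply/funext => i; apply/funext => j; apply/funext => x.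
have [Dx|nx] := pselect (cimg i (tdom j) x); last first.
  by have [[_ h _]|->] := pd r rk => //; rewrite (Eform_out h nx).
have nd := symplectic_nondeg symp Dx.
apply: (lefschetz_unique (erefl m) (o2 i x) (coef2_invl nd) (coef2_invr nd)
   (k := k) (delta := fun r => delta r i j x)) => //.
- move=> q qk; have [[_ h _]|->] := pd q qk; last exact: homog0.
  exact: Eform_homog h.
- by move=> q qk; have [[sn _ _]|->] := pd q qk; [left|right].
- move=> q qk; have [[_ _ h]|->] := pd q qk.
    by have := congr1 (fun f : Eform E => f i j x) h; rewrite Lef_iterE.
  exact: lef_iter0.
apply: etrans _ (congr1 (fun f : Eform E => f i j x) Sd); rewrite sum_formE.
by apply: eq_bigr => q _; rewrite Lef_iterE.
Qed.

Lemma is_lefschetz_unique k eta (beta beta' : nat -> Eform E) :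
  is_lefschetz omega k eta beta -> is_lefschetz omega k eta beta' -> beta = beta'.
Proof.
case=> p o e [p' o' e']; apply/funext => r.
have [rr|nr] := boolP (k - n <= r <= k./2)%N; last by rewrite o // o'.
apply/eqP; rewrite -subr_eq0; apply/eqP.
apply: (@lefschetz_unique_form k (fun r => beta r - beta' r)).
- move=> q qk; have [qq|nq] := boolP (k - n <= q <= k./2)%N.
    by left; apply: primitiveB; [exact: p|exact: p'].
  by right; rewrite o // o' // subrr.
- have iB q : iter q (Lef omega) (beta q - beta' q) =
      iter q (Lef omega) (beta q) - iter q (Lef omega) (beta' q).
    by elim: q (beta q) (beta' q) => //= q IH b b'; rewrite IH LefB.
  (* Components vanish below k - n, so the sum may start at 0, as [lefschetz_unique_form]
     requires. *)
  have full (b : nat -> Eform E) :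
      (forall q, ~~ (k - n <= q <= k./2)%N -> b q = 0) ->
      \sum_(0 <= q < k./2.+1) iter q (Lef omega) (b q) =
      \sum_(k - n <= q < k./2.+1) iter q (Lef omega) (b q).
    move=> ob; rewrite [RHS](@big_nat_widenl _ _ _ _ 0) // [RHS]big_mkcond /=.
    rewrite !big_nat; apply: eq_bigr => q /andP[_ qk].
    by case: ifPn => // kq; rewrite ob ?iter_Lef0 // negb_and kq.
  under eq_bigr => q _ do rewrite iB.
  by rewrite sumrB !full // -e -e' subrr.
- by case/andP: rr.
- by case/andP: rr; rewrite leq_subLR.
Qed.

(** Uniqueness makes the choice inside [lefschetz] return whichever decomposition has been
    exhibited. *)
Lemma lefschetzE k eta (beta : nat -> Eform E) :
  is_lefschetz omega k eta beta -> lefschetz omega k eta = beta.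
Proof.
move=> h; apply: (@is_lefschetz_unique k eta) => //.
exact: (@xgetPex _ 0 [set b | is_lefschetz omega k eta b] (ex_intro _ beta h)).
Qed.

(* Here eta has degree s + 1; it will be d_A of a primitive form of degree s. *)
Definition two_term s eta beta0 beta1 :=
  [/\ eta = beta0 + Lef omega beta1,
      (if (s < n)%N then primitive omega s.+1 beta0 else beta0 = 0),
      primitive omega s.-1 beta1 & s = 0%N -> beta1 = 0].

Lemma two_term_lefschetz s eta beta0 beta1 : (s <= n)%N ->
  two_term s eta beta0 beta1 ->
  is_lefschetz omega s.+1 eta
    (fun r => if r is r'.+1 then if r' is 0 then beta1 else 0 else beta0).
Proof.
move=> sn [e h0 h1 s0]; split.
- case=> [|[|r]] rr.
  + by rewrite double0 subn0; move: h0; case: ifP => // /negP; lia.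
  + by rewrite (_ : (s.+1 - 1.*2)%N = s.-1) //; lia.
  + by apply: primitive0; lia.
- case=> [|[|r]] // rr.
  + by move: h0; case: ifP => //; lia.
  + by apply: s0; lia.
(* The range of summation starts at 0 if s < n and at 1 if s = n, where beta0 = 0. For s = 0 it
   contains no index 1, and beta1 = 0; if n = 0 as well it is empty. *)
- rewrite e; case: s sn h0 h1 s0 {e} => [|s] sn h0 h1 s0.
    rewrite s0 // /=.
    have -> : Lef omega (0 : Eform E) = 0 by exact: (iter_Lef0 1).
    rewrite addr0; move: h0; case: ifP => n0 h0.
      by rewrite (_ : (1 - n)%N = 0%N) ?big_nat1 //; lia.
    by rewrite h0 big_geq //; lia.
  have -> : (s.+2)./2.+1 = (s./2).+2 by [].
  have big0 : \sum_(2 <= r < (s./2).+2) iter r (Lef omega)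
     (if r is r'.+1 then if r' is 0 then beta1 else 0 else beta0) = 0 :> Eform E.
    by rewrite big_nat big1 // => -[|[|r]] // _; rewrite iter_Lef0.
  have E1 : \sum_(1 <= r < (s./2).+2) iter r (Lef omega)
     (if r is r'.+1 then if r' is 0 then beta1 else 0 else beta0) = Lef omega beta1 :> Eform E.
    by rewrite big_ltn // big0 addr0.
  move: h0; case: ifP => ns h0.
    have -> : (s.+2 - n)%N = 0%N by lia.
    by rewrite big_ltn // E1.
  have -> : (s.+2 - n)%N = 1%N by lia.
  by rewrite E1 h0 add0r.
Qed.

Lemma two_term_Pi s eta beta0 beta1 : (s <= n)%N ->
  two_term s eta beta0 beta1 -> Pi_prim omega s.+1 eta = beta0.
Proof.
move=> sn h; rewrite /Pi_prim (lefschetzE (two_term_lefschetz sn h)).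
by case: h => _; case: ifP.
Qed.

Lemma two_term_Linv s eta beta0 beta1 : (s <= n)%N ->
  two_term s eta beta0 beta1 -> Linv omega s.+1 eta = beta1.
Proof.
move=> sn h; rewrite /Linv (lefschetzE (two_term_lefschetz sn h)).
rewrite (_ : maxn 1 (s.+1 - n) = 1%N); last by lia.
case: h => _ _ _; case: s sn => [|s] sn s0.
  by rewrite big_geq // s0.
rewrite big_ltn // big_nat big1 ?addr0 // => -[|[|r]] // _.
exact: iter_Lef0.
Qed.

End Primitive.

(** * The primitive complex *)

Section PrimitiveDerivatives.
Variables (R : realType) (n : nat) (M : manifold R n.*2).
Variables (N : nat) (E : vbundle M N).
Variable omega : lform M unit R^o.
Variables A Phi : Endform E.
Hypotheses (symp : symplectic omega) (cA : is_connection A).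
Hypothesis sflat : symplectically_flat omega A Phi.
Implicit Types (eta beta : Eform E).

Let so : is_scalar_form 2 omega. Proof. by case: symp. Qed.
Let co : fextd (@triv_dom R n.*2 M) omega = (fun _ _ _ => 0).
Proof. by case: symp. Qed.
Let hPhi : is_Endform 0 Phi. Proof. by case: sflat. Qed.
Let curvE : curvature A = Lef omega Phi. Proof. by case: sflat. Qed.
Let dPhi : dA_End0 A Phi = 0. Proof. by case: sflat. Qed.

Local Notation prim := (@primitive R n M omega N E).
Local Notation dp := (dplus omega A).
Local Notation dm := (dminus omega A).
Local Notation L := (@Lef R n.*2 M (tindex E) 'cV[R]_N omega).
Local Notation phi eta := (fwedge mulmx Phi eta : Eform E).

Lemma Lef0 : L (0 : Eform E) = 0.
Proof. exact: (iter_Lef0 E omega 1). Qed.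

Lemma primitiveD s beta beta' : prim s beta -> prim s beta' -> prim s (beta + beta').
Proof.
move=> p p'; have [sn _ _] := p.
rewrite -[beta']opprK -[- beta']add0r.
by apply: primitiveB => //; apply: primitiveB => //; exact: primitive0.
Qed.

Lemma dA_iter_Lef k r beta : is_Eform k beta ->
  is_Eform (k + r.*2) (iter r L beta) /\
  dA A (iter r L beta) = iter r L (dA A beta).
Proof.
move=> h; elim: r => [|r [IHh IHd]]; first by rewrite addn0.
rewrite doubleS !addnS !iterS; split; first exact: is_Eform_Lef.
by rewrite (dA_Lef so cA co IHh) IHd.
Qed.

Lemma dA_two_term s beta : prim s beta ->
  exists beta0 beta1, two_term omega s (dA A beta) beta0 beta1.
Proof.
case=> sn h Lb; set gamma := dA A beta.
have hg : is_Eform s.+1 gamma by exact: is_Eform_dA.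
have Lg : iter (n - s).+1 L gamma = 0.
  by have [_ <-] := dA_iter_Lef (n - s).+1 h; rewrite Lb dA0.
have hb1 : (0 < s)%N -> is_Eform s.-1 (Lef_part omega s gamma).
  exact: is_Eform_Lef_part.
have b10 : s = 0%N -> Lef_part omega s gamma = 0.
  by move=> s0; exact: Lef_part0 hg s0.
have Lr := Lef_part_rest symp sn hg Lg.
exists (gamma - L (Lef_part omega s gamma)), (Lef_part omega s gamma).
split=> //; first by rewrite subrK.
  case: ifP => ns; last first.
    by move: Lr; rewrite (_ : (n - s)%N = 0%N) //; lia.
  split=> //; last by rewrite (_ : (n - s.+1).+1 = (n - s)%N) //; lia.
  apply: is_EformD => //; apply: is_EformN.
  have [s0|s0] := posnP s.
    by rewrite (b10 s0) Lef0; exact: is_Eform0.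
  have := is_Eform_Lef so (hb1 s0); rewrite (_ : s.-1.+2 = s.+1) //; lia.
have [s0|s0] := posnP s; first by rewrite (b10 s0); apply: primitive0; lia.
split; [lia|exact: hb1|].
by rewrite (_ : (n - s.-1)%N = (n - s).+1) ?(Lef_part_primitive symp hg Lg) //; lia.
Qed.

Lemma dplus_dminus s beta : prim s beta ->
  two_term omega s (dA A beta) (dp s beta) (dm s beta).
Proof.
move=> pb; have [sn _ _] := pb; have [b0 [b1 h]] := dA_two_term pb.
by rewrite /dplus /dminus (two_term_Pi symp sn h) (two_term_Linv symp sn h).
Qed.

(** Uniqueness as a rule of computation: additivity of d+ and d- and their commutation with Phi are
    proved by exhibiting a two-term decomposition. *)
Lemma dplus_dminusE s beta beta0 beta1 : (s <= n)%N ->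
  two_term omega s (dA A beta) beta0 beta1 ->
  dp s beta = beta0 /\ dm s beta = beta1.
Proof.
move=> sn h.
by rewrite /dplus /dminus (two_term_Pi symp sn h) (two_term_Linv symp sn h).
Qed.

Lemma dplus_primitive s beta : (s < n)%N -> prim s beta -> prim s.+1 (dp s beta).
Proof. by move=> sn /dplus_dminus[_]; rewrite sn. Qed.

Lemma dplus_top s beta : (n <= s)%N -> prim s beta -> dp s beta = 0.
Proof. by move=> ns /dplus_dminus[_]; rewrite ltnNge ns. Qed.

Lemma dminus_primitive s beta : prim s beta -> prim s.-1 (dm s beta).
Proof. by case/dplus_dminus. Qed.

Lemma dminus0 s beta : s = 0%N -> prim s beta -> dm s beta = 0.
Proof. by move=> s0 /dplus_dminus[_ _ _]; apply. Qed.

Lemma dA_primitiveE s beta : prim s beta -> dA A beta = dp s beta + L (dm s beta).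
Proof. by case/dplus_dminus. Qed.

Lemma two_termB s eta eta' b0 b1 b0' b1' :
  two_term omega s eta b0 b1 -> two_term omega s eta' b0' b1' ->
  two_term omega s (eta - eta') (b0 - b0') (b1 - b1').
Proof.
case=> -> h0 h1 s0 [-> h0' h1' s0']; split.
- by rewrite LefB opprD addrACA.
- move: h0 h0'; case: ifP => _ => [p p'|-> ->]; last by rewrite subrr.
  exact: primitiveB.
- exact: primitiveB.
- by move=> z; rewrite s0 // s0' // subrr.
Qed.

Lemma dplus_dminusB s beta beta' : prim s beta -> prim s beta' ->
  dp s (beta - beta') = dp s beta - dp s beta' /\
  dm s (beta - beta') = dm s beta - dm s beta'.
Proof.
move=> p p'; have [sn h _] := p; have [_ h' _] := p'.
apply: dplus_dminusE => //.
rewrite (dAD cA h (is_EformN h')) (dAN cA h').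
by apply: two_termB; exact: dplus_dminus.
Qed.

Lemma dplus_dminus0 s : (s <= n)%N ->
  dp s (0 : Eform E) = 0 /\ dm s (0 : Eform E) = 0.
Proof.
move=> sn; have p0 := primitive0 E omega sn.
by have := dplus_dminusB p0 p0; rewrite !subrr.
Qed.

Lemma Lef_Phi k eta : is_Eform k eta -> L (phi eta) = phi (L eta).
Proof.
move=> h; apply/funext => i; apply/funext => j; apply/funext => x.
have P0 : homog 0 (Phi i j x) by case: hPhi => _ hh _ _; exact: hh.
exact: esym (wedge_lef _ bilin_mulmx (@omega_homog _ _ _ _ so i x) P0).
Qed.

Lemma Phi0 : phi (0 : Eform E) = 0.
Proof.
apply/funext => i; apply/funext => j; apply/funext => x.
exact: (bilin0r (bilin_wedge bilin_mulmx)).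
Qed.

Lemma PhiD eta eta' : phi (eta + eta') = phi eta + phi eta'.
Proof.
apply/funext => i; apply/funext => j; apply/funext => x.
exact: (bilinDr (bilin_wedge bilin_mulmx)).
Qed.

Lemma Phi_primitive s beta : prim s beta -> prim s (phi beta).
Proof.
case=> sn h Lb; split=> //; first exact: is_Eform_End0.
suff -> r : iter r L (phi beta) = phi (iter r L beta) by rewrite Lb Phi0.
elim: r => //= r ->; exact: Lef_Phi (dA_iter_Lef r h).1.
Qed.

Lemma dplus_dminus_Phi s beta : prim s beta ->
  dp s (phi beta) = phi (dp s beta) /\ dm s (phi beta) = phi (dm s beta).
Proof.
move=> p; have [sn h _] := p; have [e h0 h1 s0] := dplus_dminus p.
apply: dplus_dminusE => //; rewrite (dA_Phi cA hPhi dPhi h) e; split.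
- by have [_ h' _] := h1; rewrite PhiD (Lef_Phi h').
- move: h0; case: ifP => _ => [p0|->]; [exact: Phi_primitive|exact: Phi0].
- exact: Phi_primitive.
- by move=> z; rewrite s0 // Phi0.
Qed.

(* Comparing the Lefschetz components of d_A^2 beta = omega /\ Phi beta. *)
Lemma derivative_relations s beta : prim s beta ->
  [/\ (s < n)%N -> dp s.+1 (dp s beta) = 0,
      (s < n)%N -> dm s.+1 (dp s beta) + dp s.-1 (dm s beta) = phi beta
    & dm s.-1 (dm s beta) = 0].
Proof.
move=> p; have [sn h _] := p.
have pm := dminus_primitive p; have [pn hm _] := pm.
(* The components of L^0, L^1 and L^2 in d_A (d_A beta) - L (Phi beta). For s = n the form d+ beta
   is zero and degree s+1 exceeds the primitive range, whence the conditionals. *)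
pose u := if (s < n)%N then dp s.+1 (dp s beta) else 0.
pose v := (if (s < n)%N then dm s.+1 (dp s beta) else 0) + dp s.-1 (dm s beta) - phi beta.
pose w := dm s.-1 (dm s beta).
have dpE : dA A (dp s beta) = u + L (if (s < n)%N then dm s.+1 (dp s beta) else 0).
  rewrite /u; case: ifP => ns; first exact: dA_primitiveE (dplus_primitive ns p).
  by rewrite dplus_top ?dA0 ?add0r ?Lef0 // leqNgt ns.
have sum0 : u + L v + L (L w) = 0.
  have hp : is_Eform s.+1 (dp s beta).
    have [ns|ns] := ltnP s n; first by have [] := dplus_primitive ns p.
    by rewrite (dplus_top ns p); exact: is_Eform0.
  have hLm : is_Eform s.+1 (L (dm s beta)).
    have [s0|s0] := posnP s.
      by rewrite (dminus0 s0 p) Lef0; exact: is_Eform0.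
    by have := is_Eform_Lef so hm; rewrite prednK.
  have := dA_dA cA curvE h.
  rewrite (dA_primitiveE p) (dAD cA hp hLm) (dA_Lef so cA co hm) dpE.
  rewrite (dA_primitiveE pm) LefD => /eqP; rewrite -subr_eq0 => /eqP <-.
  have regroup (V : zmodType) (y a b c z : V) :
      y + (a + b - c) + z = y + a + (b + z) - c.
    by rewrite !addrA [RHS]addrAC.
  by rewrite /v LefB LefD; exact: regroup.
pose delta r : Eform E := if r is r'.+1 then
   (if r' is r''.+1 then (if r'' is 0 then w else 0) else v) else u.
(* For s < 2 the degree s+2 leaves no room for a term with L^2, so its coefficient must vanish
   beforehand. *)
have w0 : (s < 2)%N -> w = 0.
  move=> s2; rewrite /w; case: s s2 p pm {pn h hm dpE sum0 sn u v w delta} => [|[|//]] _ p pm.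
    by rewrite (dminus0 _ p) //; apply: (dplus_dminus0 _).2.
  exact: dminus0.
have pd r : (r <= s.+2./2)%N -> prim (s.+2 - r.*2) (delta r) \/ delta r = 0.
  case: r => [|[|[|r]]] rs /=; last by right.
  - rewrite /u; case: ifP => ns; last by right.
    have pp := dplus_primitive ns p.
    have [ns1|ns1] := ltnP s.+1 n; first by left; exact: dplus_primitive.
    by right; exact: dplus_top.
  - left; rewrite (_ : (s.+2 - 1.*2)%N = s); last by lia.
    apply: primitiveB; last exact: Phi_primitive.
    apply: primitiveD.
      case: ifP => ns; last exact: primitive0.
      exact: (dminus_primitive (dplus_primitive ns p)).
    have [s0|s0] := posnP s.
      rewrite (dminus0 s0 p) (dplus_dminus0 pn).1; exact: primitive0.
    have sp : (s.-1 < n)%N by lia.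
    by have := dplus_primitive sp pm; rewrite prednK.
  - left; rewrite (_ : (s.+2 - 2.*2)%N = s.-1.-1); last by lia.
    exact: dminus_primitive.
have sd : \sum_(0 <= r < s.+2./2.+1) iter r L (delta r) = 0.
  rewrite -[RHS]sum0 -addrA big_ltn //; congr (_ + _).
  rewrite big_ltn //; congr (_ + _).
  have [s2|s2] := ltnP s 2; first by rewrite big_geq ?w0 ?Lef0 //; lia.
  rewrite big_ltn; last by lia.
  rewrite big_nat big1 ?addr0 // => -[|[|[|r]]] // _.
  exact: iter_Lef0.
(* [D] applies to index r when s+2 <= n+r: index 2 always qualifies, index 1 for s < n, index 0 for
   s+2 <= n. The remaining case s+1 = n of d+ d+ = 0 holds because d+ vanishes in degree n. *)
have D := lefschetz_unique_form symp pd sd.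
split=> [ns|ns|].
- have [ns1|ns1] := ltnP s.+1 n; last exact: (dplus_top ns1 (dplus_primitive ns p)).
  have sn0 : (s.+2 <= n + 0)%N by rewrite addn0.
  by have := D 0%N isT sn0; rewrite /delta /u ns.
- have sn1 : (s.+2 <= n + 1)%N by lia.
  have := D 1%N isT sn1; rewrite /delta /v ns => /eqP.
  by rewrite subr_eq0 => /eqP.
- have [s2|s2] := ltnP s 2; first exact: w0.
  have s2' : (2 <= s.+2./2)%N by lia.
  have sn2 : (s.+2 <= n + 2)%N by lia.
  exact: D 2%N s2' sn2.
Qed.

Lemma dplus_dplus s beta : (s < n)%N -> prim s beta -> dp s.+1 (dp s beta) = 0.
Proof. by move=> sn /derivative_relations[h _ _]; exact: h. Qed.

Lemma dminus_dminus s beta : prim s beta -> dm s.-1 (dm s beta) = 0.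
Proof. by case/derivative_relations. Qed.

Lemma dminus_dplus s beta : (s < n)%N -> prim s beta ->
  dm s.+1 (dp s beta) = phi beta - dp s.-1 (dm s beta).
Proof. by move=> sn /derivative_relations[_ h _]; rewrite -h // addrK. Qed.

Lemma dplus_dplus_pred s beta : prim s beta -> dp s (dp s.-1 (dm s beta)) = 0.
Proof.
move=> p; have [sn _ _] := p; have pm := dminus_primitive p; have [pn _ _] := pm.
have [s0|s0] := posnP s.
  by rewrite (dminus0 s0 p) (dplus_dminus0 pn).1 (dplus_dminus0 sn).1.
have sp : (s.-1 < n)%N by lia.
by have := dplus_dplus sp pm; rewrite prednK.
Qed.

Lemma middle_primitive beta : prim n beta ->
  prim n (- dp n.-1 (dm n beta) + phi beta).
Proof.
move=> p; rewrite addrC; apply: primitiveB; first exact: Phi_primitive.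
have pm := dminus_primitive p; have [pn _ _] := pm.
have [n0|n0] := posnP n.
  by rewrite (dminus0 n0 p) (dplus_dminus0 pn).1; exact: primitive0.
have sp : (n.-1 < n)%N by lia.
by have := dplus_primitive sp pm; rewrite prednK.
Qed.

(** In degree n-1 one has d- d+ = Phi - d+ d-. Applying d+ and using d+ d+ = 0 gives d+ d- d+ = d+
    Phi = Phi d+. *)
Lemma middle_dplus beta : (0 < n)%N -> prim n.-1 beta ->
  - dp n.-1 (dm n (dp n.-1 beta)) + phi (dp n.-1 beta) = 0.
Proof.
move=> n0 p; have sp : (n.-1 < n)%N by lia.
have pm := dminus_primitive p; have [pn _ _] := pm.
have := dminus_dplus sp p; rewrite prednK // => ->.
have pd : prim n.-1 (dp n.-1.-1 (dm n.-1 beta)).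
  have [n1|n1] := posnP n.-1.
    rewrite (dminus0 n1 p) (dplus_dminus0 pn).1; apply: primitive0; lia.
  have sp1 : (n.-1.-1 < n)%N by lia.
  by have := dplus_primitive sp1 pm; rewrite prednK.
rewrite (dplus_dminusB (Phi_primitive p) pd).1 (dplus_dplus_pred p) subr0.
by rewrite (dplus_dminus_Phi p).1 addNr.
Qed.

(** The relation is applied to d- beta, which has degree n-1: d- d+ d- = Phi d- - d+ d- d- = Phi d-,
    by d- d- = 0. *)
Lemma dminus_middle beta : (0 < n)%N -> prim n beta ->
  dm n (- dp n.-1 (dm n beta) + phi beta) = 0.
Proof.
move=> n0 p; have sp : (n.-1 < n)%N by lia.
have pm := dminus_primitive p.
have pd : prim n (dp n.-1 (dm n beta)).
  by have := dplus_primitive sp pm; rewrite prednK.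
rewrite addrC (dplus_dminusB (Phi_primitive p) pd).2 (dplus_dminus_Phi p).2.
have := dminus_dplus sp pm; rewrite prednK // => ->.
rewrite (dminus_dminus p) opprB addrC subrK.
by apply: (dplus_dminus0 _).1; lia.
Qed.

Lemma dminusN s beta : prim s beta -> dm s (- beta) = - dm s beta.
Proof.
move=> p; have [sn _ _] := p; have p0 := primitive0 E omega sn.
by have [_] := dplus_dminusB p0 p; rewrite !sub0r (dplus_dminus0 sn).2 sub0r.
Qed.

End PrimitiveDerivatives.

Theorem mainTheorem2 (R : realType) (n : nat) (M : manifold R n.*2)
    (omega : lform M unit R^o) (N : nat) (E : vbundle M N)
    (A Phi : Endform E) :
  symplectic omega ->
  is_connection A ->
  symplectically_flat omega A Phi ->
  differential_complex (cplx_space omega E) (cplx_map omega A Phi).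
Proof.
move=> symp cA sflat; split=> k x; rewrite /cplx_space /cplx_map.
  have [kn|kn|->] := ltngtP k n.
  - exact: dplus_primitive.
  - have [k2|k2] := leqP k n.*2.
      rewrite (leqW k2) ltnS k2 => p.
      rewrite -sub0r; apply: primitiveB; first by apply: primitive0; lia.
      have := dminus_primitive symp cA p.
      by rewrite (_ : (n.*2.+1 - k).-1 = (n.*2.+1 - k.+1)%N) //; lia.
    (* From position 2n+1 on the map is zero and its target is the zero space. *)
    by have -> : (k < n.*2.+1)%N = false by lia.
  - have -> : (n < n.*2.+1)%N by lia.
    have -> : (n.*2.+1 - n.+1)%N = n by lia.
    exact: middle_primitive.
have [kn|kn|->] := ltngtP k n.
(* The next map is again d+ unless k+1 = n, where it is the second-order middle map. *)
- move=> p; have [k1|k1|k1] := ltngtP k.+1 n.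
  + exact: (dplus_dplus symp cA sflat kn p).
  + lia.
  + have n0 : (0 < n)%N by lia.
    have kE : k = n.-1 by lia.
    by move: p; rewrite kE => p; exact: (middle_dplus symp cA sflat n0 p).
- have -> : (k.+1 < n)%N = false by lia.
  have -> : (k.+1 == n) = false by lia.
  have [k2|k2] := leqP k n.*2; last by have -> : (k < n.*2)%N = false by lia.
  rewrite (leqW k2) => p; case: ifP => // k21.
  have := dminus_dminus symp cA sflat p.
  have pm := dminus_primitive symp cA p.
  have kE : (n.*2.+1 - k).-1 = (n.*2.+1 - k.+1)%N by lia.
  rewrite kE in pm *; rewrite (dminusN symp cA pm) => ->.
  by rewrite oppr0 oppr0.
- have -> : (n.+1 < n)%N = false by lia.
  have -> : (n.+1 == n) = false by lia.
  (* For n = 0 the middle map is followed directly by the final zero map; otherwise the next map is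
     -d- on degree n. *)
  case: ifP => // n2 p; have n0 : (0 < n)%N by lia.
  have -> : (n.*2.+1 - n.+1)%N = n by lia.
  by rewrite (dminus_middle symp cA sflat n0 p) oppr0.
Qed.
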